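(* Let $G$ be a group with presentation $\langle x,t\mid w\rangle$, where $w$ is a principal word in the free group on $x,t$. Write $A_w(X)=a_0+\dots+a_{d-1}X^{d-1}-mX^d$, where $d\ge 1$ is the degree of $A_w(X)$, and assume that $\gcd\{a_0,\dots,a_{d-1}\}=1$ and that $a_{d-1}$ is not divisible by $m$. If all (complex) roots of $A_w(X)$ are real and positive, then $G$ is bi-orderable.
   Context: A group $G$ is bi-orderable if there is a total order $<$ on $G$ such that $u<v$ implies $ux<vx$ and $xu<xv$ for all $u,v,x\in G$. Write $a^b=b^{-1}ab$. Let $F$ be the free group on $x,t$ and $N$ the normal subgroup of $F$ generated by $x$; $N'$ is its derived subgroup. Let $w\in F$ be a non-identity element with exponent sum of $t$ equal to zero. Then $w\in N$ and $w$ is given by an expression $$w=(x^{m_1})^{t^{d_1}}\cdots (x^{m_r})^{t^{d_r}}$$ with $r\ge 1$ and integers $d_i,m_i$. For $j\in\mathbb{Z}$ let $\tau_j(w)=\{i\mid d_i=j\}$ (with respect to this expression) and $S_w=\{j\mid \sum_{i\in\tau_j(w)}m_i\ne 0\}$; $S_w=\emptyset$ if and only if $w\in N'$. If $w\in N\setminus N'$, let $e_w$ and $d_w$ be the smallest and largest elements of $S_w$, and let $A_w(X)=\sum_{i=1}^r m_iX^{d_i-e_w}$, a polynomial in $\mathbb{Z}[X]$ of degree $d_w-e_w$ with non-zero constant coefficient. The word $w$ is tidy if $w\in N\setminus N'$ and $\tau_j(w)=\emptyset$ for all $j>d_w$ and all $j<e_w$. It is principal if it is tidy and $\tau_{d_w}(w)$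 contains exactly one element. *)

(* Defs.v *)
From HB Require Import structures.
From mathcomp Require Import all_boot all_order all_algebra.
From mathcomp Require Export reals complex.

Set Implicit Arguments.
Unset Strict Implicit.
Unset Printing Implicit Defensive.

Import Order.TTheory GRing.Theory Num.Theory.

Section FreeGroup.
Variable T : choiceType.

(* The letter (a, true) stands for a and (a, false) for its inverse. *)
Local Notation letter := (T * bool)%type.

Definition linv (a : letter) : letter := (a.1, ~~ a.2).

Definition reduced (s : seq letter) := sorted (fun a b => b != linv a) s.

Definition push (a : letter) (s : seq letter) : seq letter :=
  if s is b :: s' then (if b == linv a then s' else a :: s) else [:: a].

Lemma linvK : involutive linv.
Proof. by case=> a b; rewrite /linv /= negbK. Qed.

Lemma reduced_push a s : reduced s -> reduced (push a s).
Proof.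
case: s => //= b s rs; case: eqP => [_|/eqP nba]; first exact: path_sorted rs.
by rewrite /reduced /= nba.
Qed.

Lemma pushK a s : reduced s -> push (linv a) (push a s) = s.
Proof.
case: s => [|b s] /=; first by rewrite linvK eqxx.
case: eqP => [-> rs|_ _] /=; last by rewrite linvK eqxx.
by case: s rs => //= c s /andP[/negPf-> _].
Qed.

Lemma pushVK a s : reduced s -> push a (push (linv a) s) = s.
Proof. by move=> rs; rewrite -{1}[a]linvK pushK. Qed.

Lemma reduced_foldr u s : reduced s -> reduced (foldr push s u).
Proof. by move=> rs; elim: u => //= a u; apply: reduced_push. Qed.

Lemma foldr_push a u s : reduced s ->
  foldr push s (push a u) = push a (foldr push s u).
Proof.
move=> rs; case: u => //= b u; case: eqP => //= ->.
by rewrite pushVK // reduced_foldr.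
Qed.

Lemma foldr_foldr u v s : reduced s ->
  foldr push s (foldr push v u) = foldr push (foldr push s v) u.
Proof. by move=> rs; elim: u => //= a u <-; rewrite foldr_push. Qed.

Lemma foldr_nil u : reduced u -> foldr push [::] u = u.
Proof.
elim: u => //= a u IHu ru; rewrite IHu; last exact: path_sorted ru.
by case: u ru {IHu} => //= b u /andP[/negPf-> _].
Qed.

Definition winv (s : seq letter) := rev (map linv s).

Lemma winvK : involutive winv.
Proof. by move=> s; rewrite /winv map_rev revK (mapK linvK). Qed.

Lemma reduced_winv s : reduced s -> reduced (winv s).
Proof.
rewrite /reduced /winv rev_sorted sorted_map; apply: sub_sorted => a b.
by apply: contra => /eqP eq_ab; apply/eqP; rewrite -[LHS]linvK; symmetry.
Qed.

Lemma foldr_winv u s : reduced s -> foldr push (foldr push s u) (winv u) = s.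
Proof.
move=> rs; elim: u => //= a u IHu.
by rewrite /winv /= rev_cons foldr_rcons pushK ?IHu // reduced_foldr.
Qed.

Record fgroup := FGroup { fgword :> seq letter; _ : reduced fgword }.
HB.instance Definition _ := [isSub for fgword].
HB.instance Definition _ := [Choice of fgroup by <:].

Lemma fgwordP (u : fgroup) : reduced u. Proof. exact: valP. Qed.

Definition fg_one := @FGroup [::] isT.
Definition fg_inv (u : fgroup) := FGroup (reduced_winv (fgwordP u)).
Definition fg_mul (u v : fgroup) := FGroup (reduced_foldr u (fgwordP v)).

Lemma fg_mulA : associative fg_mul.
Proof. by move=> u v w; apply/val_inj; rewrite /= foldr_foldr ?fgwordP. Qed.

Lemma fg_mul1 : left_id fg_one fg_mul.
Proof. by move=> u; apply/val_inj. Qed.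

Lemma fg_mulr1 : right_id fg_one fg_mul.
Proof. by move=> u; apply/val_inj; rewrite /= foldr_nil ?fgwordP. Qed.

Lemma fg_mulV : left_inverse fg_one fg_inv fg_mul.
Proof.
move=> u; apply/val_inj.
by rewrite /= -[X in foldr _ X]foldr_nil ?fgwordP // foldr_winv.
Qed.

Lemma fg_mulVr : right_inverse fg_one fg_inv fg_mul.
Proof.
move=> u; have uu : fg_inv (fg_inv u) = u by apply/val_inj; rewrite /= winvK.
by rewrite -{1}uu fg_mulV.
Qed.

HB.instance Definition _ :=
  isGroup.Build fgroup fg_mulA fg_mul1 fg_mulr1 fg_mulV fg_mulVr.

Definition fg_gen (a : T) := @FGroup [:: (a, true)] isT.

End FreeGroup.

Local Open Scope group_scope.

Section Groups.
Variable G : groupType.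

Definition expgz (g : G) (n : int) : G :=
  match n with Posz k => g ^+ k | Negz k => g ^- k.+1 end.

Inductive gen_subgroup (P : G -> Prop) : G -> Prop :=
| gen_in g : P g -> gen_subgroup P g
| gen_1 : gen_subgroup P 1
| gen_M g h : gen_subgroup P g -> gen_subgroup P h -> gen_subgroup P (g * h)
| gen_V g : gen_subgroup P g -> gen_subgroup P g^-1.

Definition normal_closure (P : G -> Prop) : G -> Prop :=
  gen_subgroup (fun g => exists k h : G, P k /\ g = k ^ h).

Definition derived (P : G -> Prop) : G -> Prop :=
  gen_subgroup (fun g => exists h k : G, [/\ P h, P k & g = [~ h, k]]).

Definition bi_orderable : Prop :=
  exists lt : G -> G -> Prop,
    [/\ forall u, ~ lt u u,
        forall u v w, lt u v -> lt v w -> lt u w,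
        forall u v, [\/ lt u v, u = v | lt v u]
      & forall u v g, lt u v -> lt (u * g) (v * g) /\ lt (g * u) (g * v)].

End Groups.

Definition has_presentation (T : choiceType) (rels : fgroup T -> Prop)
    (G : groupType) : Prop :=
  exists phi : {multiplicative fgroup T -> G},
    (forall g, exists u, phi u = g) /\
    (forall u, phi u = 1 <-> normal_closure rels u).

Definition F2 : groupType := fgroup bool.
Definition x_ : F2 := fg_gen false.
Definition t_ : F2 := fg_gen true.

Definition subN : F2 -> Prop := normal_closure (fun g => g = x_).

Local Close Scope group_scope.
Local Open Scope ring_scope.

(* An expression for w is (x^(m 0))^(t^(d 0)) ... (x^(m (r-1)))^(t^(d (r-1))).
   It need not be reduced: the m i may vanish and consecutive d i may agree. *)
Section Expressions.
Variables (r : nat) (m d : 'I_r -> int).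

Definition is_expression (w : F2) : Prop :=
  (0 < r)%N /\ w = (\prod_(i < r) (expgz x_ (m i) ^ expgz t_ (d i)))%g.

Definition tau (j : int) : {set 'I_r} := [set i | d i == j].

Definition expsum (j : int) : int := \sum_(i in tau j) m i.

(* The finite set S_w, listed in increasing order; see mem_supp. *)
Definition supp : seq int :=
  sort <=%O [seq j <- undup (codom d) | expsum j != 0].

(* Smallest and largest elements of S_w; junk value 0 when S_w is empty. *)
Definition low : int := head 0 supp.
Definition high : int := last 0 supp.

Lemma mem_supp j : (j \in supp) = (expsum j != 0).
Proof.
rewrite mem_sort mem_filter mem_undup andb_idr // => nz_j.
apply/negPn/negP => dj; case/eqP: nz_j; rewrite /expsum big1 // => i.
by rewrite inE => /eqP def_j; case/negP: dj; rewrite -def_j codom_f.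
Qed.

Lemma low_supp j : j \in supp -> low \in supp /\ low <= j.
Proof.
have: sorted <=%O supp by apply/sort_sorted/le_total.
rewrite /low; case: supp => //= i s le_s; rewrite !inE eqxx => Hj; split=> //.
have /allP le_i := order_path_min le_trans le_s.
by case/predU1P: Hj => [->|/le_i].
Qed.

Lemma high_supp j : j \in supp -> high \in supp /\ j <= high.
Proof.
have: sorted <=%O supp by apply/sort_sorted/le_total.
rewrite /high; case/lastP: supp => // s k.
rewrite last_rcons -cats1 (sorted_pairwise le_trans) pairwise_cat allrel1r.
case/andP=> /allP le_k _; rewrite !mem_cat !mem_seq1 eqxx orbT => Hj; split=> //.
by case/orP: Hj => [/le_k|/eqP->].
Qed.

(* The terms with d i < low contribute 0 in total, so dropping them makes all
   exponents natural numbers without changing the polynomial. *)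
Definition wpoly : {poly int} :=
  \sum_(i < r | low <= d i) m i *: 'X^(`|d i - low|%N).

Definition tidy (w : F2) : Prop :=
  [/\ is_expression w, subN w, ~ derived subN w
    & forall j, (high < j) || (j < low) -> tau j = set0].

Definition principal (w : F2) : Prop := tidy w /\ #|tau high| = 1%N.

End Expressions.

(* Main.v *)
Require Import Defs.
From mathcomp Require Import all_boot all_order all_algebra.
From HB Require Import structures.
From mathcomp Require Import boolp ring lra zify.

(** Put x_i = x^(t^i) and let m be the absolute value of the exponent of the top
    term of w.  In G the relator says that the m-th power of x_(i+d) is a word in
    x_i, ..., x_(i+d-1), for every integer i.  The same relations can be solved in
    the group 1 + I of noncommutative power series in d variables, by extracting
    m-th roots; call the solution X_i.

    The map x_i |-> X_i, for i >= 0, is injective.  Roots are adjoined one prime at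
    a time: let y^p = z, with z in the group H obtained so far.  The amalgam of H
    and <y> over <z> acts on p-tuples of series with coefficients in one more
    variable T: H acts by scalars, and y by the companion matrix of X^p - z
    conjugated by 1 + T v w, where w v = 0.  Since the centralizer of z in H is
    <z>, the top coefficient in T of a reduced product of powers of y and elements
    of H does not vanish, so the action is faithful.  On the other hand, a product
    which is trivial in the series ring acts trivially, because up to integers
    prime to p it lies arbitrarily deep in the augmentation filtration.  The
    hypothesis on the gcd gives, for each p, a basis modulo p-prime torsion of the
    characters of the group, and makes z primitive.

    The shift x_i |-> x_(i+1) is realised by a substitution of power series whose
    linear part has characteristic polynomial A_w up to a scalar.  As the roots
    of A_w are positive, a Newton basis makes it triangular with positive
    diagonal, so it preserves the bi-invariant order on 1 + I given by the sign
    of the first non-zero coefficient in the shortlex order.  An element u of G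
    is positive if its t-exponent is positive, or if it is zero and the words in
    x_i that represent conjugates of u by large powers of t are positive. *)

Set Implicit Arguments.
Unset Strict Implicit.
Unset Printing Implicit Defensive.

Import Order.TTheory GRing.Theory Num.Theory.
Local Open Scope ring_scope.

(** * Noncommutative power series *)

(** The amalgam is never constructed. Injectivity is stated in the product of an arbitrary group
    satisfying the same relations with the group of series: an element of the subgroup generated by
    the pairs is trivial as soon as its series component is. With the conjugates of x in G as first
    components, this says that a word trivial on the series is trivial in G. The difficulty is that
    the matrix action, faithful on the amalgam, must be shown to factor through the series. Let Y be
    the matrix root of a series u. As u is 1 modulo the variables, Y - 1 is nilpotent modulo p and
    the variables, so deep elements of the augmentation filtration act by matrices that are highly
    divisible by p in every fixed degree, and an integer divisible by all powers of p is 0. This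
    works for roots of prime order p and over the rationals only; real coefficients enter with the
    order, through a change of variables. The series X_i exist for i >= 0 only, and the substitution
    realising the shift goes one way; this is why signs are read after conjugation by large powers
    of t. *)

Definition ncps (K : Type) (d : nat) := seq 'I_d -> K.

HB.instance Definition _ (K : choiceType) d := gen_eqMixin (ncps K d).
HB.instance Definition _ (K : choiceType) d := gen_choiceMixin (ncps K d).

Section Series.
Variables (K : numFieldType) (d : nat).
Local Notation A := (ncps K d).
Implicit Types (f g h : A) (w v : seq 'I_d) (c : K) (n m : nat).

Definition ncps_zero : A := fun=> 0.
Definition ncps_opp f : A := fun w => - f w.
Definition ncps_add f g : A := fun w => f w + g w.

Fact ncps_addA : associative ncps_add.
Proof. by move=> f g h; apply/funext => w; apply: addrA. Qed.
Fact ncps_addC : commutative ncps_add.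
Proof. by move=> f g; apply/funext => w; apply: addrC. Qed.
Fact ncps_add0 : left_id ncps_zero ncps_add.
Proof. by move=> f; apply/funext => w; apply: add0r. Qed.
Fact ncps_addN : left_inverse ncps_zero ncps_opp ncps_add.
Proof. by move=> f; apply/funext => w; apply: addNr. Qed.

HB.instance Definition _ :=
  GRing.isZmodule.Build A ncps_addA ncps_addC ncps_add0 ncps_addN.

Definition lder (a : 'I_d) f : A := fun w => f (a :: w).

(** Recursion on the word through left derivatives lets the ring axioms be proved without sums over
    cuts; [ncpsM] recovers the sum over all factorizations of the word. *)
Fixpoint ncps_mul_at f g w : K :=
  if w is a :: w' then f [::] * g w + ncps_mul_at (lder a f) g w'
  else f [::] * g [::].

Definition ncps_mul f g : A := ncps_mul_at f g.
Definition ncps_one : A := fun w => if w is [::] then 1 else 0.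
Definition ncps_scale c f : A := fun w => c * f w.

Fact ncps_scaleA c c' f : ncps_scale c (ncps_scale c' f) = ncps_scale (c * c') f.
Proof. by apply/funext => w; apply: mulrA. Qed.
Fact ncps_scale1 : left_id 1 ncps_scale.
Proof. by move=> f; apply/funext => w; apply: mul1r. Qed.
Fact ncps_scaleDr : right_distributive ncps_scale +%R.
Proof. by move=> c f g; apply/funext => w; apply: mulrDr. Qed.
Fact ncps_scaleDl f : {morph ncps_scale^~ f : c c' / c + c'}.
Proof. by move=> c c'; apply/funext => w; apply: mulrDl. Qed.

HB.instance Definition _ := GRing.Zmodule_isLmodule.Build K A
  ncps_scaleA ncps_scale1 ncps_scaleDr ncps_scaleDl.

Lemma ncpsD f g w : (f + g) w = f w + g w. Proof. by []. Qed.
Lemma ncpsN f w : (- f) w = - f w. Proof. by []. Qed.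
Lemma ncpsB f g w : (f - g) w = f w - g w. Proof. by []. Qed.
Lemma ncps0 w : (0 : A) w = 0. Proof. by []. Qed.
Lemma ncpsZ c f w : (c *: f) w = c * f w. Proof. by []. Qed.

Lemma lderD a f g : lder a (f + g) = lder a f + lder a g.
Proof. by []. Qed.
Lemma lderZ a c f : lder a (c *: f) = c *: lder a f. Proof. by []. Qed.

Fact ncps_mulDl : left_distributive ncps_mul +%R.
Proof.
move=> f g h; apply/funext => w; rewrite /ncps_mul ncpsD.
elim: w f g => [|a w IHw] f g /=; first by rewrite ncpsD mulrDl.
by rewrite lderD IHw ncpsD mulrDl addrACA.
Qed.

Fact ncps_mulDr : right_distributive ncps_mul +%R.
Proof.
move=> f g h; apply/funext => w; rewrite /ncps_mul ncpsD.
elim: w f => [|a w IHw] f /=; first by rewrite ncpsD mulrDr.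
by rewrite IHw ncpsD mulrDr addrACA.
Qed.

Fact ncps_mulZl c f g : ncps_mul (c *: f) g = c *: ncps_mul f g.
Proof.
apply/funext => w; rewrite /ncps_mul ncpsZ.
elim: w f => [|a w IHw] f /=; first by rewrite ncpsZ mulrA.
by rewrite lderZ IHw ncpsZ mulrDr !mulrA.
Qed.

Fact ncps_mulA : associative ncps_mul.
Proof.
move=> f g h; apply/funext => w; rewrite /ncps_mul.
elim: w f => [|a w IHw] f /=; first by rewrite mulrA.
rewrite IHw mulrDr mulrA -addrA; congr (_ + _).
have := congr1 (fun u : A => u w)
  (ncps_mulDl (f [::] *: lder a g) (ncps_mul (lder a f) g) h).
by rewrite ncps_mulZl => /esym.
Qed.

Fact ncps_mul1 : left_id ncps_one ncps_mul.
Proof.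
have E0 f w : ncps_mul 0 f w = 0.
  by rewrite -(scale0r (0 : A)) ncps_mulZl ncpsZ mul0r.
move=> f; apply/funext => -[|a w]; rewrite /ncps_mul /= mul1r //.
by rewrite -[lder a _]/(0 : A) -/(ncps_mul _ _ _) E0 addr0.
Qed.

Fact ncps_mulr1 : right_id ncps_one ncps_mul.
Proof.
move=> f; apply/funext => w; rewrite /ncps_mul.
elim: w f => [|a w IHw] f /=; first by rewrite mulr1.
by rewrite IHw mulr0 add0r.
Qed.

Fact ncps_one_neq0 : ncps_one != 0.
Proof.
by apply/eqP => /(congr1 (fun u : A => u [::]))/eqP; rewrite /= oner_eq0.
Qed.

HB.instance Definition _ := GRing.Zmodule_isNzRing.Build A
  ncps_mulA ncps_mul1 ncps_mulr1 ncps_mulDl ncps_mulDr ncps_one_neq0.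

Fact ncps_scaleAl c f g : c *: (f * g) = c *: f * g.
Proof. by rewrite -[RHS]/(ncps_mul _ _) ncps_mulZl. Qed.
HB.instance Definition _ := GRing.Lmodule_isLalgebra.Build K A ncps_scaleAl.

Lemma ncps1 w : (1 : A) w = (w == [::])%:R. Proof. by case: w. Qed.

Lemma ncpsM_nil f g : (f * g) [::] = f [::] * g [::]. Proof. by []. Qed.

Lemma ncpsM_cons f g a w :
  (f * g) (a :: w) = f [::] * g (a :: w) + (lder a f * g) w.
Proof. by []. Qed.

Lemma lderM a f g : lder a (f * g) = f [::] *: lder a g + lder a f * g.
Proof. by []. Qed.

Lemma ncpsM f g w :
  (f * g) w = \sum_(i < (size w).+1) f (take i w) * g (drop i w).
Proof.
elim: w f => [|a w IHw] f; first by rewrite big_ord1.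
by rewrite ncpsM_cons IHw [in RHS]big_ord_recl.
Qed.

Fact ncps_scaleAr c f g : c *: (f * g) = f * (c *: g).
Proof.
apply/funext => w; rewrite ncpsZ !ncpsM mulr_sumr.
by apply: eq_bigr => i _; rewrite ncpsZ mulrCA.
Qed.
HB.instance Definition _ := GRing.Lalgebra_isAlgebra.Build K A ncps_scaleAr.

Lemma ncps_sum (I : Type) (r : seq I) (P : pred I) (F : I -> A) w :
  (\sum_(i <- r | P i) F i) w = \sum_(i <- r | P i) F i w.
Proof. by elim/big_rec2: _ => //= i y1 y2 _ <-. Qed.

Lemma ncpsMn f n w : (f *+ n) w = f w *+ n.
Proof. by elim: n => // n IHn; rewrite !mulrS ncpsD IHn. Qed.

Lemma ncpsMz f (i : int) w : (f *~ i) w = f w *~ i.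
Proof. by case: i => n; rewrite ?NegzE ?mulrNz ?ncpsN; [|congr (- _)]; apply: ncpsMn. Qed.

(* [small n] is the n-th power of the augmentation ideal. *)
Definition small n f : Prop := forall w, (size w < n)%N -> f w = 0.

Lemma small_zero n : small n 0. Proof. by []. Qed.
Lemma smallD n f g : small n f -> small n g -> small n (f + g).
Proof. by move=> sf sg w ltw; rewrite ncpsD sf ?sg ?addr0. Qed.
Lemma smallN n f : small n f -> small n (- f).
Proof. by move=> sf w ltw; rewrite ncpsN sf ?oppr0. Qed.
Lemma smallB n f g : small n f -> small n g -> small n (f - g).
Proof. by move=> sf sg; apply/smallD/smallN. Qed.
Lemma smallZ n c f : small n f -> small n (c *: f).
Proof. by move=> sf w ltw; rewrite ncpsZ sf ?mulr0. Qed.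
Lemma smallW m n f : (m <= n)%N -> small n f -> small m f.
Proof. by move=> lemn sf w ltw; rewrite sf // (leq_trans ltw). Qed.
Lemma small_sum n (I : Type) (r : seq I) (P : pred I) (F : I -> A) :
  (forall i, P i -> small n (F i)) -> small n (\sum_(i <- r | P i) F i).
Proof. by move=> sF; elim/big_ind: _ => //; apply: smallD. Qed.
Lemma small1 f : small 1 f <-> f [::] = 0.
Proof.
split=> [->//|f0 w]; rewrite ltnS leqn0 => /nilP->; exact: f0.
Qed.

Lemma smallM m n f g : small m f -> small n g -> small (m + n) (f * g).
Proof.
move=> sf sg w ltw; rewrite ncpsM big1 // => i _.
have [lt_im | le_mi] := ltnP i m.
  by rewrite sf ?mul0r // size_take_min gtn_min lt_im.
rewrite sg ?mulr0 // size_drop; move: (ltn_ord i); rewrite ltnS => le_iw.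
by rewrite ltn_subLR // (leq_trans ltw) // leq_add2r.
Qed.

Lemma smallMl n f g : small n f -> small n (f * g).
Proof. by move=> sf; rewrite -[n]addn0; apply: smallM. Qed.
Lemma smallMr n f g : small n g -> small n (f * g).
Proof. by move=> sg; rewrite -[n]add0n; apply: smallM. Qed.

Lemma smallP f : (forall n, small n f) -> f = 0.
Proof. by move=> sf; apply/funext => w; apply: (sf (size w).+1). Qed.

Lemma ncps_low f : f != 0 -> exists2 w, f w != 0 & small (size w) f.
Proof.
move=> nz_f; have exn : exists n, `[< exists2 w, size w = n & f w != 0 >].
  apply: contrapT => no_n; case/eqP: nz_f; apply/funext => w.
  apply/eqP/negPn/negP => nz_w; apply: no_n.
  by exists (size w); apply/asboolP; exists w.
case: (ex_minnP exn) => n /asboolP[w <- nz_w] min_n; exists w => // v ltv.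
apply/eqP/negPn/negP => nz_v.
suff: (size w <= size v)%N by rewrite leqNgt ltv.
by apply: min_n; apply/asboolP; exists v.
Qed.

(** Take non-zero coefficients of least degree at w and v. Among the cuts of [w ++ v], only the one
    between w and v leaves both halves long enough to contribute. *)
Lemma ncps_mulf_neq0 f g : f != 0 -> g != 0 -> f * g != 0.
Proof.
move=> /ncps_low[w nz_w sw] /ncps_low[v nz_v sv].
apply/eqP => /(congr1 (fun u : A => u (w ++ v)))/eqP.
have lt_w : (size w < (size (w ++ v)).+1)%N by rewrite size_cat ltnS leq_addr.
rewrite ncpsM (bigD1 (Ordinal lt_w)) //= take_size_cat // drop_size_cat //.
rewrite big1 ?addr0 ?mulf_eq0 ?(negPf nz_w) ?(negPf nz_v) // => i.
rewrite -val_eqE /= neq_ltn => /orP[lt_i | lt_i].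
  by rewrite sw ?mul0r // size_take_min gtn_min lt_i.
rewrite sv ?mulr0 // size_drop; move: (ltn_ord i); rewrite ltnS => le_i.
by move: (i : nat) lt_i le_i => k ltk lek; rewrite ltn_subLR // size_cat ltn_add2r.
Qed.

Section Limits.
Variable F : nat -> A.
Hypothesis cvF : forall n, small n (F n.+1 - F n).

(** By [cvF] the coefficient at w no longer changes from step [(size w).+1] on. *)
Definition ncps_lim : A := fun w => F (size w).+1 w.

Lemma ncps_limP n : small n (ncps_lim - F n).
Proof.
move=> w ltw; apply/eqP; rewrite subr_eq0 /ncps_lim.
elim: n ltw => // n IHn; rewrite ltnS leq_eqVlt => /predU1P[<-//|ltn].
rewrite (eqP (IHn ltn)) eq_sym -subr_eq0; apply/eqP/(cvF ltn).
Qed.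

End Limits.
Arguments ncps_limP [F] cvF n.

Lemma small_exp f n m : small n (f - 1) -> small n (f ^+ m - 1).
Proof.
move=> sf; elim: m => [|m IHm]; first by rewrite subrr.
rewrite exprS (_ : _ - 1 = f * (f ^+ m - 1) + (f - 1)); last first.
  by rewrite mulrBr mulr1 addrA subrK.
by apply: smallD => //; apply: smallMr.
Qed.

(** First-order estimate of the power map near 1, one degree beyond f - g. It gives both uniqueness
    and existence of m-th roots. *)
Lemma small_expB f g n m : f [::] = 1 -> g [::] = 1 -> small n (f - g) ->
  small n.+1 (f ^+ m - g ^+ m - (f - g) *+ m).
Proof.
move=> f1 g1 sfg; pose P k := f ^+ k - g ^+ k.
have sf1 : small 1 (f - 1) by apply/small1; rewrite ncpsB f1 subrr.
have sg1 : small 1 (g - 1) by apply/small1; rewrite ncpsB g1 subrr.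
have EP k : P k.+1 = f * P k + (f - g) * g ^+ k.
  by rewrite /P !exprS mulrBr mulrBl addrA subrK.
have sP k : small n (P k).
  elim: k => [|k IHk]; first by rewrite /P subrr.
  by rewrite EP; apply: smallD; [apply: smallMr | apply: smallMl].
elim: m => [|m IHm]; first by rewrite /P !expr0 mulr0n subrr subr0.
rewrite -/(P _) EP mulrSr (_ : _ - _ = (f - 1) * P m + (P m - (f - g) *+ m)
  + (f - g) * (g ^+ m - 1)).
  apply: smallD; first apply: smallD => //; first by rewrite -add1n; apply: smallM.
  by rewrite -addn1; apply: smallM => //; apply: small_exp.
rewrite [(f - 1) * _]mulrBl mul1r [_ * (_ - 1)]mulrBr mulr1 -/(P m).
rewrite (addrA (f * P m - P m)) subrK [in RHS]addrACA -opprD.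
by congr (_ + _ - _); rewrite addrC.
Qed.

Lemma ncps_root_inj f g m : (0 < m)%N -> f [::] = 1 -> g [::] = 1 ->
  f ^+ m = g ^+ m -> f = g.
Proof.
move=> m_gt0 f1 g1 efg; apply/eqP; rewrite -subr_eq0; apply/eqP/smallP.
elim=> // n /(small_expB m f1 g1); rewrite efg subrr sub0r => sn w ltw.
have := sn w ltw; rewrite ncpsN ncpsMn => /eqP.
by rewrite oppr_eq0 mulrn_eq0 eqn0Ngt m_gt0 => /eqP.
Qed.

(** Newton iteration with the derivative frozen at its value m at 1; each step gains one degree. *)
Fixpoint root_approx (m : nat) f (n : nat) : A :=
  if n is n'.+1 then
    root_approx m f n' + m%:R^-1 *: (f - root_approx m f n' ^+ m)
  else 1.

Definition ncps_root m f := ncps_lim (root_approx m f).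

Lemma root_approxP m f n : (0 < m)%N -> f [::] = 1 ->
  root_approx m f n [::] = 1 /\ small n.+1 (f - root_approx m f n ^+ m).
Proof.
move=> m_gt0 f1; have nz_m : m%:R != 0 :> K by rewrite pnatr_eq0 -lt0n.
elim: n => [|n [g1 sg]] /=.
  by split=> //; apply/small1; rewrite ncpsB expr1n f1 subrr.
set g := root_approx m f n in g1 sg *; set e := m%:R^-1 *: _.
have se : small n.+1 e by apply: smallZ.
have h1 : (g + e) [::] = 1 by rewrite ncpsD g1 se // addr0.
split=> //; have Ee : (g + e) - g = e by rewrite addrC addKr.
have := small_expB m h1 g1; rewrite Ee => /(_ _ se) /smallN.
have -> : e *+ m = f - g ^+ m by rewrite -scaler_nat scalerA divff // scale1r.
by rewrite opprB opprB addrA subrK.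
Qed.

Lemma ncps_rootP m f : (0 < m)%N -> f [::] = 1 ->
  ncps_root m f [::] = 1 /\ ncps_root m f ^+ m = f.
Proof.
move=> m_gt0 f1; have P n := root_approxP n m_gt0 f1.
have cv n : small n (root_approx m f n.+1 - root_approx m f n).
  by rewrite /= addrC addKr; apply: smallZ; apply: smallW (P n).2.
have E n := ncps_limP cv n.
have r1 : ncps_root m f [::] = 1.
  by have := E 1%N [::] isT; rewrite ncpsB (P _).1 => /eqP; rewrite subr_eq0 => /eqP.
split=> //; apply/eqP; rewrite -subr_eq0; apply/eqP/smallP => n.
have := small_expB m r1 (P n).1 (E n) => /(smallW (leqnSn n)) s1.
have s2 := smallW (leqnSn n) (P n).2.
rewrite (_ : _ - f = (ncps_root m f ^+ m - root_approx m f n ^+ m) - (f - root_approx m f n ^+ m)).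
  apply: smallB => //; rewrite -[X in small _ X](subrK ((ncps_root m f - root_approx m f n) *+ m)).
  by apply: smallD => //; rewrite -scaler_nat; apply: smallZ.
by rewrite opprB addrA subrK.
Qed.

Fixpoint inv_approx f n : A :=
  if n is n'.+1 then 1 - (f - 1) * inv_approx f n' else 0.

Definition ncps_inv f := ncps_lim (inv_approx f).

Lemma ncps_invP f : f [::] = 1 -> ncps_inv f [::] = 1 /\ f * ncps_inv f = 1.
Proof.
move=> f1; have sf1 : small 1 (f - 1) by apply/small1; rewrite ncpsB f1 subrr.
have cv n : small n (inv_approx f n.+1 - inv_approx f n).
  elim: n => // n IHn; have E k : inv_approx f k.+1 = 1 - (f - 1) * inv_approx f k by [].
  rewrite E [X in _ - X]E; move: (inv_approx f n.+1) (inv_approx f n) IHn => u v suv.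
  rewrite [X in _ + X]opprB addrC addrA subrK -opprB -mulrBr -add1n.
  exact/smallN/smallM.
have E n := ncps_limP cv n; rewrite -/(ncps_inv f) in E.
move: (ncps_inv f) E => L E.
have fg : f * L = 1.
  apply/eqP; rewrite -subr_eq0; apply/eqP/smallP => n.
  rewrite (_ : _ - 1 = (f - 1) * (L - inv_approx f n) + (L - inv_approx f n.+1)).
    by apply: smallD; [apply: smallMr | apply: smallW (E _)].
  rewrite [inv_approx f n.+1]/= mulrBr mulrBl mul1r.
  apply/funext => w; rewrite !(ncpsD, ncpsN). ring.
by split=> //; have := congr1 (fun u : A => u [::]) fg; rewrite ncpsM_nil f1 mul1r.
Qed.

End Series.

(** * Substitution of series without constant term *)

Section Substitution.
Variables (K : numFieldType) (d d' : nat) (W : 'I_d -> ncps K d').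
Implicit Types (f g : ncps K d) (n : nat).

Fixpoint subst_approx n f : ncps K d' :=
  if n is n'.+1 then
    f [::] *: 1 + \sum_j W j * subst_approx n' (lder j f)
  else 0.

Lemma subst_approxS n f : subst_approx n.+1 f =
  f [::] *: 1 + \sum_j W j * subst_approx n (lder j f).
Proof. by []. Qed.

Definition subst f : ncps K d' := ncps_lim (subst_approx^~ f).

Hypothesis sW : forall j, small 1 (W j).

Lemma subst_limP f n : small n (subst f - subst_approx n f).
Proof.
apply: ncps_limP => {}n.
elim: n f => // n IHn f; rewrite subst_approxS [in X in _ - X]subst_approxS.
rewrite opprD addrACA subrr add0r -sumrB; apply: small_sum => j _.
by rewrite -mulrBr -add1n; apply: smallM.
Qed.

Arguments subst_limP : clear implicits.

Lemma substE f : subst f = f [::] *: 1 + \sum_j W j * subst (lder j f).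
Proof.
apply/eqP; rewrite -subr_eq0; apply/eqP/smallP => n.
rewrite -[subst f](subrK (subst_approx n.+1 f)) -addrA; apply: smallD.
  exact: smallW (leqnSn n) (subst_limP f n.+1).
rewrite subst_approxS opprD addrACA subrr add0r -sumrB; apply: small_sum => j _.
rewrite -mulrBr; apply: smallMr; rewrite -opprB; apply: smallN.
exact: subst_limP.
Qed.

Lemma subst_eq f (u : ncps K d') :
  (forall n, small n (u - subst_approx n f)) -> subst f = u.
Proof.
move=> su; apply/eqP; rewrite -subr_eq0; apply/eqP/smallP => n.
rewrite -[subst f](subrK (subst_approx n f)) -addrA; apply: smallD.
  exact: subst_limP.
by rewrite -opprB; apply: smallN.
Qed.

Lemma substD f g : subst (f + g) = subst f + subst g.
Proof.
have E n : forall f g, subst_approx n (f + g) = subst_approx n f + subst_approx n g.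
  elim: n => [|n IHn] {}f {}g; first by rewrite addr0.
  rewrite !subst_approxS ncpsD scalerDl addrACA -big_split; congr (_ + _).
  by apply: eq_bigr => j _; rewrite lderD IHn mulrDr.
apply: subst_eq => n; rewrite E opprD addrACA.
by apply: smallD; apply: subst_limP.
Qed.

Lemma substZ c f : subst (c *: f) = c *: subst f.
Proof.
have E n : forall f, subst_approx n (c *: f) = c *: subst_approx n f.
  elim: n => [|n IHn] {}f; first by rewrite scaler0.
  rewrite !subst_approxS scalerDr scalerA; congr (_ + _).
  by rewrite scaler_sumr; apply: eq_bigr => j _; rewrite lderZ IHn scalerAr.
by apply: subst_eq => n; rewrite E -scalerBr; apply/smallZ/subst_limP.
Qed.

Lemma subst0 : subst 0 = 0.
Proof. by rewrite -(scale0r (0 : ncps K d)) substZ scale0r. Qed.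

Lemma substB f g : subst (f - g) = subst f - subst g.
Proof. by rewrite substD -scaleN1r substZ scaleN1r. Qed.

Lemma subst1 : subst 1 = 1.
Proof.
rewrite substE ncps1 scale1r big1 ?addr0 // => j _.
by rewrite (_ : lder j 1 = 0) ?subst0 ?mulr0.
Qed.

Lemma substM f g : subst (f * g) = subst f * subst g.
Proof.
apply/eqP; rewrite -subr_eq0; apply/eqP/smallP => n.
elim: n f g => // n IHn f g; rewrite substE ncpsM_nil.
rewrite [subst f]substE mulrDl -scalerAl mul1r {1}[subst g]substE scalerDr scalerA.
rewrite mulr_suml scaler_sumr -[X in _ - X]addrA opprD addrACA subrr add0r -big_split -sumrB.
apply: small_sum => j _; rewrite lderM substD substZ mulrDr scalerAr.
rewrite [X in _ - X]/= opprD addrACA subrr add0r -mulrA -mulrBr -add1n.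
exact: smallM.
Qed.

Lemma subst_nil f : subst f [::] = f [::].
Proof.
rewrite substE ncpsD ncpsZ ncps1 mulr1 ncps_sum big1 ?addr0 // => j _.
by rewrite ncpsM_nil sW ?mul0r.
Qed.

End Substitution.

Section Linear.
Variables (K : numFieldType) (d : nat).

Definition lin (v : 'I_d -> K) : ncps K d :=
  fun w => if w is [:: j] then v j else 0.

Lemma small_lin v : small 1 (lin v).
Proof. by apply/small1. Qed.

Lemma subst_linE d' (W : 'I_d -> ncps K d') v : (forall j, small 1 (W j)) ->
  subst W (lin v) = \sum_j v j *: W j.
Proof.
move=> sW; rewrite substE // scale0r add0r; apply: eq_bigr => j _.
rewrite (_ : lder j (lin v) = v j *: 1) ?substZ ?subst1 -?scalerAr ?mulr1 //.
by apply/funext => -[|a w]; rewrite ncpsZ ncps1 ?mulr1 ?mulr0.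
Qed.

End Linear.

Section MapCoefficients.
Variables (K L : numFieldType) (d : nat) (phi : {rmorphism K -> L}).
Implicit Types f g : ncps K d.

Definition ncps_map f : ncps L d := fun w => phi (f w).

Lemma ncps_mapM f g : ncps_map (f * g) = ncps_map f * ncps_map g.
Proof.
apply/funext => w; rewrite /ncps_map !ncpsM rmorph_sum; apply: eq_bigr => i _.
by rewrite rmorphM.
Qed.

Lemma ncps_map_inj : injective ncps_map.
Proof.
move=> f g efg; apply/funext => w; apply: (fmorph_inj phi).
exact: (congr1 (fun u : ncps L d => u w) efg).
Qed.

End MapCoefficients.

(** * The group of series with constant term 1 *)

Section MagnusUnits.
Variables (K : numFieldType) (d : nat).

Record munit := MUnit { mval : ncps K d; _ : mval [::] == 1 }.
HB.instance Definition _ := [isSub for mval].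
HB.instance Definition _ := [Choice of munit by <:].
Implicit Types f g : munit.

Lemma munitP f : mval f [::] = 1. Proof. by case: f => u /= /eqP. Qed.

Fact munit_mul_subproof f g : (mval f * mval g) [::] == 1.
Proof. by rewrite ncpsM_nil !munitP mulr1. Qed.
Fact munit_inv_subproof f : ncps_inv (mval f) [::] == 1.
Proof. by case: (ncps_invP (munitP f)) => ->. Qed.

Definition munit_one := @MUnit 1 (eqxx _).
Definition munit_mul f g := MUnit (munit_mul_subproof f g).
Definition munit_inv f := MUnit (munit_inv_subproof f).

Fact munit_mulA : associative munit_mul.
Proof. by move=> f g h; apply/val_inj/mulrA. Qed.
Fact munit_mul1 : left_id munit_one munit_mul.
Proof. by move=> f; apply/val_inj/mul1r. Qed.
Fact munit_mulr1 : right_id munit_one munit_mul.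
Proof. by move=> f; apply/val_inj/mulr1. Qed.
Fact munit_mulVr : right_inverse munit_one munit_inv munit_mul.
Proof. by move=> f; apply/val_inj; case: (ncps_invP (munitP f)). Qed.
Fact munit_mulV : left_inverse munit_one munit_inv munit_mul.
Proof.
move=> f; have fVV : munit_inv (munit_inv f) = f.
  rewrite -[RHS]munit_mulr1 -(munit_mulVr (munit_inv f)) munit_mulA munit_mulVr.
  by rewrite munit_mul1.
by rewrite -{2}fVV munit_mulVr.
Qed.

HB.instance Definition _ := isGroup.Build munit
  munit_mulA munit_mul1 munit_mulr1 munit_mulV munit_mulVr.

Lemma mval1 : mval 1%g = 1. Proof. by []. Qed.
Lemma mvalM f g : mval (f * g)%g = mval f * mval g. Proof. by []. Qed.
Lemma mvalX f n : mval (f ^+ n)%g = mval f ^+ n.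
Proof. by elim: n => // n IHn; rewrite expgS exprS mvalM IHn. Qed.
Lemma mvalV f : mval f * mval f^-1%g = 1.
Proof. by rewrite -mvalM mulgV. Qed.
Lemma mvalVl f : mval f^-1%g * mval f = 1.
Proof. by rewrite -mvalM mulVg. Qed.

End MagnusUnits.

(** * Integer powers and group morphisms *)

Section IntegerPowers.
Variable G : groupType.
Implicit Types (g h : G) (m n : nat) (i j : int).
Local Open Scope group_scope.

Lemma expgz_sub g m n : expgz g (m%:Z - n%:Z)%R = g ^+ m * g ^- n.
Proof.
have [le_nm | lt_mn] := leqP n m.
  by rewrite subzn //= expgnFr.
have -> : (m%:Z - n%:Z)%R = Negz (n - m).-1 by lia.
have -> : n = ((n - m).-1.+1 + m)%N by lia.
rewrite -/(_ ^- _) /= (_ : (n - m).-1.+1 + m - m = (n - m).-1.+1)%N; last by lia.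
by rewrite expgnDr invgM mulVKg.
Qed.

Lemma intE i : exists m n, i = (m%:Z - n%:Z)%R.
Proof. by case: i => k; [exists k, 0 | exists 0, k.+1]; lia. Qed.

Lemma expgzD g i j : expgz g (i + j)%R = expgz g i * expgz g j.
Proof.
have [m [n ->]] := intE i; have [m' [n' ->]] := intE j.
rewrite (_ : (_ + _)%R = ((m + m')%N%:Z - (n + n')%N%:Z)%R); last by lia.
rewrite !expgz_sub expgnDr addnC expgnDr invgM !mulgA; congr (_ * _).
have cV : commute (g ^+ m') (g ^- n) by apply/commuteV/commuteX2/commute_refl.
by rewrite -!mulgA cV.
Qed.

Lemma expgz1 g : expgz g 1 = g. Proof. by []. Qed.

Lemma expgzN g i : expgz g (- i)%R = (expgz g i)^-1.
Proof. by apply/esym/mulg1_eq; rewrite -expgzD subrr. Qed.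

Lemma expgzM g i j : expgz g (i * j)%R = expgz (expgz g i) j.
Proof.
have E n : expgz g (i * n%:Z)%R = expgz g i ^+ n.
  elim: n => [|n IHn]; first by rewrite mulr0.
  by rewrite expgSr -IHn -expgzD -addn1 PoszD mulrDr mulr1.
have [m [n ->]] := intE j.
by rewrite expgz_sub -!E -expgzN -expgzD mulrBr.
Qed.

Lemma commute_expgz g h i : commute g h -> commute g (expgz h i).
Proof.
move=> cgh; have [m [n ->]] := intE i; rewrite expgz_sub.
by apply: commuteM; [apply: commuteX | apply/commuteV/commuteX].
Qed.

Lemma expgzMn g h i : commute g h -> expgz (g * h) i = expgz g i * expgz h i.
Proof.
move=> cgh; have [m [n ->]] := intE i; rewrite !expgz_sub !expgMn // invgM.
rewrite -!mulgA; congr (_ * _); rewrite [RHS]mulgA.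
have c1 : commute (h ^+ m) (h ^- n) by apply/commuteV/commuteX2/commute_refl.
have c2 : commute (g ^- n) (h ^+ m * h ^- n).
  apply: commute_sym; apply/commuteV/commuteX/commute_sym.
  by apply: commuteM; [apply: commuteX | apply/commuteV/commuteX].
by rewrite -[RHS]mulgA [RHS]mulgA -[in RHS]mulgA c2 !mulgA.
Qed.

End IntegerPowers.

Section Morphisms.
Variables (G H : groupType) (T : G -> H).
Hypothesis TM : {morph T : x y / (x * y)%g}.
Local Open Scope group_scope.

Lemma morph1 : T 1 = 1.
Proof. by apply: (mulgI (T 1)); rewrite -TM !mulg1. Qed.
Lemma morphV x : T x^-1 = (T x)^-1.
Proof. by apply/esym/mulg1_eq; rewrite -TM mulgV morph1. Qed.
Lemma morphX x n : T (x ^+ n) = T x ^+ n.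
Proof. by elim: n => [|n IHn]; rewrite ?morph1 // !expgS TM IHn. Qed.
Lemma morph_expgz x i : T (expgz x i) = expgz (T x) i.
Proof. by case: i => n; rewrite /= ?morphV morphX. Qed.
Lemma morph_prod (I : Type) (r : seq I) (F : I -> G) :
  T (\prod_(i <- r) F i) = \prod_(i <- r) T (F i).
Proof. by apply: (big_morph T TM morph1). Qed.

End Morphisms.

(** * Characters of finitely generated groups *)

(* [character B S chi]: chi is a homomorphism on B modulo the subgroup S of M. *)
Definition character (G : groupType) (B : G -> Prop) (M : zmodType)
    (S : M -> Prop) (chi : G -> M) : Prop :=
  [/\ S 0, forall x y, S x -> S y -> S (x - y)
    & forall g h, B g -> B h -> S (chi (g * h)%g - chi g - chi h)].

Definition gen_by (G : groupType) (x : nat -> G) (n : nat) : G -> Prop :=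
  gen_subgroup (fun g => exists2 i, (i < n)%N & g = x i).

Section GenBy.
Variable (G : groupType).
Implicit Types (x y : nat -> G) (g h : G) (n m : nat).

Lemma gen_expgz (P : G -> Prop) g i :
  gen_subgroup P g -> gen_subgroup P (expgz g i).
Proof.
move=> Pg; have PX n : gen_subgroup P (g ^+ n)%g.
  by elim: n => [|n IHn]; [apply: gen_1 | rewrite expgS; apply: gen_M].
by case: i => n /=; [|apply: gen_V]; apply: PX.
Qed.

Lemma gen_byS x n y m g : (forall i, (i < n)%N -> gen_by y m (x i)) ->
  gen_by x n g -> gen_by y m g.
Proof.
move=> xy; elim=> [h [i /xy ? ->]| |? ? _ ? _ ?|? _ ?] //; first exact: gen_1.
  exact: gen_M.
exact: gen_V.
Qed.

Lemma gen_by_gen x n i : (i < n)%N -> gen_by x n (x i).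
Proof. by move=> lt_in; apply: gen_in; exists i. Qed.

End GenBy.

Lemma gen_morph (G H : groupType) (T : G -> H) (P : G -> Prop) (Q : H -> Prop) g :
  {morph T : x y / (x * y)%g} -> (forall h, P h -> gen_subgroup Q (T h)) ->
  gen_subgroup P g -> gen_subgroup Q (T g).
Proof.
move=> TM TP; elim=> [h /TP//| |h k _ ? _ ?|h _ ?].
- by rewrite (morph1 TM); apply: gen_1.
- by rewrite TM; apply: gen_M.
by rewrite (morphV TM); apply: gen_V.
Qed.

Section Characters.
Variables (G : groupType) (P : G -> Prop) (M : zmodType) (S : M -> Prop).
Variable chi : G -> M.
Local Notation B := (gen_subgroup P).
Hypothesis chiP : character B S chi.
Implicit Types (g h : G) (i : int).

Lemma charS0 : S 0. Proof. by case: chiP. Qed.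
Lemma charSB x y : S x -> S y -> S (x - y). Proof. by case: chiP => _ SB _; apply: SB. Qed.
Lemma charSN x : S x -> S (- x).
Proof. by move=> Sx; rewrite -sub0r; apply: charSB => //; apply: charS0. Qed.
Lemma charSD x y : S x -> S y -> S (x + y).
Proof. by move=> Sx Sy; rewrite -[y]opprK; apply/charSB/charSN. Qed.
Lemma charS_sum (I : Type) (r : seq I) (F : I -> M) :
  (forall a, S (F a)) -> S (\sum_(a <- r) F a).
Proof. by move=> SF; elim/big_ind: _ => //; [apply: charS0|apply: charSD]. Qed.
Lemma charSMz x i : S x -> S (x *~ i).
Proof.
move=> Sx; have SM n : S (x *+ n).
  by elim: n => [|n IHn]; [apply: charS0|rewrite mulrS; apply: charSD].
by case: i => n; [apply: SM | rewrite NegzE mulrNz; apply/charSN/SM].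
Qed.
Lemma charM g h : B g -> B h -> S (chi (g * h)%g - (chi g + chi h)).
Proof. by move=> Bg Bh; rewrite opprD addrA; case: chiP => _ _; apply. Qed.

Lemma charSE x y : S (x - y) -> S y -> S x.
Proof. by move=> Sxy Sy; rewrite -(subrK y x); apply: charSD. Qed.

Lemma charSC x y z : S (x - y) -> S (y - z) -> S (x - z).
Proof. by move=> Sxy Syz; rewrite -(subrK y x) -addrA; apply: charSD. Qed.

Lemma char1 : S (chi 1%g).
Proof.
have := charM (gen_1 P) (gen_1 P); rewrite mulg1 opprD addrA subrr sub0r.
by move/charSN; rewrite opprK.
Qed.

Lemma charV g : B g -> S (chi g^-1%g + chi g).
Proof.
move=> Bg; have := charM (gen_V Bg) Bg; rewrite mulVg => /charSN.
by rewrite opprB => /charSE; apply; apply: char1.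
Qed.

Lemma charX g n : B g -> S (chi (g ^+ n)%g - chi g *+ n).
Proof.
move=> Bg; have BX m : B (g ^+ m)%g := gen_expgz m%:Z Bg.
elim: n => [|n IHn]; first by rewrite subr0; apply: char1.
rewrite expgS mulrS; apply: charSC (charM Bg (BX n)) _.
by rewrite opprD addrACA subrr add0r.
Qed.

Lemma char_expgz g i : B g -> S (chi (expgz g i) - chi g *~ i).
Proof.
move=> Bg; case: i => n; first exact: charX.
rewrite /= NegzE mulrNz opprK; have BX := gen_expgz n.+1%:Z Bg.
have := charSD (charV BX) (charSN (charX n.+1 Bg)).
by rewrite opprB addrA [_ + _ - _]addrAC addrK.
Qed.

End Characters.

(** The e t are the exponent sums of one word representing b. They are fixed before the character is
    given, so the same vector serves characters with values in different groups. *)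
Lemma gen_by_exponents (G : groupType) (x : nat -> G) n b : gen_by x n b ->
  exists e : nat -> int, forall (M : zmodType) (S : M -> Prop) (chi : G -> M),
    character (gen_by x n) S chi -> S (chi b - \sum_(t < n) chi (x t) *~ e t).
Proof.
elim=> [g [i lt_in ->]| |g h Bg [e He] Bh [f Hf]|g Bg [e He]].
- exists (fun t => (t == i)%:Z) => M S chi chiP.
  rewrite (bigD1 (Ordinal lt_in)) //= eqxx mulr1z big1 ?addr0 ?subrr.
    exact: charS0 chiP.
  by move=> t; rewrite -val_eqE => /negPf/= ->.
- exists (fun=> 0) => M S chi chiP.
  by rewrite big1 ?subr0 // ; apply: char1 chiP.
- exists (fun t => e t + f t) => M S chi chiP.
  refine (charSC chiP (charM chiP Bg Bh) _). under eq_bigr do rewrite mulrzDr.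
  rewrite big_split /= opprD addrACA.
  by apply: (charSD chiP); [exact: (He _ _ _ chiP) | exact: (Hf _ _ _ chiP)].
exists (fun t => - e t) => M S chi chiP; under eq_bigr do rewrite mulrNz.
rewrite sumrN opprK.
have := charSB chiP (charV chiP Bg) (He _ _ _ chiP); rewrite opprB addrA.
by rewrite [_ + \sum__ _]addrAC addrK.
Qed.

(** * A basis of characters up to integers prime to p *)

Section Toeplitz.
Variables (G : groupType) (x : nat -> G) (d k : nat) (al top : nat -> int).
Local Notation N := (d + k.+1)%N.

(* Row i of the relation matrix: the coefficients of A shifted by i, with the
   leading coefficient replaced by [top i]. *)
Definition rel_row (i t : nat) : int :=
  if (i <= t < i + d)%N then al (t - i)%N else if t == (i + d)%N then top i else 0.

(** Enumerates the d indices outside the window s, ..., s + k. *)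
Definition other_index (s l : nat) : nat := if (l < s)%N then l else (l + k.+1)%N.

Lemma sum_split_window (M : zmodType) (s : nat) (F : nat -> M) : (s < d)%N ->
  \sum_(t < N) F t =
    \sum_(j < k.+1) F (s + j)%N + \sum_(l < d) F (other_index s l).
Proof.
move=> lt_sd; rewrite -!(big_mkord xpredT F) -(big_mkord xpredT (fun j => F (s + j)%N)).
rewrite -(big_mkord xpredT (fun l => F (other_index s l))).
rewrite (@big_cat_nat _ _ _ s) ?leq0n //=; last by rewrite (leq_trans (ltnW lt_sd)) ?leq_addr.
rewrite (@big_cat_nat _ _ _ (s + k.+1)%N _ N) ?leq_addr ?leq_add2r ?(ltnW lt_sd) //=.
rewrite (@big_cat_nat _ _ _ s 0 d) ?leq0n ?(ltnW lt_sd) //= addrCA; congr (_ + (_ + _)).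
- by rewrite -{1}[s]add0n big_addn addKn; apply: eq_bigr => j _; rewrite addnC.
- rewrite !big_nat; apply: eq_bigr => l /andP[_ lt_ls].
  by rewrite /other_index lt_ls.
rewrite big_addn addnK !big_nat; apply: eq_bigr => l /andP[le_sl _].
by rewrite /other_index ltnNge le_sl.
Qed.

Variables (p s : nat).
Hypotheses (pr_p : prime p) (lt_sd : (s < d)%N) (al_s : ~~ (p %| al s)%Z).
Hypothesis al_gt : forall j, (s < j < d)%N -> (p %| al j)%Z.
Hypothesis top_p : forall i, (p %| top i)%Z.
Hypothesis relP : forall i (M : zmodType) (S : M -> Prop) (chi : G -> M),
  (i <= k)%N -> character (gen_by x N) S chi ->
  S (\sum_(t < N) chi (x t) *~ rel_row i t).

Lemma Fp_int_eq0 (c : int) : (c%:~R == 0 :> 'F_p) = (p %| c)%Z.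
Proof.
case: c => n; rewrite ?NegzE ?rmorphN ?oppr_eq0 -?pmulrn /=.
  by rewrite -(dvdn_pcharf (pchar_Fp pr_p)).
by rewrite dvdzE abszN absz_nat -(dvdn_pcharf (pchar_Fp pr_p)).
Qed.

(** Since s is the last index with [al s] prime to p, the relation rows restricted to the columns s,
    ..., s + k form a matrix that is lower triangular modulo p with [al s] on the diagonal. Its
    determinant is thus prime to p, and Cramer's rule eliminates the generators of the window. *)
Lemma local_basis : exists2 Q : int, ~~ (p %| Q)%Z & forall b, gen_by x N b ->
  exists c : 'I_d -> int, forall (M : zmodType) (S : M -> Prop) (chi : G -> M),
    character (gen_by x N) S chi ->
    S (chi b *~ Q - \sum_(l < d) chi (x (other_index s l)) *~ c l).
Proof.
pose T := (\matrix_(i < k.+1, j < k.+1) rel_row i (s + j))%R.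
exists (\det T).
  rewrite -Fp_int_eq0 -(det_map_mx (intr : int -> 'F_p)) det_trig.
    rewrite prodf_seq_neq0; apply/allP => i _ /=; rewrite !mxE /rel_row.
    by rewrite leq_addl addnC ltn_add2l lt_sd /= addKn Fp_int_eq0.
  apply/is_trig_mxP => i j lt_ij; rewrite !mxE; apply/eqP; rewrite Fp_int_eq0.
  rewrite /rel_row; case: ifP => [/andP[le1 lt2]|_].
    by apply: al_gt; apply/andP; lia.
  by case: ifP; rewrite ?top_p ?dvdz0.
move=> b /gen_by_exponents[e He].
pose E := (\row_(j < k.+1) e (s + j)%N)%R; pose mu := E *m \adj T.
have Emu : \det T *: E = mu *m T by rewrite -mulmxA mul_adj_mx mul_mx_scalar.
clearbody mu.
(* Exponents of b, scaled by the determinant and reduced by the combination of relations that clears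
   the window. *)
pose v t := \det T * e t - \sum_(i < k.+1) mu 0 i * rel_row i t.
have v0 (j : 'I_k.+1) : v (s + j)%N = 0.
  have := congr1 (fun A : 'rV_k.+1 => A 0 j) Emu.
  rewrite !mxE /v => ->; under eq_bigr do rewrite mxE; exact: subrr.
exists (fun l => v (other_index s l)) => M S chi chiP.
have -> : \sum_(l < d) chi (x (other_index s l)) *~ v (other_index s l) =
    \sum_(t < N) chi (x t) *~ v t.
  rewrite (sum_split_window (fun t => chi (x t) *~ v t) lt_sd).
  rewrite [X in _ = X + _]big1 ?add0r //.
  by move=> j _; rewrite v0 mulr0z.
have := charSMz chiP (\det T) (He _ _ _ chiP); rewrite mulrzBl => H1.
apply: (charSC chiP H1).
suff -> : (\sum_(t < N) chi (x t) *~ e t) *~ \det T - \sum_(t < N) chi (x t) *~ v t =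
   \sum_(i < k.+1) (\sum_(t < N) chi (x t) *~ rel_row i t) *~ mu 0 i.
  apply: (charS_sum chiP) => i; apply: (charSMz chiP).
  by apply: (relP _ chiP); rewrite -ltnS.
rewrite mulrz_suml -sumrB; under [RHS]eq_bigr do rewrite mulrz_suml.
rewrite exchange_big; apply: eq_bigr => t _ /=.
rewrite /v mulrzBr -mulrzA mulrC opprB addrC subrK mulrz_sumr.
by apply: eq_bigr => i _; rewrite -mulrzA mulrC.
Qed.

End Toeplitz.

(** * Augmentation powers *)

Lemma approx_step (R : nzRingType) (x be m s : R) (a b : int) :
  (x * be) *~ (a * b) - m * s =
  (x *~ a - m) * (be *~ b) + m * (be *~ b - s).
Proof.
rewrite (mulrBl (be *~ b)) (mulrBr m) addrA subrK; congr (_ - _).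
by rewrite mulrzAl mulrzAr -mulrzA mulrC.
Qed.

Section AugmentationPowers.
Variables (K : numFieldType) (d : nat) (S : nzRingType) (G : groupType).
Variables (P : G -> Prop) (r : G -> (ncps K d * S)%type).
Hypotheses (rM : forall g h, r (g * h)%g = r g * r h) (r1 : r 1%g = 1).
Hypothesis r_nil : forall g, (r g).1 [::] = 1.
Local Notation B := (gen_subgroup P).
Local Notation T := (ncps K d * S)%type.
Implicit Types (x y z : T) (n m : nat).

(* [aug n] is the n-th power of the augmentation ideal of the ring spanned by
   the image of B. *)
Inductive aug : nat -> T -> Prop :=
| aug_r c : B c -> aug 0 (r c)
| aug_step n x b : B b -> aug n x -> aug n.+1 (x * (r b - 1))
| aug_0 n : aug n 0
| aug_B n x y : aug n x -> aug n y -> aug n (x - y).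

Lemma augN n x : aug n x -> aug n (- x).
Proof. by move=> ax; rewrite -sub0r; apply: aug_B => //; apply: aug_0. Qed.
Lemma augD n x y : aug n x -> aug n y -> aug n (x + y).
Proof. by move=> ax ay; rewrite -[y]opprK; apply/aug_B/augN. Qed.
Lemma augMz n x i : aug n x -> aug n (x *~ i).
Proof.
move=> ax; have aX k : aug n (x *+ k).
  by elim: k => [|k IHk]; [apply: aug_0 | rewrite mulrS; apply: augD].
by case: i => k; [apply: aX | rewrite NegzE mulrNz; apply/augN/aX].
Qed.
Lemma aug_sum n (I : Type) (s : seq I) (F : I -> T) :
  (forall i, aug n (F i)) -> aug n (\sum_(i <- s) F i).
Proof. by move=> aF; elim/big_ind: _ => //; [apply: aug_0|apply: augD]. Qed.

(** The factor r b - 1 moves past r c at the price of conjugating b by c. *)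
Lemma aug_mulr n x c : B c -> aug n x -> aug n (x * r c).
Proof.
move=> Bc ax; elim: ax => [b Bb|{}n {}x b Bb ax IHx|{}n|{}n {}x y _ IHx _ IHy].
- by rewrite -rM; apply/aug_r/gen_M.
- have -> : x * (r b - 1) * r c = x * r c * (r (b ^ c)%g - 1).
    rewrite -!mulrA; congr (x * _).
    by rewrite mulrBl mul1r mulrBr mulr1 -!rM -conjgC.
  by apply: aug_step => //; rewrite conjgE; do !apply: gen_M => //; apply: gen_V.
- by rewrite mul0r; apply: aug_0.
by rewrite mulrBl; apply: aug_B.
Qed.

Lemma augW n x : aug n.+1 x -> aug n x.
Proof.
move En : n.+1 => m ax; elim: ax n En => // [n' {}x b Bb ax _ n [->]|n' n _|].
- by rewrite mulrBr mulr1; apply: aug_B => //; apply: aug_mulr.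
- exact: aug_0.
by move=> n' {}x y _ IHx _ IHy n En; apply: aug_B; auto.
Qed.

Lemma augM n m x y : aug n x -> aug m y -> aug (n + m) (x * y).
Proof.
move=> ax; elim=> [c Bc|{}m {}y b Bb _ IHy|{}m|{}m {}y z _ IHy _ IHz].
- by rewrite addn0; apply: aug_mulr.
- by rewrite addnS mulrA; apply: aug_step.
- by rewrite mulr0; apply: aug_0.
by rewrite mulrBr; apply: aug_B.
Qed.

Lemma aug_one : aug 0 1.
Proof. by rewrite -r1; apply/aug_r/gen_1. Qed.

Lemma aug_sub1 b : B b -> aug 1 (r b - 1).
Proof. by move=> Bb; rewrite -[_ - _]mul1r; apply/aug_step/aug_one. Qed.

Lemma aug_coef g w : (r g - 1).1 w = (r g).1 w - (w == [::])%:R.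
Proof. by rewrite -ncps1. Qed.

Lemma fstB (x z : T) : (x - z).1 = x.1 - z.1.
Proof. by []. Qed.

Lemma fstMz (x : T) i : (x *~ i).1 = x.1 *~ i.
Proof. exact: (raddfMz (@fst (ncps K d) S)). Qed.

Lemma aug_small n x : aug n x -> small n x.1.
Proof.
elim=> {n x} [//|n x b Bb _ IHx|n|n x y _ IHx _ IHy].
- rewrite -addn1; apply: smallM => //; apply/small1.
  by rewrite aug_coef r_nil subrr.
- exact: small_zero.
exact: smallB.
Qed.

Lemma aug_character : character B (aug 2) (fun g => r g - 1).
Proof.
split=> [|x y|g h Bg Bh]; [exact: aug_0 | exact: aug_B |].
have -> : r (g * h)%g - 1 - (r g - 1) - (r h - 1) = (r g - 1) * (r h - 1).
  rewrite rM mulrBl mul1r mulrBr mulr1; congr (_ - _).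
  by rewrite opprB addrA subrK.
exact: (augM (aug_sub1 Bg) (aug_sub1 Bh)).
Qed.

Variables (p : nat) (y : 'I_d -> G) (Q0 : int).
Hypotheses (pr_p : prime p) (pQ0 : ~~ (p %| Q0)%Z) (By : forall j, B (y j)).
Hypothesis y_gen : forall b, B b -> exists c : 'I_d -> int,
  aug 2 ((r b - 1) *~ Q0 - \sum_j (r (y j) - 1) *~ c j).
Hypothesis y_unit : (\matrix_(i, j) (r (y i)).1 [:: j]) \in unitmx.

(** Homogeneous noncommutative polynomials of degree n in the elements [r (y j) - 1], with integer
    coefficients. *)
Fixpoint mono n x : Prop :=
  if n is n'.+1 then exists2 f : 'I_d -> T, (forall j, mono n' (f j))
    & x = \sum_j f j * (r (y j) - 1)
  else exists c : int, x = c%:~R.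

Lemma mono0 n : mono n 0.
Proof.
elim: n => [|n IHn] /=; first by exists 0.
by exists (fun=> 0) => //; rewrite big1 // => j _; rewrite mul0r.
Qed.

Lemma monoB n x z : mono n x -> mono n z -> mono n (x - z).
Proof.
elim: n x z => [|n IHn] x z /=.
  by move=> [c ->] [c' ->]; exists (c - c'); rewrite intrB.
move=> [f Mf ->] [f' Mf' ->]; exists (fun j => f j - f' j); first by auto.
by rewrite -sumrB; apply: eq_bigr => j _; rewrite mulrBl.
Qed.

Lemma monoMz n x i : mono n x -> mono n (x *~ i).
Proof.
elim: n x => [|n IHn] x /=.
  by move=> [c ->]; exists (c * i); rewrite intrM mulrzr.
move=> [f Mf ->]; exists (fun j => f j *~ i); first by auto.
by rewrite mulrz_suml; apply: eq_bigr => j _; rewrite mulrzAl.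
Qed.

Lemma mono_aug n x : mono n x -> aug n x.
Proof.
elim: n x => [|n IHn] x /= => [[c ->]|[f Mf ->]].
  by apply: augMz; apply: aug_one.
by apply: aug_sum => j; apply: aug_step; auto.
Qed.

(** In lowest degree the series of the [r (y j) - 1] are linear forms, independent by [y_unit]. A
    vanishing part of degree n therefore kills all coefficients of the polynomial, and with them its
    second component too. *)
Lemma mono_inj n x : mono n x -> small n.+1 x.1 -> x = 0.
Proof.
elim: n x => [|n IHn] x /= => [[c ->]|[f Mf ->]] sx.
  have := sx [::] isT; rewrite fstMz.
  by rewrite ncpsMz /= => /eqP; rewrite intr_eq0 => /eqP->.
suff sfi i : small n.+1 (f i).1 by rewrite big1 // => i _; rewrite (IHn (f i)) ?mul0r.
have sf j : small n (f j).1 by apply/aug_small/mono_aug.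
move: i; suff E w : size w = n -> forall j, (f j).1 w = 0.
  move=> j w; rewrite ltnS leq_eqVlt => /predU1P[/E->//|]; exact: sf.
move=> szw; pose u := \row_j (f j).1 w.
suff /rowP u0 : u = 0 by move=> j; have := u0 j; rewrite !mxE.
rewrite -[u](mulmxK y_unit) (_ : u *m _ = 0) ?mul0mx //.
apply/rowP => b; rewrite !mxE; under eq_bigr do rewrite !mxE.
have := sx (rcons w b); rewrite size_rcons szw ltnSn => /(_ isT).
rewrite raddf_sum ncps_sum => sx0; rewrite -[RHS]sx0; apply: eq_bigr => j _.
rewrite -[RHS]/(((f j).1 * (r (y j) - 1).1) (rcons w b)) ncpsM size_rcons -cats1 szw.
rewrite big_ord_recr big_ord_recr /= -szw.
rewrite drop_size_cat // take_size_cat // big1 ?add0r; last first.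
  by move=> i _; rewrite sf ?mul0r // size_take_min gtn_min -szw ltn_ord.
rewrite drop_oversize ?size_cat ?addn1 // !ncpsB r_nil !ncps1 eqxx subrr mulr0 addr0.
by rewrite subr0.
Qed.

(** By [y_gen] the last factor r b - 1 of a product can be replaced by an integer combination of the
    [r (y j) - 1], at the cost of a factor Q0 and of an error one step deeper. *)
Lemma mono_approx n x : aug n x -> exists Q : int,
  ~~ (p %| Q)%Z /\ exists2 m, mono n m & aug n.+1 (x *~ Q - m).
Proof.
have pM Q Q' : ~~ (p %| Q)%Z -> ~~ (p %| Q')%Z -> ~~ (p %| Q * Q')%Z.
  by rewrite !dvdzE abszM Euclid_dvdM // negb_or => -> ->.
have p1 : ~~ (p %| 1)%Z by rewrite dvdzE dvdn1 neq_ltn prime_gt1 ?orbT.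
elim=> {n x} [c Bc|n x b Bb ax [Q [pQ [m Mm ad]]]|n|n x z _ [Q [pQ [m Mm ad]]] _ [Q' [pQ' [m' Mm' ad']]]].
- exists 1; split=> //; exists 1; first by exists 1.
  exact: aug_sub1.
- have [c ac] := y_gen Bb; exists (Q * Q0); split; first exact: pM.
  set s := \sum_j _ in ac; exists (m * s).
    exists (fun j => m *~ c j) => [j|]; first exact: monoMz.
    by rewrite mulr_sumr; apply: eq_bigr => j _; rewrite mulrzAr mulrzAl.
  rewrite approx_step.
  apply: augD; first by rewrite -addn1; apply: augM => //; apply/augMz/aug_sub1.
  by rewrite -addn2; apply: augM => //; apply: mono_aug.
- exists 1; split=> //; exists 0; first exact: mono0.
  by rewrite mul0rz subr0; apply: aug_0.
exists (Q * Q'); split; first exact: pM.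
exists (m *~ Q' - m' *~ Q); first by apply: monoB; apply: monoMz.
have -> : (x - z) *~ (Q * Q') - (m *~ Q' - m' *~ Q) =
    (x *~ Q - m) *~ Q' - (z *~ Q' - m') *~ Q.
  rewrite !mulrzBl -!mulrzA [Q' * Q]mulrC !opprB.
  by rewrite addrACA [RHS]addrACA; congr (_ + _); rewrite addrC.
by apply: aug_B; apply: augMz.
Qed.

(* An element trivial in the power series ring is, up to multiples prime to p,
   in every power of the augmentation ideal. *)
Lemma kernel_in_aug b n : B b -> (r b).1 = 1 ->
  exists2 Q : int, ~~ (p %| Q)%Z & aug n ((r b - 1) *~ Q).
Proof.
move=> Bb rb1; elim: n => [|n [Q pQ aQ]].
  exists 1; first by rewrite dvdzE dvdn1 neq_ltn prime_gt1 ?orbT.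
  exact/augW/aug_sub1.
have [Q' [pQ' [m Mm am]]] := mono_approx aQ.
(* As r b has trivial series, the series of m is, up to sign, that of an element of [aug n.+1],
   hence of order at least n + 1. *)
have m0 : m = 0.
  apply: mono_inj Mm _.
  have z1 : ((r b - 1) *~ Q).1 = 0 by rewrite fstMz fstB rb1 subrr mul0rz.
  have -> : m.1 = - ((r b - 1) *~ Q *~ Q' - m).1.
    by rewrite fstB fstMz z1 mul0rz sub0r opprK.
  exact/smallN/aug_small.
exists (Q * Q'); first by rewrite dvdzE abszM Euclid_dvdM // negb_or pQ.
by move: am; rewrite m0 subr0 mulrzA.
Qed.

End AugmentationPowers.

(** * From augmentation depth to depth in a p-adic filtration *)

Section Filtration.
Variables (S : nzRingType) (Fil : nat -> S -> Prop) (p : nat) (Y : S).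
Hypotheses (pr_p : prime p) (Fil0 : forall k, Fil k 0).
Hypothesis FilB : forall k x y, Fil k x -> Fil k y -> Fil k (x - y).
Hypothesis FilM : forall k l x y, Fil k x -> Fil l y -> Fil (k + l)%N (x * y).
Hypothesis FilW : forall k l x, (k <= l)%N -> Fil l x -> Fil k x.
Hypothesis Filp : forall k x, Fil k x -> Fil k.+1 (x *+ p).
Hypotheses (Fil1 : Fil 0 1) (FilY : Fil 0 Y) (FilYp : Fil 1 (Y ^+ p - 1)).
Implicit Types (x y z : S) (k l n : nat).

Lemma FilN k x : Fil k x -> Fil k (- x).
Proof. by move=> Fx; rewrite -sub0r; apply: FilB. Qed.
Lemma FilD k x y : Fil k x -> Fil k y -> Fil k (x + y).
Proof. by move=> Fx Fy; rewrite -[y]opprK; apply/FilB/FilN. Qed.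
Lemma Fil_sum k (I : Type) (s : seq I) (E : I -> S) :
  (forall i, Fil k (E i)) -> Fil k (\sum_(i <- s) E i).
Proof. by move=> FE; elim/big_ind: _ => //; apply: FilD. Qed.
Lemma FilMn k x n : Fil k x -> Fil k (x *+ n).
Proof. by move=> Fx; elim: n => // n IHn; rewrite mulrS; apply: FilD. Qed.
Lemma FilX x n : Fil 0 x -> Fil 0 (x ^+ n).
Proof. by move=> Fx; elim: n => // n IHn; rewrite exprS -[0%N]addn0; apply: FilM. Qed.
Lemma FilMl k x y : Fil 0 x -> Fil k y -> Fil k (x * y).
Proof. by move=> Fx Fy; rewrite -[k]add0n; apply: FilM. Qed.
Lemma FilMr k x y : Fil k x -> Fil 0 y -> Fil k (x * y).
Proof. by move=> Fx Fy; rewrite -[k]addn0; apply: FilM. Qed.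

Let th := Y - 1.

Lemma Fil_th : Fil 0 th. Proof. exact: FilB. Qed.

(** The inner binomial coefficients are divisible by p. What remains is (Y^p - 1) + (1 + (-1)^p),
    whose last bracket is 0 for odd p and equals p for p = 2. *)
Lemma Fil_thp : Fil 1 (th ^+ p).
Proof.
have p_gt1 := prime_gt1 pr_p.
rewrite exprBn_comm; last exact: commr1.
rewrite -(big_mkord xpredT (fun i => ((-1) ^+ i * Y ^+ (p - i) * 1 ^+ i) *+ 'C(p, i))).
rewrite big_nat_recr //= big_ltn ?(ltnW p_gt1) // subnn bin0 binn !expr0 subn0 !mulr1n.
rewrite mul1r !mulr1 expr1n mulr1.
set M := \sum_(1 <= i < p) _; have FM : Fil 1 M.
  rewrite /M big_nat; elim/big_ind: _ => // [x y|i /andP[i_gt0 lt_ip]]; first exact: FilD.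
  have /dvdnP[q ->] := prime_dvd_bin pr_p (introT andP (conj i_gt0 lt_ip)).
  rewrite mulrnA; apply/Filp/FilMn; rewrite expr1n mulr1 -signr_odd.
  by case: odd; rewrite ?expr1 ?mulN1r ?expr0 ?mul1r; [apply: FilN|]; apply: FilX.
rewrite (_ : _ + _ = (Y ^+ p - 1) + M + (1 + (-1) ^+ p)); last first.
  by rewrite [_ - 1 + M]addrAC -[RHS]addrA addKr.
apply: FilD; first exact: FilD.
have [p2 | podd] := even_prime pr_p; last by rewrite -signr_odd podd subrr.
rewrite p2 -signr_odd expr0 -mulr2n -[X in 1 *+ X]p2; exact: Filp.
Qed.

Lemma Fil_thX j : Fil (j %/ p)%N (th ^+ j).
Proof.
rewrite {2}(divn_eq j p) exprD mulnC exprM; apply: FilMr; last exact/FilX/Fil_th.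
elim: (_ %/ _)%N => // n IHn; rewrite exprS -add1n; apply: FilM => //.
exact: Fil_thp.
Qed.

Lemma YX_th j : exists2 ka, Fil 0 ka & Y ^+ j - 1 = th * ka /\ GRing.comm th ka.
Proof.
have cY : GRing.comm th Y by apply/commr_sym/commrB; [apply: commr_refl|apply: commr1].
exists (\sum_(i < j) Y ^+ i); first by apply: Fil_sum => i; apply: FilX.
by split; [exact: subrX1 | apply: commr_sum => i _; apply: commrX].
Qed.

(** A finer filtration, with weight 1 for [th] and weight p for one step of [Fil]. A factor b - 1
    gains only one unit of weight, which [Fil] alone cannot record. *)
Inductive theta (n : nat) : S -> Prop :=
| theta_gen k j x : Fil k x -> (n <= p * k + j)%N -> theta n (x * th ^+ j)
| theta_0 : theta n 0
| theta_B x y : theta n x -> theta n y -> theta n (x - y).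

Lemma thetaN n x : theta n x -> theta n (- x).
Proof. by move=> tx; rewrite -sub0r; apply: theta_B => //; apply: theta_0. Qed.
Lemma thetaD n x y : theta n x -> theta n y -> theta n (x + y).
Proof. by move=> tx ty; rewrite -[y]opprK; apply/theta_B/thetaN. Qed.

Lemma theta_Fil n x : theta n x -> Fil (n %/ p)%N x.
Proof.
elim=> {x} [k j x Fx le_n||x y _ IHx _]; [|exact: Fil0|exact: FilB].
apply: FilW (FilM Fx (Fil_thX j)).
by rewrite -divnMDl ?prime_gt0 // mulnC leq_div2r.
Qed.

Lemma theta_step n x (b : S) j : Fil 1 (b - Y ^+ j) ->
  theta n x -> theta n.+1 (x * (b - 1)).
Proof.
move=> Fb; elim=> {x} [k i x Fx le_n||x y _ IHx _ IHy]; first 1 last.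
- by rewrite mul0r; apply: theta_0.
- by rewrite mulrBl; apply: theta_B.
have [ka Fka [Eka cka]] := YX_th j.
have -> : b - 1 = th * ka + (b - Y ^+ j) by rewrite -Eka [RHS]addrC addrA subrK.
rewrite mulrDr; apply: thetaD.
  have -> : x * th ^+ i * (th * ka) = x * ka * th ^+ i.+1.
    rewrite -!mulrA; congr (x * _); rewrite mulrA -exprSr.
    exact/commr_sym/commrX/commr_sym.
  by apply: (@theta_gen _ k); [apply: FilMr | rewrite addnS ltnS].
(* By [Fil_thX] the weight rises from p k + i to p (k + i %/ p + 1), which is larger because the
   remainder of i is less than p. *)
rewrite -[X in theta _ X]mulr1 -(expr0 th).
apply: theta_gen (FilM (FilM Fx (Fil_thX i)) Fb) _.
rewrite addn0 !mulnDr muln1 -addnA; apply: leq_ltn_trans le_n _.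
rewrite ltn_add2l {1}(divn_eq i p) mulnC ltn_add2l ltn_mod.
exact: prime_gt0.
Qed.

End Filtration.

(** Every group element acts as a power of Y modulo [Fil 1], so each factor r b - 1 raises the
    weight in [theta] by one; p units of weight make one step of [Fil]. *)
Lemma aug_theta (d p : nat) (S : nzRingType) (G : groupType) (P : G -> Prop)
    (r : G -> (ncps rat d * S)%type) (Fil : nat -> S -> Prop) (Y : S) n x :
  prime p -> (forall k, Fil k 0) ->
  (forall k x y, Fil k x -> Fil k y -> Fil k (x - y)) ->
  (forall k l x y, Fil k x -> Fil l y -> Fil (k + l)%N (x * y)) ->
  (forall k l x, (k <= l)%N -> Fil l x -> Fil k x) ->
  (forall k x, Fil k x -> Fil k.+1 (x *+ p)) ->
  Fil 0 1 -> Fil 0 Y -> Fil 1 (Y ^+ p - 1) ->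
  (forall g h, r (g * h)%g = r g * r h) -> r 1%g = 1 ->
  (forall g, P g -> [/\ Fil 0 (r g).2, Fil 0 (r g^-1%g).2
                      & exists j, Fil 1 ((r g).2 - Y ^+ j)]) ->
  aug P r n x -> Fil (n %/ p)%N x.2.
Proof.
move=> pr_p Fil0 FilB FilM FilW Filp Fil1 FilY FilYp rM r1 rP.
have FilN k y : Fil k y -> Fil k (- y) by move=> Fy; rewrite -sub0r; apply: FilB.
have FilD k y z : Fil k y -> Fil k z -> Fil k (y + z).
  by move=> Fy Fz; rewrite -[z]opprK; apply/FilB/FilN.
have FilM0 y z : Fil 0 y -> Fil 0 z -> Fil 0 (y * z) by exact: FilM.
have FilMl y z : Fil 0 y -> Fil 1 z -> Fil 1 (y * z) by exact: FilM.
have FilMr y z : Fil 1 y -> Fil 0 z -> Fil 1 (y * z) by exact: FilM.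
have FilX0 y k : Fil 0 y -> Fil 0 (y ^+ k).
  by move=> Fy; elim: k => // k IHk; rewrite exprS; apply: FilM0.
have rM2 g h : (r (g * h)%g).2 = (r g).2 * (r h).2 by rewrite rM.
have r12 : (r 1%g).2 = 1 by rewrite r1.
have rBP b : gen_subgroup P b -> [/\ Fil 0 (r b).2, Fil 0 (r b^-1%g).2
    & exists j, Fil 1 ((r b).2 - Y ^+ j)].
  elim=> [g /rP//| |g h _ [Fg FgV [j Fj]] _ [Fh FhV [i Fi]]|g _ [Fg FgV [j Fj]]].
  - by rewrite invg1 r12; split=> //; exists 0; rewrite expr0 subrr.
  - rewrite invgM !rM2; split; [exact: FilM0 | exact: FilM0 |].
    exists (j + i)%N; rewrite exprD.
    rewrite (_ : _ - _ = ((r g).2 - Y ^+ j) * (r h).2 + Y ^+ j * ((r h).2 - Y ^+ i)).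
      by apply: FilD; [apply: FilMr | apply/FilMl => //; apply: FilX0].
    by rewrite mulrBl mulrBr addrA subrK.
  (* Modulo [Fil 1] one has Y^p = 1, so the inverse of Y^j is Y^((p - 1) j). *)
  rewrite invgK; split=> //; exists (p.-1 * j)%N.
  have p_gt0 := prime_gt0 pr_p.
  have E : (r g^-1%g).2 * (r g).2 = 1.
    by rewrite -rM2 mulVg.
  have FX i : Fil 1 (1 - Y ^+ (p * i)).
    rewrite exprM -opprB; apply: FilN.
    elim: i => [|i IHi]; first by rewrite subrr.
    rewrite exprS (_ : _ - 1 = Y ^+ p * ((Y ^+ p) ^+ i - 1) + (Y ^+ p - 1)).
      by apply: FilD => //; apply/FilMl => //; apply: FilX0.
    by rewrite mulrBr mulr1 addrA subrK.
  rewrite (_ : _ - _ = (r g^-1%g).2 * (1 - Y ^+ (p * j)) - (r g^-1%g).2 * ((r g).2 - Y ^+ j) * Y ^+ (p.-1 * j)).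
    by apply: FilB; [apply: FilMl | apply/FilMr/FilX0 => //; apply: FilMl].
  rewrite (mulrBr _ _ (Y ^+ j)) E mulrBr mulr1 mulrBl mul1r -mulrA -exprD.
  rewrite -mulSn prednK //.
  by rewrite opprB addrA subrK.
move=> ax; suff : theta Fil p Y n x.2 by apply: theta_Fil.
elim: ax => {n x} [c /rBP[Fc _ _]|n x b /rBP[_ _ [j Fj]] _ IHx|n|n x y _ IHx _ IHy].
- by rewrite -[(r c).2]mulr1 -(expr0 (Y - 1)); apply: theta_gen Fc _.
- exact: (theta_step _ _ _ _ _ _ _ _ Fj).
- exact: theta_0.
exact: theta_B.
Qed.

(** * Integral lattices in truncated series *)

Section Integrality.
Variables (d p n C : nat).
Local Notation A := (ncps rat d).
Implicit Types (q : rat) (f g : A).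

Definition pdiv_at (e : nat) (q : rat) : Prop :=
  exists c : int, q = (p ^ e)%:R * c%:~R.

Lemma pdiv0 e : pdiv_at e 0. Proof. by exists 0; rewrite mulr0. Qed.
Lemma pdivB e q q' : pdiv_at e q -> pdiv_at e q' -> pdiv_at e (q - q').
Proof. by move=> [c ->] [c' ->]; exists (c - c'); rewrite intrB mulrBr. Qed.
Lemma pdiv_sum e (I : Type) (s : seq I) (F : I -> rat) :
  (forall i, pdiv_at e (F i)) -> pdiv_at e (\sum_(i <- s) F i).
Proof.
move=> eF; elim/big_ind: _ => // [|x y ex ey]; first exact: pdiv0.
by rewrite -[y]opprK; apply: pdivB => //; rewrite -sub0r; apply: pdivB => //; apply: pdiv0.
Qed.
Lemma pdivW e e' q : (e <= e')%N -> pdiv_at e' q -> pdiv_at e q.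
Proof.
move=> le_e [c ->]; exists ((p ^ (e' - e))%N%:Z * c).
by rewrite intrM mulrA -pmulrn -natrM -expnD subnKC.
Qed.
Lemma pdivM e e' q q' : pdiv_at e q -> pdiv_at e' q' -> pdiv_at (e + e') (q * q').
Proof.
by move=> [c ->] [c' ->]; exists (c * c'); rewrite expnD natrM intrM mulrACA.
Qed.

(** The k-th power of the ideal generated by p and the variables, in integral series cut off beyond
    degree n; C rescales the variables to clear denominators. The subtraction is truncated: in
    degrees from k on only integrality is asked. *)
Definition lattice k f : Prop := forall w, (size w <= n)%N ->
  pdiv_at (k - size w) (C%:R ^+ size w * f w).

Lemma lattice0 k : lattice k 0.
Proof. by move=> w _; rewrite ncps0 mulr0; apply: pdiv0. Qed.
Lemma latticeB k f g : lattice k f -> lattice k g -> lattice k (f - g).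
Proof.
by move=> lf lg w lew; rewrite ncpsB mulrBr; apply: pdivB; [apply: lf|apply: lg].
Qed.
Lemma latticeW k l f : (k <= l)%N -> lattice l f -> lattice k f.
Proof. by move=> lekl lf w lew; apply: pdivW (lf w lew); apply: leq_sub2r. Qed.
Lemma lattice_p k f : lattice k f -> lattice k.+1 (f *+ p).
Proof.
move=> lf w lew; rewrite ncpsMn mulrnAr -mulr_natl.
apply: (@pdivW _ (1 + (k - size w))); first by rewrite add1n; lia.
by apply: pdivM (lf w lew); exists 1; rewrite expn1 mulr1.
Qed.
Lemma latticeM k l f g : lattice k f -> lattice l g -> lattice (k + l) (f * g).
Proof.
move=> lf lg w lew; rewrite ncpsM mulr_sumr; apply: pdiv_sum => i.
have lei : (i <= size w)%N by rewrite -ltnS.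
have -> : C%:R ^+ size w = C%:R ^+ i * C%:R ^+ (size w - i) :> rat.
  by rewrite -exprD subnKC.
rewrite mulrACA.
have szt : size (take i w) = i by rewrite size_takel.
have szd : size (drop i w) = (size w - i)%N by rewrite size_drop.
apply: (@pdivW _ ((k - i) + (l - (size w - i)))); first by lia.
have := lf (take i w); have := lg (drop i w); rewrite szt szd => Hg Hf.
by apply: pdivM; [apply: Hf | apply: Hg]; lia.
Qed.
Lemma lattice1 : lattice 0 1.
Proof.
move=> w _; rewrite ncps1; case: w => [|a w] /=; first by exists 1; rewrite !mulr1.
by rewrite mulr0; apply: pdiv0.
Qed.
Lemma lattice_aug f : lattice 0 f -> f [::] = 0 -> lattice 1 f.
Proof.
move=> lf f0 [|a w] lew; first by rewrite f0 mulr0; apply: pdiv0.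
exact: lf.
Qed.

End Integrality.

Lemma latticeC d p n C C' (f : ncps rat d) : (C %| C')%N ->
  lattice p n C 0 f -> lattice p n C' 0 f.
Proof.
move=> /dvdnP[q ->] lf w lew; rewrite natrM exprMn -mulrA -[(0 - _)%N]add0n.
by apply: pdivM (lf w lew); exists (q ^ size w)%N%:Z; rewrite mul1r -pmulrn natrX.
Qed.

Lemma rat_denominator (q : rat) : exists2 C, (0 < C)%N & exists c : int, C%:R * q = c%:~R.
Proof.
exists `|denq q|%N; first by rewrite absz_gt0 denq_neq0.
by exists (numq q); rewrite -{2}[q]divq_num_den mulrC natr_absz ger0_norm ?denq_ge0 // divfK ?intr_eq0 ?denq_neq0.
Qed.

Lemma common_denominator d n (f : ncps rat d) :
  exists2 C, (0 < C)%N & forall w, (size w <= n)%N -> exists c : int, C%:R * f w = c%:~R.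
Proof.
elim: n f => [|n IHn] f.
  have [C C_gt0 [c Ec]] := rat_denominator (f [::]); exists C => // w.
  by rewrite leqn0 => /nilP->; exists c.
have [C0 C0_gt0 [c Ec]] := rat_denominator (f [::]).
have /choice[D DP] (j : 'I_d) : exists C, (0 < C)%N /\ forall w, (size w <= n)%N ->
    exists c : int, C%:R * f (j :: w) = c%:~R.
  by have [C C_gt0 CP] := IHn (lder j f); exists C.
exists (C0 * \prod_j D j)%N.
  by rewrite muln_gt0 C0_gt0; apply/prodn_gt0 => j; case: (DP j).
case=> [_|j w]; first by exists (c * (\prod_j D j)%N%:Z); rewrite intrM -Ec natrM mulrAC.
rewrite ltnS => /(DP j).2[c' Ec']; rewrite (bigD1 j) //= mulnCA.
by eexists (c' * (C0 * _)%N%:Z); rewrite intrM -Ec' natrM mulrAC.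
Qed.

(** A common denominator C of the coefficients up to degree n suffices, as C divides C^|w| for
    non-empty w. Constant terms are not rescaled, so they have to be integers from the start. *)
Lemma lattice_ex d p n (fs : seq (ncps rat d)) :
  (forall f, f \in fs -> exists c : int, f [::] = c%:~R) ->
  exists2 C, (0 < C)%N & forall f, f \in fs -> lattice p n C 0 f.
Proof.
elim: fs => [|f fs IHfs] fsP; first by exists 1%N.
have [|C C_gt0 CP] := IHfs; first by move=> g gfs; apply: fsP; rewrite inE gfs orbT.
have [C' C'_gt0 C'P] := common_denominator n f.
exists (C' * C)%N => [|g]; first by rewrite muln_gt0 C_gt0 C'_gt0.
rewrite inE => /predU1P[->|/CP lg]; last by apply: latticeC lg; apply: dvdn_mull.
apply: (@latticeC _ _ _ C'); first exact: dvdn_mulr.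
case=> [_|a w lew]; first by have [c ->] := fsP _ (mem_head _ _); exists c; rewrite !mul1r.
have [c Ec] := C'P _ lew; exists ((C' ^ size w)%N%:Z * c).
by rewrite mul1r intrM -Ec -pmulrn natrX /= exprSr mulrA.
Qed.

(** * A matrix root of a power series *)

Lemma coefM_top (R : nzRingType) (P Q : {poly R}) a b :
  (size P <= a.+1)%N -> (size Q <= b.+1)%N ->
  (P * Q)`_(a + b) = P`_a * Q`_b /\ (size (P * Q)%R <= (a + b).+1)%N.
Proof.
move=> szP szQ; split; last first.
  by apply: leq_trans (size_polyMleq _ _) _; lia.
have lt_a : (a < (a + b).+1)%N by rewrite ltnS leq_addr.
rewrite coefM (bigD1 (Ordinal lt_a)) //= addKn big1 ?addr0 // => i.
rewrite -val_eqE /= neq_ltn => /orP[lt_ia | lt_ai].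
  rewrite [X in _ * X]nth_default ?mulr0 // (leq_trans szQ) //; have := ltn_ord i; lia.
by rewrite nth_default ?mul0r // (leq_trans szP).
Qed.

Section RootMatrix.
Variables (A : nzRingType) (p0 : nat) (u : A).
Local Notation p := p0.+2.
Local Notation Mx := 'M[A]_p0.+2.
Implicit Types (h : A) (k : nat).

Definition root_mx : Mx :=
  \matrix_(i, j) (if (i == j.+1 :> nat) then 1
                  else if (i == 0%N :> nat) && (j == p.-1 :> nat) then u else 0).
(** The vectors [colv] and [roww] meet three demands: their product [roww *m colv] is 0;
    [roww h colv] is h u - u h, which detects non-commutation with u; and [roww Pi^k colv], with Pi
    the companion matrix, does not vanish for 0 < k < p. *)
Definition colv : 'cV[A]_p :=
  \col_i (if i == 0%N :> nat then u else if i == 1%N :> nat then 1 else 0).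
Definition roww : 'rV[A]_p := \row_i (if i == 1%N :> nat then - u else 1).
Definition ecol k : 'cV[A]_p := \col_i (i == k :> nat)%:R.

Lemma ecolP m (M : 'M[A]_(m, p)) i k (lt_k : (k < p)%N) : (M *m ecol k) i 0 = M i (Ordinal lt_k).
Proof.
rewrite mxE (bigD1 (Ordinal lt_k)) //= mxE eqxx mulr1 big1 ?addr0 // => j.
by rewrite -val_eqE mxE => /negPf/= ->; rewrite mulr0.
Qed.

Lemma root_ecol k : (k.+1 < p)%N -> root_mx *m ecol k = ecol k.+1.
Proof.
move=> lt_k; apply/colP => i; rewrite (ecolP _ _ (ltnW lt_k)) !mxE /=.
by case: eqP => // _; rewrite [k == _]ltn_eqF ?andbF.
Qed.

Lemma root_ecol_last : root_mx *m ecol p.-1 = u%:M *m ecol 0.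
Proof.
apply/colP => i; rewrite !(ecolP _ _ (ltnSn _), ecolP _ _ (ltn0Sn _)) !mxE /=.
rewrite ltn_eqF ?ltn_ord // eqxx andbT -val_eqE /=.
by case: eqP => // _; rewrite mulr0n.
Qed.

Lemma mulmx_scalarE m n (M : 'M[A]_(m, n)) a i j : (M *m a%:M) i j = M i j * a.
Proof.
rewrite mxE (bigD1 j) //= mxE eqxx mulr1n big1 ?addr0 // => l /negPf nlj.
by rewrite mxE nlj mulr0n mulr0.
Qed.

Lemma scalar_mulmxE m n (M : 'M[A]_(m, n)) a i j : (a%:M *m M) i j = a * M i j.
Proof. by rewrite mul_scalar_mx mxE. Qed.

Lemma scalar_mx_commute m n (M : 'M[A]_(m, n)) :
  (forall i j, GRing.comm u (M i j)) -> M *m u%:M = u%:M *m M.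
Proof.
by move=> cM; apply/matrixP => i j; rewrite mulmx_scalarE scalar_mulmxE cM.
Qed.

Lemma root_mx_u : root_mx *m u%:M = u%:M *m root_mx.
Proof.
apply: scalar_mx_commute => i j; rewrite mxE; case: ifP => _; first exact: commr1.
by case: ifP => _; [apply: commr_refl | apply: commr0].
Qed.

Lemma root_mxX_u k : root_mx ^+ k *m u%:M = u%:M *m root_mx ^+ k.
Proof.
elim: k => [|k IHk]; first by rewrite mulmx1 mul1mx.
by rewrite exprS -mulmxE -mulmxA IHk mulmxA root_mx_u mulmxA.
Qed.

Lemma root_mxX_ecol k l : (k + l < p)%N -> root_mx ^+ k *m ecol l = ecol (k + l).
Proof.
elim: k => [|k IHk] lt_kl; first by rewrite mul1mx.
by rewrite exprS -mulmxE -mulmxA IHk ?root_ecol // ltnW.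
Qed.

(** The companion matrix moves basis vectors cyclically and picks up the factor u when the index
    passes p. *)
Lemma root_mxX_wrap k l : (l < p)%N -> (k <= l)%N ->
  root_mx ^+ (p - l + k) *m ecol l = u%:M *m ecol k.
Proof.
move=> lt_lp le_kl; have -> : (p - l + k = k + (1 + (p.-1 - l)))%N by move=> /=; lia.
rewrite exprD exprD expr1 -!mulmxE -!mulmxA root_mxX_ecol /=; last by lia.
rewrite subnK; last by rewrite -ltnS.
by rewrite root_ecol_last !mulmxA root_mxX_u -mulmxA root_mxX_ecol ?addn0 //; lia.
Qed.

Lemma root_mxXp : root_mx ^+ p = u%:M.
Proof.
apply/matrixP => i j; rewrite -[in LHS](_ : Ordinal (ltn_ord j) = j); last exact: val_inj.
rewrite -(ecolP (root_mx ^+ p)) -[X in _ ^+ X](subnK (ltnW (ltn_ord j))).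
rewrite root_mxX_wrap ?ltn_ord // scalar_mulmxE !mxE -val_eqE mulr_natr.
by case: eqP.
Qed.

Lemma colvE : colv = u%:M *m ecol 0 + ecol 1.
Proof.
apply/colP => i; rewrite [RHS]mxE scalar_mulmxE !mxE.
by case: (val i) => [|[|k]]; rewrite /= ?mulr1 ?mulr0 ?addr0 ?add0r.
Qed.

Lemma roww_ecol k (lt_k : (k < p)%N) :
  (roww *m ecol k) 0 0 = if k == 1%N then - u else 1.
Proof. by rewrite ecolP mxE. Qed.

Lemma roww_scalar_colv h : (roww *m h%:M *m colv) 0 0 = h * u - u * h.
Proof.
rewrite colvE mulmxDr mxE [roww *m _ *m (_ *m _)]mulmxA.
rewrite -[roww *m _ *m _]mulmxA -scalar_mxM.
rewrite !(ecolP _ _ (ltn0Sn _)) (ecolP _ _ (isT : 1 < p)%N) !mulmx_scalarE !mxE /=.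
by rewrite mul1r mulNr.
Qed.

Lemma roww_colv : roww *m colv = 0.
Proof.
apply/matrixP => i j; rewrite !ord1 -[roww]mulmx1 roww_scalar_colv mul1r mulr1.
by rewrite subrr mxE.
Qed.

Definition lam k : A := (roww *m root_mx ^+ k *m colv) 0 0.

Lemma lamE k : (0 < k < p)%N ->
  lam k = (if k == 1%N then - u else 1) * u + (if k.+1 == p then u else 1).
Proof.
case/andP=> k_gt0 lt_k; rewrite /lam colvE mulmxDr mxE; congr (_ + _).
  rewrite mulmxA -[_ *m _ *m u%:M]mulmxA root_mxX_u mulmxA -[LHS]/((_ *m _) 0 0).
  by rewrite -mulmxA root_mxX_ecol addn0 // ecolP mulmx_scalarE mxE.
rewrite -mulmxA; case: (k.+1 =P p) => [Ek|nk].
  have -> : k = (p - 1 + 0)%N by lia.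
  by rewrite root_mxX_wrap // mulmxA ecolP mulmx_scalarE mxE mul1r.
have lt_k1 : (k + 1 < p)%N by lia.
by rewrite root_mxX_ecol // (roww_ecol lt_k1) addn1 eqSS eqn0Ngt k_gt0.
Qed.

End RootMatrix.

(** * The unit group of a ring *)

Section RingUnits.
Variable R : nzRingType.

(** The inverse is carried as data; by [rval_inj] it is determined by the element. *)
Record runit := RUnit {
  rpair : R * R; _ : (rpair.1 * rpair.2 == 1) && (rpair.2 * rpair.1 == 1) }.
HB.instance Definition _ := [isSub for rpair].
HB.instance Definition _ := [Choice of runit by <:].
Implicit Types f g : runit.

Definition rval f : R := (rpair f).1.

Lemma runitP f : rval f * (rpair f).2 = 1 /\ (rpair f).2 * rval f = 1.
Proof. by case: f => -[a b] ab; case/andP: (ab) => /eqP ? /eqP ?. Qed.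

Definition runit_one := @RUnit (1, 1) (introT andP (conj (introT eqP (mulr1 1)) (introT eqP (mulr1 1)))).
Fact runit_mul_subproof f g :
  (rval f * rval g * ((rpair g).2 * (rpair f).2) == 1)
  && ((rpair g).2 * (rpair f).2 * (rval f * rval g) == 1).
Proof.
have [f1 f2] := runitP f; have [g1 g2] := runitP g.
rewrite -mulrA [rval g * _]mulrA g1 mul1r f1 eqxx /=.
by rewrite -mulrA [(rpair f).2 * _]mulrA f2 mul1r g2.
Qed.
Definition runit_mul f g := @RUnit (_, _) (runit_mul_subproof f g).
Fact runit_inv_subproof f : ((rpair f).2 * rval f == 1) && (rval f * (rpair f).2 == 1).
Proof. by have [-> ->] := runitP f; rewrite eqxx. Qed.
Definition runit_inv f := @RUnit (_, _) (runit_inv_subproof f).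

Fact runit_mulA : associative runit_mul.
Proof. by move=> f g h; apply/val_inj; congr (_, _); rewrite /= !mulrA. Qed.
Fact runit_mul1 : left_id runit_one runit_mul.
Proof. by move=> f; apply/val_inj; case: f => -[a b] ? ; congr (_, _); rewrite /= ?mul1r ?mulr1. Qed.
Fact runit_mulr1 : right_id runit_one runit_mul.
Proof. by move=> f; apply/val_inj; case: f => -[a b] ? ; congr (_, _); rewrite /= ?mul1r ?mulr1. Qed.
Fact runit_mulV : left_inverse runit_one runit_inv runit_mul.
Proof. by move=> f; apply/val_inj; have [f1 f2] := runitP f; congr (_, _). Qed.
Fact runit_mulVr : right_inverse runit_one runit_inv runit_mul.
Proof. by move=> f; apply/val_inj; have [f1 f2] := runitP f; congr (_, _). Qed.

HB.instance Definition _ := isGroup.Build runit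
  runit_mulA runit_mul1 runit_mulr1 runit_mulV runit_mulVr.

Lemma rvalM f g : rval (f * g)%g = rval f * rval g. Proof. by []. Qed.
Lemma rvalX f n : rval (f ^+ n)%g = rval f ^+ n.
Proof. by elim: n => // n IHn; rewrite expgS exprS rvalM IHn. Qed.
Lemma rval_inj : injective rval.
Proof.
move=> f g efg; apply/val_inj.
have [f1 f2] := runitP f; have [g1 g2] := runitP g.
rewrite /= [LHS]surjective_pairing [RHS]surjective_pairing; congr (_, _) => //.
by rewrite -[LHS]mulr1 -g1 -efg mulrA f2 mul1r.
Qed.

End RingUnits.

(** * Faithfulness through top coefficients *)

Section Representation.
Variables (A : nzRingType) (p0 : nat) (u : A).
Local Notation p := p0.+2.
Local Notation Mx := 'M[A]_p0.+2.
Local Notation Pi := (root_mx p0 u).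
Local Notation v := (colv p0 u).
Local Notation w := (roww p0 u).
Implicit Types (N : Mx) (h : A) (R : {poly Mx}) (s : seq (nat * A)).

Definition shear_mx : Mx := v *m w.
Local Notation E := shear_mx.

Lemma shear_mx2 N : E * N * E = v *m (w *m N *m v) *m w.
Proof. by rewrite -!mulmxE !mulmxA. Qed.

Lemma shear_sqr : E * E = 0.
Proof. by rewrite -[E in X in X * _]mulr1 shear_mx2 mulmx1 roww_colv mulmx0 mul0mx. Qed.

(** The two values are inverse to each other because E has square 0. Conjugation by them puts - E N
    E into degree 2, the top degree. *)
Definition shear (e : bool) : {poly Mx} := 1 + (if e then - E else E)%:P * 'X.

Lemma shearK : shear true * shear false = 1 /\ shear false * shear true = 1.
Proof.
have EX (a b : Mx) : a * b = 0 -> a%:P * 'X * (b%:P * 'X) = 0.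
  by move=> ab0; rewrite mulrA -[a%:P * 'X * _]mulrA -commr_polyX mulrA -polyCM ab0 !mul0r.
rewrite /shear !mulrDl !mulrDr !mulr1 !mul1r.
rewrite !EX ?mulrN ?mulNr ?shear_sqr ?oppr0 // !addr0 -!addrA -!mulrDl -!polyCD.
by rewrite addNr subrr mul0r addr0.
Qed.

Definition conj_poly N : {poly Mx} := shear true * N%:P * shear false.

Lemma conj_polyM N N' : conj_poly (N * N') = conj_poly N * conj_poly N'.
Proof.
rewrite /conj_poly -!mulrA [shear false * _]mulrA (proj2 shearK) mul1r polyCM.
by rewrite !mulrA.
Qed.

Lemma conj_polyX N j : conj_poly (N ^+ j) = conj_poly N ^+ j.
Proof.
elim: j => [|j IHj]; last by rewrite !exprS conj_polyM IHj.
by rewrite /conj_poly mulr1 (proj1 shearK).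
Qed.

Lemma shear_coef e : (size (shear e) <= 2)%N /\ (shear e)`_1 = if e then - E else E.
Proof.
split; last by rewrite coefD coef1 coefMX coefC add0r.
apply: leq_trans (size_polyD _ _) _; rewrite size_poly1 geq_max /=.
apply: leq_trans (size_polyMleq _ _) _; rewrite size_polyX addn2 /= ltnS.
exact: size_polyC_leq1.
Qed.

Lemma conj_poly_coef N :
  (size (conj_poly N) <= 3)%N /\ (conj_poly N)`_2 = - (E * N * E).
Proof.
have [s1 c1] := shear_coef true; have [s2 c2] := shear_coef false.
have [c3 s3] := coefM_top s1 (size_polyC_leq1 N).
have [c4 s4] := coefM_top s3 s2; split=> //.
by rewrite [LHS]c4 c3 c1 c2 coefC mulNr mulNr.
Qed.

Definition scal h : {poly Mx} := (h%:M)%:P.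

Lemma scalM h h' : scal (h * h') = scal h * scal h'.
Proof. by rewrite /scal scalar_mxM polyCM. Qed.
Lemma scal1 : scal 1 = 1. Proof. by []. Qed.

Definition root_poly := conj_poly Pi.

Lemma E_comm i j : GRing.comm u (E i j).
Proof.
have cv k l : GRing.comm u (v k l).
  rewrite mxE; case: ifP => _; first exact: commr_refl.
  by case: ifP => _; [apply: commr1 | apply: commr0].
have cw k l : GRing.comm u (w k l).
  by rewrite mxE; case: ifP => _; [apply/commrN/commr_refl | apply: commr1].
by rewrite mxE; apply: commr_sum => k _; apply: commrM.
Qed.

(** The entries of E commute with u, so the conjugation fixes the scalar matrix u, and the
    conjugated companion matrix is still a p-th root of u. *)
Lemma root_polyXp : root_poly ^+ p = scal u.
Proof.
rewrite -conj_polyX root_mxXp /conj_poly; have cu e : shear e * scal u = scal u * shear e.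
  rewrite /shear mulrDl mulrDr mul1r mulr1 -mulrA -[in LHS]commr_polyX !mulrA -!polyCM.
  congr (_ + _%:P * _); apply: scalar_mx_commute => i j.
  by case: e; [rewrite [(- E) i j]mxE; apply: commrN|]; apply: E_comm.
by rewrite cu -mulrA (proj1 shearK) mulr1.
Qed.

Hypothesis A_dom : forall x y : A, x != 0 -> y != 0 -> x * y != 0.
Hypothesis lam_neq0 : forall j, (0 < j < p)%N -> lam p0 u j != 0.

Definition alt_mul R (jh : nat * A) : {poly Mx} := R * root_poly ^+ jh.1 * scal jh.2.

(** The condition on a reduced product after its first syllable: an inner coefficient must not
    commute with u, for otherwise it could be moved across the root. The last one only has to be
    non-zero. *)
Fixpoint alternating h s : Prop :=
  if s is (j, h') :: s' then
    [/\ h * u != u * h, (0 < j < p)%N & alternating h' s']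
  else h != 0.

(** Entry 1 of C is tracked because [colv] equals 1 there. The trailing factor h is kept apart since
    the next syllable turns w h v into the commutator h u - u h. *)
Definition leading l h R : Prop := (size R <= l.+1)%N /\
  exists2 C : 'cV[A]_p, C (Ordinal (isT : 1 < p)%N) 0 != 0 & R`_l = C *m w *m h%:M.

Lemma alt_mul_coef l R j h : (size R <= l.+1)%N ->
  (size (alt_mul R (j, h)) <= l.+3)%N /\
  (alt_mul R (j, h))`_(l.+2) = - (R`_l *m v *m (lam p0 u j)%:M *m w *m h%:M).
Proof.
move=> szR; rewrite /alt_mul /= -conj_polyX.
have [sz1 c1] := conj_poly_coef (Pi ^+ j).
have [c2 sz2] := coefM_top szR sz1.
have [c3 sz3] := coefM_top sz2 (size_polyC_leq1 (h%:M : Mx)).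
have -> : l.+2 = (l + 2 + 0)%N by lia.
split=> //.
rewrite c3 c2 c1 coefC /= shear_mx2 mulrN mulNr; congr (- _).
rewrite -!mulmxE !mulmxA; congr (_ *m w *m _); rewrite -!mulmxA; congr (_ *m (_ *m _)).
by rewrite mulmxA; apply/matrixP => a b; rewrite !ord1 [RHS]mxE eqxx.
Qed.

Lemma leading_step l h R j h' : leading l h R -> h * u != u * h ->
  (0 < j < p)%N -> leading l.+2 h' (alt_mul R (j, h')).
Proof.
move=> [szR [C nzC RC]] ncomm lt_j; have [sz' c'] := alt_mul_coef j h' szR.
split=> //; exists (- (C *m (w *m h%:M *m v) *m (lam p0 u j)%:M)).
  rewrite mxE mulmx_scalarE mxE big_ord1 roww_scalar_colv oppr_eq0.
  by rewrite !A_dom ?lam_neq0 // subr_eq0.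
by rewrite c' RC !mulNmx !mulmxA.
Qed.

Lemma leading_start h j h' : h != 0 -> (0 < j < p)%N ->
  leading 2 h' (alt_mul (scal h) (j, h')).
Proof.
move=> nzh lt_j; have [sz' c'] := alt_mul_coef j h' (size_polyC_leq1 (h%:M : Mx)).
split=> //; exists (- (h%:M *m v *m (lam p0 u j)%:M)).
  rewrite mxE mulmx_scalarE scalar_mulmxE mxE /= mulr1 oppr_eq0.
  by rewrite A_dom ?lam_neq0.
by rewrite c' coefC !mulNmx.
Qed.

Lemma alternating_neq1 l h R s : (0 < l)%N -> leading l h R -> alternating h s ->
  foldl alt_mul R s != 1.
Proof.
elim: s l h R => [|[j h'] s IHs] l h R l_gt0 /=; last first.
  by move=> lR [ncomm lt_j] /IHs; apply; last exact: leading_step lR _ _.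
move=> [_ [C nzC RC]] nzh; apply/eqP => R1; move: RC; rewrite R1 coef1.
(* In position (1, 0) the coefficient of degree l is C_1 h, because [roww] begins with 1; for the
   constant 1 it would be 0. *)
rewrite eqn0Ngt l_gt0 => /matrixP/(_ (Ordinal (isT : 1 < p)%N) ord0)/esym/eqP.
rewrite mulmx_scalarE mxE big_ord1 [w _ _]mxE /= mulr1 mxE.
by apply/negP; rewrite A_dom.
Qed.

Lemma alternating_prod_neq1 h j h' s : h != 0 -> (0 < j < p)%N ->
  alternating h' s -> foldl alt_mul (scal h) ((j, h') :: s) != 1.
Proof.
by move=> nzh lt_j; apply: (@alternating_neq1 2) => //; apply: leading_start.
Qed.

End Representation.

Section Faithful.
Variables (d p0 : nat) (u : ncps rat d).
Local Notation p := p0.+2.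
Hypotheses (u1 : u [::] = 1) (nz_u : u != 1).

(** For j = 1 the value is u (1 - u) or (1 - u)(1 + u), according to whether p = 2; for j > 1 its
    constant term is 2. *)
Lemma lam_neq0 j : (0 < j < p)%N -> lam p0 u j != 0.
Proof.
move=> lt_j; rewrite lamE //; case: (j =P 1%N) => [->|/eqP nj].
  case: (2 =P p) => [_|_].
    rewrite (_ : _ + _ = u * (1 - u)).
      apply: ncps_mulf_neq0; last by rewrite subr_eq0 eq_sym.
      by apply: contra_eq_neq u1 => ->; rewrite ncps0 eq_sym oner_neq0.
    by rewrite mulrBr mulr1 mulNr addrC.
  rewrite (_ : _ + _ = (1 - u) * (1 + u)).
    apply: ncps_mulf_neq0; first by rewrite subr_eq0 eq_sym.
    apply/eqP => /(congr1 (fun f : ncps rat d => f [::])); rewrite ncpsD u1 ncps1.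
    by move=> /eqP.
  by rewrite mulrDr mulr1 mulrBl mul1r addrA subrK mulNr addrC.
apply/eqP => /(congr1 (fun f : ncps rat d => f [::])).
by rewrite ncpsD mul1r u1; case: ifP; rewrite ?u1 ?ncps1 => _ /eqP.
Qed.

End Faithful.

(** * The lattice filtration on matrix polynomials *)

Section PolyLattice.
Variables (d p0 n C : nat).
Local Notation p := p0.+2.
Local Notation A := (ncps rat d).
Local Notation Mx := 'M[A]_p0.+2.
Local Notation lat := (lattice p n C).

Definition poly_lattice k (R : {poly Mx}) : Prop := forall i a b, lat k (R`_i a b).

Lemma lattice_sum k (I : Type) (s : seq I) (F : I -> A) :
  (forall i, lat k (F i)) -> lat k (\sum_(i <- s) F i).
Proof.
move=> lF; elim/big_ind: _ => // [|x y lx ly]; first exact: lattice0.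
rewrite -[y]opprK; apply: latticeB => //; rewrite -sub0r.
by apply: latticeB => //; apply: lattice0.
Qed.

Lemma poly_lattice0 k : poly_lattice k 0.
Proof. by move=> i a b; rewrite coef0 mxE; apply: lattice0. Qed.
Lemma poly_latticeB k R R' :
  poly_lattice k R -> poly_lattice k R' -> poly_lattice k (R - R').
Proof. by move=> lR lR' i a b; rewrite coefB !mxE; apply: latticeB. Qed.
Lemma poly_latticeM k l R R' :
  poly_lattice k R -> poly_lattice l R' -> poly_lattice (k + l) (R * R').
Proof.
move=> lR lR' i a b; rewrite coefM summxE; apply: lattice_sum => j.
rewrite -mulmxE mxE; apply: lattice_sum => c.
exact: latticeM (lR _ _ _) (lR' _ _ _).
Qed.
Lemma poly_latticeW k l R : (k <= l)%N -> poly_lattice l R -> poly_lattice k R.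
Proof. by move=> lekl lR i a b; apply: latticeW (lR i a b). Qed.
Lemma mulmxnE (M : Mx) k a b : (M *+ k) a b = M a b *+ k.
Proof. by elim: k => [|k IHk]; rewrite ?mxE // !mulrS mxE IHk. Qed.
Lemma poly_lattice_p k R : poly_lattice k R -> poly_lattice k.+1 (R *+ p).
Proof. by move=> lR i a b; rewrite coefMn mulmxnE; apply: lattice_p. Qed.
Lemma poly_latticeC k (M : Mx) : (forall a b, lat k (M a b)) -> poly_lattice k M%:P.
Proof.
move=> lM i a b; rewrite coefC; case: ifP => // _.
by rewrite mxE; apply: lattice0.
Qed.
Lemma poly_lattice_scal k h : lat k h -> poly_lattice k (scal p0 h).
Proof.
move=> lh; apply: poly_latticeC => a b; rewrite mxE.
by case: (_ == _); rewrite ?mulr1n ?mulr0n //; apply: lattice0.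
Qed.
Lemma poly_lattice1 : poly_lattice 0 1.
Proof. by rewrite -scal1; apply/poly_lattice_scal/lattice1. Qed.
Lemma poly_latticeX : poly_lattice 0 'X.
Proof.
move=> i a b; rewrite coefX; case: (_ == _); rewrite mxE.
  by case: (_ == _); rewrite ?mulr1n ?mulr0n; [apply: lattice1|apply: lattice0].
exact: lattice0.
Qed.

Lemma poly_lattice_root u : lat 0 u -> poly_lattice 0 (root_poly p0 u).
Proof.
move=> lu; have M0 R R' : poly_lattice 0 R -> poly_lattice 0 R' -> poly_lattice 0 (R * R').
  exact: poly_latticeM.
have l1 : lat 0 (1 : A) by apply: lattice1.
have l0 : lat 0 (0 : A) by apply: lattice0.
have lN (f : A) : lat 0 f -> lat 0 (- f) by move=> lf; rewrite -sub0r; apply: latticeB.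
have LM0 (f g : A) : lat 0 f -> lat 0 g -> lat 0 (f * g) by exact: latticeM.
have lE a b : lat 0 (shear_mx p0 u a b).
  rewrite mxE; apply: lattice_sum => c; apply: LM0; rewrite mxE.
    by case: ifP => // _; case: ifP.
  by case: ifP => // _; apply: lN.
have lS e : poly_lattice 0 (shear p0 u e).
  rewrite -[shear _ _ _]opprK -sub0r; apply: poly_latticeB; first exact: poly_lattice0.
  rewrite opprD addrC; apply: poly_latticeB; last exact: poly_lattice1.
  rewrite -mulNr -polyCN; apply: (M0 _ _); last exact: poly_latticeX.
  apply: poly_latticeC => a b; case: e; first by rewrite opprK; apply: lE.
  have -> : (- shear_mx p0 u) a b = - shear_mx p0 u a b by rewrite [LHS]mxE.
  exact/lN/lE.
apply: (M0 _ _) => //; apply: (M0 _ _) => //; apply: poly_latticeC => a b.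
by rewrite mxE; do 2?case: ifP.
Qed.

(** After scaling by a power of C the coefficient is an integer; as the factors Q are prime to p,
    every power of p divides it. *)
Lemma poly_lattice_inf (R : {poly Mx}) i a b w : prime p -> (0 < C)%N -> (size w <= n)%N ->
  poly_lattice 0 R ->
  (forall N, exists2 Q : int, ~~ (p %| Q)%Z & poly_lattice N (R *~ Q)) ->
  R`_i a b w = 0.
Proof.
move=> pr_p C_gt0 lew /(_ i a b w lew)[c]; rewrite sub0n expn0 mul1r => Ec lR.
have nzC : C%:R ^+ size w != 0 :> rat by rewrite expf_neq0 // pnatr_eq0 -lt0n.
suff c0 : c = 0.
  by move/eqP: Ec; rewrite c0 mulf_eq0 (negPf nzC) => /eqP.
apply/eqP; rewrite -absz_eq0; apply/negPn/negP; rewrite -lt0n => c_gt0.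
have pdvd N : (p ^ N %| `|c|)%N.
  (* The extra depth [size w] compensates for the subtraction in [lattice]. *)
  have [Q pQ /(_ i a b w lew)[e]] := lR (N + size w)%N; rewrite addnK.
  have -> : (R *~ Q)`_i a b w = R`_i a b w *~ Q.
    have E k : (R *+ k)`_i a b w = R`_i a b w *+ k.
      by rewrite coefMn mulmxnE ncpsMn.
    case: (Q) => k; rewrite ?NegzE ?mulrNz ?coefN ?mxE ?ncpsN; [|congr (- _)]; exact: E.
  rewrite -mulrzl mulrCA Ec [(p ^ N)%:R]pmulrn -!intrM => /intr_inj E.
  have: (p ^ N %| `|(Q * c)%R|)%N by rewrite E abszM dvdn_mulr.
  by rewrite abszM Gauss_dvdr // coprimeXl // prime_coprime.
by have := dvdn_leq c_gt0 (pdvd `|c|%N); rewrite leqNgt ltn_expl.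
Qed.

End PolyLattice.

(** * Logarithmic derivatives *)

Lemma ncpsM_1 (K : numFieldType) d (f g : ncps K d) j :
  (f * g) [:: j] = f [::] * g [:: j] + f [:: j] * g [::].
Proof. by []. Qed.

Section Dlog.
Variables (K : numFieldType) (d : nat).
Local Notation A := (ncps K d).
Implicit Types (f g h : A) (w : seq 'I_d).

Definition euler f : A := fun w => f w *+ size w.

Lemma eulerM f g : euler (f * g) = euler f * g + f * euler g.
Proof.
apply/funext => w; rewrite ncpsD -[LHS]/((f * g) w *+ size w) !ncpsM -sumrMnl -big_split.
apply: eq_bigr => i _ /=; rewrite /euler mulrnAr mulrnAl -mulrnDr.
by congr (_ *+ _); rewrite -size_cat cat_take_drop.
Qed.

Lemma nseq_mul_sym a r f g : (f * g) (nseq r a) = (g * f) (nseq r a).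
Proof.
rewrite !ncpsM size_nseq (reindex_inj rev_ord_inj) /=; apply: eq_bigr => i _.
have lei : (i <= r)%N by rewrite -ltnS.
have tk k : (k <= r)%N -> take k (nseq r a) = nseq k a.
  by move=> lek; rewrite -{1}(subnKC lek) nseqD take_size_cat ?size_nseq.
have dk k : (k <= r)%N -> drop k (nseq r a) = nseq (r - k) a.
  by move=> lek; rewrite -{1}(subnKC lek) nseqD drop_size_cat ?size_nseq.
by rewrite subSS !tk ?dk ?leq_subr // subKn // mulrC.
Qed.

Definition dlog a r (f : munit K d) : K :=
  (mval f^-1%g * euler (mval f)) (nseq r a).

Lemma dlogM a r (f g : munit K d) : dlog a r (f * g)%g = dlog a r f + dlog a r g.
Proof.
rewrite /dlog mvalM eulerM invgM mvalM mulrDr ncpsD -!mulrA.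
rewrite nseq_mul_sym -!mulrA mvalV mulr1; congr (_ + _).
by rewrite [mval f^-1%g * _]mulrA mvalVl mul1r.
Qed.

Lemma dlog_low a r (f : munit K d) : (0 < r)%N -> small r (mval f - 1) ->
  dlog a r f = mval f (nseq r a) *+ r.
Proof.
move=> r_gt0 sf; rewrite /dlog ncpsM size_nseq big_ord_recl big1 ?addr0.
  by rewrite take0 drop0 munitP mul1r /euler size_nseq.
move=> i _; rewrite [euler _ _]/euler.
have szd : (size (drop (lift ord0 i) (nseq r a)) < r)%N.
  by rewrite size_drop size_nseq /= /bump /=; have := ltn_ord i; lia.
have [/size0nil -> | nz] := posnP (size (drop (lift ord0 i) (nseq r a))).
  by rewrite mulr0.
have := sf _ szd; rewrite ncpsB ncps1 -size_eq0 (gtn_eqF nz) subr0 => ->.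
by rewrite mul0rn mulr0.
Qed.

Lemma low_mul_r n (f u : A) v a : size v = n -> small n f -> small 1 u ->
  (f * u) (rcons v a) = f v * u [:: a].
Proof.
move=> <- sf su; rewrite ncpsM size_rcons -cats1 big_ord_recr big_ord_recr /=.
rewrite big1 ?add0r; last first.
  by move=> j _; rewrite sf ?mul0r // size_take_min gtn_min ltn_ord.
rewrite take_size_cat // drop_size_cat // [drop _.+1 _]drop_oversize ?size_cat ?addn1 //.
by rewrite (su [::] isT) mulr0 addr0.
Qed.

Lemma low_mul_l n (f u : A) v a : size v = n -> small n f -> small 1 u ->
  (u * f) (a :: v) = u [:: a] * f v.
Proof.
move=> <- sf su; rewrite ncpsM_cons (su [::] isT) mul0r add0r ncpsM big_ord_recl /=.
rewrite take0 drop0 big1 ?addr0 // => j _; rewrite [f _]sf ?mulr0 //.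
by rewrite size_drop /= /bump /=; have := ltn_ord j; lia.
Qed.

(** Comparing coefficients at b v a in f u = u f gives f(b v) u_a = u_b f(v a) in lowest degree. So
    a first letter b can be traded for a final a without losing non-vanishing, until only letters a
    remain. *)
Lemma commute_low (f u : A) a w : small 1 u -> u [:: a] != 0 -> small (size w) f ->
  f * u = u * f -> f w != 0 -> f (nseq (size w) a) != 0.
Proof.
move=> su nzu sf cfu nzw.
suff S i : (i <= size w)%N -> f (drop i w ++ nseq i a) != 0.
  by have := S _ (leqnn _); rewrite drop_size.
elim: i => [|i IHi] lti; first by rewrite drop0 cats0.
have := IHi (ltnW lti); rewrite (drop_nth a lti); set b := nth _ _ _.
set v := drop i.+1 w ++ nseq i a => nzv.
have szv : (size v).+1 = size w by rewrite size_cat size_drop size_nseq; lia.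
have -> : drop i.+1 w ++ nseq i.+1 a = rcons v a.
  by rewrite -cats1 -catA -[[:: a]]/(nseq 1 a) -nseqD addn1.
have := congr1 (fun g : A => g (b :: rcons v a)) cfu.
rewrite (low_mul_l _ _ sf su) ?size_rcons // -rcons_cons (low_mul_r _ _ sf su) // => E.
by apply: contraNneq (mulf_neq0 nzv nzu) => E0; rewrite E E0 mulr0.
Qed.

End Dlog.

(** * Adjoining a root *)

Definition tower_gens (G : groupType) (n : nat) (xs : nat -> G) (y : G) (t : nat) : G :=
  if (t < n)%N then xs t else y.

Lemma tower_gens_last (G : groupType) n (xs : nat -> G) y :
  gen_by (tower_gens n xs y) n.+1 y.
Proof. by apply: gen_in; exists n; rewrite // /tower_gens ltnn. Qed.

Lemma tower_gens_lt (G : groupType) n (xs : nat -> G) y t : (t < n)%N ->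
  gen_by (tower_gens n xs y) n.+1 (xs t).
Proof. by move=> lt_t; apply: gen_in; exists t; rewrite ?leqW // /tower_gens lt_t. Qed.

Lemma gen_by_tower (G : groupType) n (xs : nat -> G) y (Q : G -> Prop) g :
  (forall t, (t < n)%N -> gen_subgroup Q (xs t)) -> gen_subgroup Q y ->
  gen_by (tower_gens n xs y) n.+1 g -> gen_subgroup Q g.
Proof.
move=> Qx Qy; elim=> [h [i lt_i ->]||? ? _ ? _ ?|? _ ?].
- by rewrite /tower_gens; case: ifP => // /Qx.
- exact: gen_1.
- exact: gen_M.
exact: gen_V.
Qed.

Lemma ncpsM_2 (K : numFieldType) d (f g : ncps K d) i j :
  (f * g) [:: i; j] =
  f [::] * g [:: i; j] + (f [:: i] * g [:: j] + f [:: i; j] * g [::]).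
Proof. by []. Qed.

Section Step.
Variables (Gr : groupType) (d p0 n0 : nat).
Local Notation p := p0.+2.
Local Notation A := (ncps rat d).
Local Notation Mx := 'M[A]_p0.+2.
Local Notation G0 := (Gr * munit rat d)%type.
Local Notation G1 := (G0 * runit {poly Mx})%type.
Variables (xs : nat -> G0) (y : G0).
Implicit Types (g h : G0) (j : 'I_d).

Fact scal_subproof (f : munit rat d) :
  (scal p0 (mval f) * scal p0 (mval f^-1%g) == 1)
  && (scal p0 (mval f^-1%g) * scal p0 (mval f) == 1).
Proof. by rewrite -!scalM mvalV mvalVl eqxx. Qed.
Definition scal_unit (f : munit rat d) : runit {poly Mx} :=
  @RUnit _ (_, _) (scal_subproof f).

Lemma scal_unitM : {morph scal_unit : f g / (f * g)%g}.
Proof. by move=> f g; apply: rval_inj; rewrite rvalM /= -scalM. Qed.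

Definition lift_scal g : G1 := (g, scal_unit g.2).

Lemma lift_scalM : {morph lift_scal : f g / (f * g)%g}.
Proof. by move=> f g; congr (_, _); rewrite -scal_unitM. Qed.

Definition lin_coef g j : rat := mval g.2 [:: j].

Lemma lin_coefM g h j : lin_coef (g * h)%g j = lin_coef g j + lin_coef h j.
Proof.
rewrite -[LHS]/((mval g.2 * mval h.2) [:: j]) ncpsM_1 !munitP mul1r mulr1.
exact: addrC.
Qed.

Local Notation z := (y ^+ p)%g.
Local Notation u := (mval (y ^+ p)%g.2).
Local Notation H := (gen_by (tower_gens n0 xs z) n0.+1).

Definition root_inv : {poly Mx} := root_poly p0 u ^+ p.-1 * scal p0 (mval (z^-1)%g.2).

Fact root_subproof :
  (root_poly p0 u * root_inv == 1) && (root_inv * root_poly p0 u == 1).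
Proof.
set Y := root_poly p0 u; set V := scal p0 (mval (z^-1)%g.2).
have Yp : Y ^+ p = scal p0 u := root_polyXp p0 u.
have uV : scal p0 u * V = 1 by rewrite -scalM mvalV.
have Vu : V * scal p0 u = 1 by rewrite -scalM mvalVl.
have cV : V * Y = Y * V.
  rewrite -[V * Y]mulr1 -uV -Yp [V * Y * _]mulrA -[V * Y * _]mulrA -exprS exprSr.
  by rewrite [V * _]mulrA Yp Vu mul1r.
by rewrite /root_inv -/Y -/V mulrA -exprS Yp uV -mulrA cV mulrA -exprSr Yp uV eqxx.
Qed.
Definition root_unit : runit {poly Mx} := @RUnit _ (_, _) root_subproof.
Definition yt : G1 := (y, root_unit).

Lemma yt_p : (yt ^+ p)%g = lift_scal z.
Proof.
have E k : (yt ^+ k)%g = ((y ^+ k)%g, (root_unit ^+ k)%g).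
  by elim: k => // k IHk; rewrite !expgS IHk.
rewrite E; congr (_, _); apply: rval_inj; rewrite rvalX.
exact: root_polyXp.
Qed.

Local Notation gt := (tower_gens n0 (fun t => lift_scal (xs t)) yt).
Local Notation Bt := (gen_by gt n0.+1).

Hypothesis pr_p : prime p.
Variables (Q0 : int) (ys : 'I_d -> G1).
Hypotheses (pQ0 : ~~ (p %| Q0)%Z) (Bys : forall j, Bt (ys j)).
Hypothesis basis : forall b, Bt b -> exists c : 'I_d -> int,
  forall (M : zmodType) (S : M -> Prop) (chi : G1 -> M),
    character Bt S chi -> S (chi b *~ Q0 - \sum_j chi (ys j) *~ c j).
Hypothesis vars : forall i : 'I_d, exists2 t, (t < n0)%N &
  forall j, lin_coef (xs t) j = (i == j)%:R.
Hypothesis prim : forall v (b : int), H v ->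
  (forall j, lin_coef z j = lin_coef v j *~ b) -> b = 1 \/ b = -1.
Hypothesis injH : forall h, H h -> h.2 = 1%g -> h = 1%g.

Lemma lin_coef_char j : character Bt (fun q : rat => q = 0) (fun b : G1 => lin_coef b.1 j).
Proof.
split=> // [q q' -> ->|b b' _ _]; first exact: subrr.
by rewrite lin_coefM addrAC addrK subrr.
Qed.

(** Some of the xs have the unit vectors as linear parts; up to the factor Q0 these are integer
    combinations of the linear parts of the ys. *)
Lemma ys_unit : (\matrix_(i, j) lin_coef (ys i).1 j) \in unitmx.
Proof.
have /choice[C CP] (i : 'I_d) : exists c : 'I_d -> int, forall j,
    (i == j)%:R *~ Q0 = \sum_l lin_coef (ys l).1 j *~ c l.
  have [t lt_t Et] := vars i; have [c cP] := basis (tower_gens_lt _ _ lt_t).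
  exists c => j; rewrite -Et; apply/eqP; rewrite -subr_eq0; apply/eqP.
  exact: (cP _ _ _ (lin_coef_char j)).
pose Cm := \matrix_(i, l) (C i l)%:~R : 'M[rat]_d.
have E : Cm *m (\matrix_(i, j) lin_coef (ys i).1 j) = (Q0%:~R)%:M.
  apply/matrixP => i j; rewrite !mxE -mulr_natr mulrzl CP.
  by apply: eq_bigr => l _; rewrite !mxE mulrzl.
have nzQ : Q0 != 0 by apply: contraNneq pQ0 => ->; rewrite dvdz0.
have : Cm *m (\matrix_(i, j) lin_coef (ys i).1 j) \in unitmx.
  by rewrite E -scalemx1 unitmxZ ?unitmx1 // unitfE intr_eq0.
by rewrite unitmx_mul => /andP[].
Qed.

(** A rational character is determined by its d values on the ys, and by [ys_unit] the d linear
    coefficients already span all such vectors of values. *)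
Lemma char_lin_coef b (chi : G1 -> rat) : Bt b ->
  character Bt (fun q : rat => q = 0) chi -> (forall j, lin_coef b.1 j = 0) -> chi b = 0.
Proof.
move=> Bb chiP b0; have [c cP] := basis Bb.
have c0 : (\row_l (c l)%:~R : 'rV[rat]_d) = 0.
  suff E : \row_l (c l)%:~R *m (\matrix_(i, j) lin_coef (ys i).1 j) = 0.
    by rewrite -[LHS](mulmxK ys_unit) E mul0mx.
  apply/rowP => j; rewrite !mxE; under eq_bigr do rewrite !mxE mulrzl.
  by have := cP _ _ _ (lin_coef_char j); rewrite b0 mul0rz sub0r => /eqP; rewrite oppr_eq0 => /eqP.
have := cP _ _ _ chiP; rewrite big1 ?subr0 => [/eqP|l _]; last first.
  move/rowP: c0 => /(_ l); rewrite !mxE => /eqP; rewrite intr_eq0 => /eqP->.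
  exact: mulr0z.
rewrite -mulrzl mulf_eq0 intr_eq0 => /orP[/eqP Q00|/eqP//].
by case/negP: pQ0; rewrite Q00 dvdz0.
Qed.

Lemma lift_H h : H h -> Bt (lift_scal h).
Proof.
apply: gen_morph lift_scalM _ => g [t]; rewrite ltnS leq_eqVlt /tower_gens.
case/predU1P=> [-> ->|lt_t ->]; last by rewrite lt_t; apply: tower_gens_lt.
by rewrite ltnn -yt_p; apply: (gen_expgz p%:Z); apply: tower_gens_last.
Qed.

Lemma H_z : H z. Proof. exact: tower_gens_last. Qed.

Lemma z_lin : exists j, lin_coef z j != 0.
Proof.
apply: contrapT => no_j.
have := @prim 1%g 0 (gen_1 _); case=> // j; rewrite mulr0z; apply/eqP.
by apply/negPn/negP => nzj; apply: no_j; exists j.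
Qed.

Lemma u_nil : u [::] = 1. Proof. exact: munitP. Qed.
Lemma small_u1 : small 1 (u - 1). Proof. by apply/small1; rewrite ncpsB u_nil subrr. Qed.

(** Otherwise [commute_low] yields a non-zero coefficient of h at a^n in its lowest degree n. Then
    [dlog] is a rational character not vanishing at h, against [char_lin_coef]. *)
Lemma centralizer_trivial h : H h -> commute h.2 z.2 ->
  (forall j, lin_coef h j = 0) -> h = 1%g.
Proof.
move=> Hh chz h0; apply: injH => //; apply/val_inj/eqP; rewrite -[_ == _]subr_eq0.
apply/negPn/negP => /ncps_low[w nzw sw]; set f := mval h.2 - 1 in nzw sw.
have [a nza] := z_lin.
have cfu : f * (u - 1) = (u - 1) * f.
  have chu : GRing.comm u (mval h.2) by rewrite /GRing.comm -!mvalM chz.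
  apply: commrB; last exact: commr1.
  by apply/commr_sym/commrB; [exact: chu | exact: commr1].
have nzua : (u - 1) [:: a] != 0 by rewrite ncpsB ncps1 subr0.
have := commute_low small_u1 nzua sw cfu nzw.
have [sz0|sz_gt0] := posnP (size w).
  by rewrite sz0 /f ncpsB ncps1 munitP subrr eqxx.
have szw : size w != 0%N by rewrite -lt0n.
rewrite /f ncpsB ncps1 -size_eq0 size_nseq (negPf szw) subr0 => /negP[].
have := dlog_low a sz_gt0 sw; move/esym/eqP.
suff -> : dlog a (size w) h.2 = 0 by rewrite mulrn_eq0 (negPf szw).
apply: (@char_lin_coef (lift_scal h) (fun b : G1 => dlog a (size w) b.1.2)) => //.
  exact: lift_H.
split=> // [q q' -> ->|b b' _ _]; first exact: subrr.
by rewrite dlogM addrAC addrK subrr.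
Qed.

Lemma lin_coef_expgz g (i : int) j : lin_coef (expgz g i) j = lin_coef g j *~ i.
Proof.
have E k : lin_coef (g ^+ k)%g j = lin_coef g j *+ k.
  elim: k => [|k IHk]; first by rewrite /lin_coef /= ncps1.
  by rewrite expgS lin_coefM IHk mulrS.
case: i => k; first exact: E.
apply/eqP; rewrite NegzE mulrNz -addr_eq0 -[_ *~ k.+1]/(lin_coef g j *+ k.+1) -E.
by rewrite -lin_coefM mulVg /lin_coef /= ncps1.
Qed.

(** In degree 2, commutation forces the linear parts of h and z to be proportional, with some ratio
    al / be in lowest terms. Then h^be = z^al by [centralizer_trivial], Bezout produces v with v^be
    = z, and primitivity of z leaves be = 1. *)
Lemma centralizer_cyclic h : H h -> mval h.2 * u = u * mval h.2 ->
  exists e : int, h = expgz z e.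
Proof.
move=> Hh cu; have chz : commute h z.
  apply/commgP/eqP; apply: injH.
    have HV : H (h^-1)%g by apply: gen_V.
    have HzV : H (z^-1)%g by apply/gen_V/H_z.
    by rewrite commgEl conjgE; apply: (gen_M HV (gen_M HzV (gen_M Hh H_z))).
  by apply/eqP/commgP/val_inj.
have [a nza] := z_lin.
pose q := lin_coef h a / lin_coef z a.
have Eh j : lin_coef h j = q * lin_coef z j.
  have := congr1 (fun f : A => f [:: a; j]) cu; rewrite !ncpsM_2 !munitP !mul1r !mulr1.
  move=> E; have {}E : mval h.2 [:: a] * u [:: j] = u [:: a] * mval h.2 [:: j].
    by move: (_ * _) (_ * _) E => s t; lra.
  by apply: (mulIf nza); rewrite /q mulrAC divfK // mulrC -E.
pose al := numq q; pose be := denq q.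
have E j : lin_coef h j *~ be = lin_coef z j *~ al.
  rewrite -[RHS]mulrzl -[LHS]mulrzl Eh mulrA; congr (_ * _).
  by rewrite /al numqE mulrC.
have cX i k : commute (expgz h i) (expgz z k).
  by apply: commute_expgz; apply/commute_sym/commute_expgz/commute_sym.
have hz : expgz h be = expgz z al.
  apply/divg1_eq; rewrite -expgzN; apply: centralizer_trivial.
  - by apply: (gen_M (gen_expgz _ _) (gen_expgz _ H_z)).
  - have: commute (expgz h be * expgz z (- al))%g z.
      apply/commute_sym/commuteM; apply: commute_expgz; first exact/commute_sym.
      exact: commute_refl.
    by move=> /(congr1 snd).
  by move=> j; rewrite lin_coefM !lin_coef_expgz E mulrNz subrr.
have [s [t st]] : exists s t : int, s * al + t * be = 1.
  have := Bezoutz al be; rewrite (_ : gcdz al be = 1) => [[s [t st]]|].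
    by exists s, t.
  by apply/eqP; rewrite -[_ == _]/(coprimez _ _) coprimezE coprime_num_den.
pose v := (expgz h s * expgz z t)%g.
have Ev : expgz v be = z.
  rewrite /v expgzMn // -!expgzM [(s * be)%R]mulrC [expgz h _]expgzM hz -expgzM -expgzD.
  by rewrite [al * s]mulrC st.
have Hv : H v by apply: (gen_M (gen_expgz _ _) (gen_expgz _ H_z)).
have [] := prim Hv (b := be).
- by move=> j; rewrite -lin_coef_expgz Ev.
- by move=> be1; exists al; move: hz; rewrite be1.
by move=> beN1; have := denq_gt0 q; rewrite -/be beN1.
Qed.

Lemma u_neq1 : u != 1.
Proof.
have [a] := z_lin; apply: contraNneq => u1.
by rewrite /lin_coef u1 ncps1.
Qed.

(* The element yt^j1 h1 yt^j2 h2 ... of the formal root extension. *)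
Fixpoint syllables (s : seq (nat * G0)) : G1 :=
  if s is (j, h) :: s' then (yt ^+ j * lift_scal h * syllables s')%g else 1%g.

Definition syllables_in (s : seq (nat * G0)) : Prop :=
  forall jh, jh \in s -> (jh.1 < p)%N /\ H jh.2.

Lemma syllables_cat s s' :
  syllables (s ++ s') = (syllables s * syllables s')%g.
Proof. by elim: s => [|[j h] s IHs] /=; rewrite ?mul1g // IHs !mulgA. Qed.

Lemma syllables_ex b : Bt b -> exists h s,
  [/\ H h, syllables_in s & b = (lift_scal h * syllables s)%g].
Proof.
pose rep b := exists h s, [/\ H h, syllables_in s & b = (lift_scal h * syllables s)%g].
have repM b1 b2 : rep b1 -> rep b2 -> rep (b1 * b2)%g.
  move=> [h [s [Hh Hs ->]]] [h' [s' [Hh' Hs' ->]]]; exists h, (s ++ (0, h') :: s').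
  split=> // [jh|]; last by rewrite syllables_cat /= mul1g !mulgA.
  by rewrite mem_cat inE => /or3P[/Hs|/eqP->|/Hs'].
have rep_lift h : H h -> rep (lift_scal h) by exists h, [::]; rewrite mulg1.
have rep_y k : (k < p)%N -> rep (yt ^+ k)%g.
  move=> ltk; exists 1%g, [:: (k, 1%g)]; split; first exact: gen_1.
    by move=> jh; rewrite inE => /eqP->; split=> //; apply: gen_1.
  by rewrite /= (morph1 lift_scalM) mul1g !mulg1.
suff: forall b, Bt b -> rep b /\ rep (b^-1)%g by move=> R /R[].
move=> {}b; elim=> {b} [b [t lt_t ->]| |b1 b2 _ [rg rgV] _ [rh rhV]|b1 _ [rg rgV]].
- rewrite /tower_gens; case: ifP => [lt_t0|_].
    rewrite -(morphV lift_scalM); have Hx := tower_gens_lt xs z lt_t0.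
    by split; apply: rep_lift => //; apply: gen_V.
  split; first by rewrite -[yt]expg1; apply: rep_y.
  have -> : (yt^-1 = yt ^+ p.-1 * lift_scal z^-1)%g.
    by apply: (mulgI yt); rewrite mulgV mulgA -expgS yt_p -lift_scalM mulgV (morph1 lift_scalM).
  by apply: repM; [apply: rep_y | apply/rep_lift/gen_V/H_z].
- by rewrite invg1 -(morph1 lift_scalM); split; apply/rep_lift/gen_1.
- by rewrite invgM; split; apply: repM.
by rewrite invgK.
Qed.

(** The normal form of the amalgam. An inner coefficient commuting with u is a power of z, so it
    passes through yt and the neighbouring powers of yt merge; yt^p goes back into H as z. *)
Lemma syllables_reduce s h : H h -> syllables_in s -> exists h' s',
  [/\ H h', syllables_in s', lift_scal h * syllables s = lift_scal h' * syllables s'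
    & if s' is (j, h1) :: s1 then (0 < j < p)%N /\
        alternating p0 u (mval h1.2) [seq (jh.1, mval jh.2.2) | jh <- s1]
      else True]%g.
Proof.
have nz_h (h1 : G0) : mval h1.2 != 0.
  by apply: contra_eq_neq (munitP h1.2) => ->; rewrite ncps0 eq_sym oner_neq0.
have HX e : H (expgz z e) by apply/gen_expgz/H_z.
elim: s h => [|[j h1] s IHs] h Hh Hs; first by exists h, [::].
have [ltj Hh1] : (j < p)%N /\ H h1 by apply: Hs (mem_head _ _).
have Hs1 : syllables_in s by move=> jh js; apply: Hs; rewrite inE js orbT.
have {IHs} [h2 [s' [Hh2 Hs' E red]]] := IHs h1 Hh1 Hs1.
rewrite /= -[(_ * lift_scal h1 * _)%g]mulgA E.
have [->|j_gt0] := posnP j.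
  exists (h * h2)%g, s'; split=> //; first exact: gen_M.
  by rewrite mul1g mulgA -lift_scalM.
have in_cons k h4 s2 : (k < p)%N -> H h4 -> syllables_in s2 ->
    syllables_in ((k, h4) :: s2).
  by move=> ltk Hh4 Hs2 jh; rewrite inE => /predU1P[->|/Hs2].
case: s' Hs' E red => [|[j1 h3] s1] Hs' E red.
  exists h, [:: (j, h2)]; split=> //; [exact: in_cons | by rewrite /= !mulgA |].
  by rewrite j_gt0 ltj; split=> //=; apply: nz_h.
have [cu|ncu] := eqVneq (mval h2.2 * u) (u * mval h2.2); last first.
  exists h, [:: (j, h2), (j1, h3) & s1]; split=> //=; [exact: in_cons | by rewrite !mulgA |].
  by rewrite j_gt0 ltj; case: red.
have [e Ee] := centralizer_cyclic Hh2 cu; case: red => /andP[j1_gt0 ltj1] alt.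
have Hh3 : H h3 by have [] := Hs' _ (mem_head _ _).
have Hs2 : syllables_in s1 by move=> jh js; apply: Hs'; rewrite inE js orbT.
have cy k : commute (yt ^+ k)%g (lift_scal (expgz z e)).
  rewrite (morph_expgz lift_scalM) -yt_p; apply/commute_expgz/commuteX2.
  exact: commute_refl.
have {E} -> : (yt ^+ j * (lift_scal h2 * syllables ((j1, h3) :: s1)) =
    lift_scal (expgz z e) * (yt ^+ (j + j1) * lift_scal h3 * syllables s1))%g.
  by rewrite Ee /= !mulgA cy expgnDr !mulgA.
rewrite mulgA -lift_scalM.
have [lt_jj|le_p] := ltnP (j + j1) p.
  exists (h * expgz z e)%g, (((j + j1)%N, h3) :: s1); split=> //.
    exact: (gen_M Hh (HX e)).
    exact: in_cons.
  by rewrite lt_jj addn_gt0 j_gt0.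
have Ejj : (j + j1 = p + (j + j1 - p))%N by rewrite subnKC.
have lt_k : (j + j1 - p < p)%N by lia.
rewrite Ejj expgnDr yt_p.
have [k0|k_gt0] := posnP (j + j1 - p)%N.
  exists (h * expgz z e * z * h3)%g, s1; split.
  - exact: (gen_M (gen_M (gen_M Hh (HX e)) H_z) Hh3).
  - exact: Hs2.
  - rewrite k0 expg0 mulg1 (lift_scalM (h * expgz z e * z)%g) (lift_scalM (h * expgz z e)%g z).
    by rewrite !mulgA.
  by clear Hs' Hs2; case: s1 alt => [|[j2 h4] s2] //= [].
exists (h * expgz z e * z)%g, (((j + j1 - p)%N, h3) :: s1); split.
- exact: (gen_M (gen_M Hh (HX e)) H_z).
- exact: in_cons.
- by rewrite /= (lift_scalM (h * expgz z e)%g z) !mulgA.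
by rewrite k_gt0 lt_k.
Qed.

Definition pair_rep (b : G1) : (A * {poly Mx})%type := (mval b.1.2, rval b.2).

Lemma aug_pair_rep (n C : nat) N x : (0 < C)%N ->
  (forall t, (t < n0)%N -> lattice p n C 0 (mval (xs t).2) /\
                          lattice p n C 0 (mval ((xs t).2)^-1%g)) ->
  lattice p n C 0 u -> lattice p n C 0 (mval (z^-1)%g.2) ->
  aug (fun g : G1 => exists2 i, (i < n0.+1)%N & g = gt i) pair_rep N x ->
  poly_lattice n C (N %/ p)%N x.2.
Proof.
move=> C_gt0 lx lu luV; apply: (@aug_theta _ _ _ _ _ _ _ (root_poly p0 u)) => //.
- exact: poly_lattice0.
- exact: poly_latticeB.
- exact: poly_latticeM.
- exact: poly_latticeW.
- exact: poly_lattice_p.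
- exact: poly_lattice1.
- exact: poly_lattice_root.
- rewrite root_polyXp (_ : _ - 1 = scal p0 (u - 1)).
    apply/poly_lattice_scal/lattice_aug; last by rewrite ncpsB u_nil subrr.
    by apply: latticeB => //; apply: lattice1.
  by rewrite /scal raddfB /= polyCB.
move=> g [t lt_t ->]; rewrite /tower_gens; case: ifP => [lt_t0|_].
  have [l1 l2] := lx t lt_t0; split; [exact: poly_lattice_scal|exact: poly_lattice_scal|].
  exists 0; rewrite expr0 (_ : _ - 1 = scal p0 (mval (xs t).2 - 1)).
    apply/poly_lattice_scal/lattice_aug; last by rewrite ncpsB munitP subrr.
    by apply: latticeB => //; apply: lattice1.
  by rewrite /scal raddfB /= polyCB.
have lY : poly_lattice n C 0 (root_poly p0 u) by apply: poly_lattice_root.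
split=> //=; last by exists 1; rewrite expr1 subrr; apply: poly_lattice0.
have MM R R' : poly_lattice n C 0 R -> poly_lattice n C 0 R' ->
    poly_lattice n C 0 (R * R') by exact: poly_latticeM.
apply: (MM _ _); last exact: poly_lattice_scal.
by elim: p.-1 => [|k IHk]; [apply: poly_lattice1 | rewrite exprS; apply: (MM _ _)].
Qed.

(** By [kernel_in_aug] such a b is arbitrarily deep in the augmentation powers, up to factors prime
    to p. By [aug_pair_rep] its matrix minus 1 is then arbitrarily deep in the lattice
    filtration. *)
Lemma kernel_rep b : Bt b -> b.1.2 = 1%g -> rval b.2 = 1.
Proof.
move=> Bb b1; pose P (g : G1) := exists2 i, (i < n0.+1)%N & g = gt i.
have rM (g h : G1) : pair_rep (g * h)%g = pair_rep g * pair_rep h by [].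
have r1 : pair_rep 1%g = 1 by [].
have r_nil (g : G1) : (pair_rep g).1 [::] = 1 by apply: munitP.
have yg b' : Bt b' -> exists c : 'I_d -> int,
    aug P pair_rep 2 ((pair_rep b' - 1) *~ Q0 - \sum_j (pair_rep (ys j) - 1) *~ c j).
  by move=> /basis[c cP]; exists c; apply: (cP _ _ _ (aug_character P rM r1)).
have K N := kernel_in_aug rM r1 r_nil pr_p pQ0 Bys yg ys_unit N Bb (congr1 (@mval _ _) b1).
apply/eqP; rewrite -subr_eq0; apply/eqP/polyP => i; apply/matrixP => k l.
rewrite coef0 [RHS]mxE; apply/funext => w.
(* The denominator C has to serve every series occurring in the generators and their inverses. It
   depends on the length of w, so the coefficients are treated one word at a time. *)
pose fs := [seq mval (xs t).2 | t <- iota 0 n0]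
  ++ [seq mval ((xs t).2)^-1%g | t <- iota 0 n0] ++ [:: u; mval (z^-1)%g.2].
have [|C C_gt0 CP] := @lattice_ex d p (size w) fs.
  move=> f; rewrite !mem_cat => /or3P[/mapP[t _ ->]|/mapP[t _ ->]|].
  - by exists 1; apply: munitP.
  - by exists 1; apply: munitP.
  by rewrite !inE => /orP[]/eqP->; exists 1; apply: munitP.
have L N x : aug P pair_rep N x -> poly_lattice (size w) C (N %/ p)%N x.2.
  apply: aug_pair_rep => // [t lt_t| |].
  - have tI : t \in iota 0 n0 by rewrite mem_iota.
    by split; apply: CP; rewrite !mem_cat; apply/or3P; [constructor 1|constructor 2];
      apply: map_f.
  - by apply: CP; rewrite !mem_cat !inE eqxx !orbT.
  by apply: CP; rewrite !mem_cat !inE eqxx !orbT.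
apply: (@poly_lattice_inf d p0 (size w) C) => //.
  have := L _ _ (augW rM (aug_sub1 r1 Bb)); rewrite div0n; exact.
(* Depth N p is asked for because [aug_pair_rep] divides the depth by p. *)
move=> N; have [Q pQ aQ] := K (N * p)%N; exists Q => //.
have := L _ _ aQ; rewrite mulnK //.
by rewrite [_.2](raddfMz (@snd A {poly Mx})).
Qed.

Lemma foldl_syllables R s :
  foldl (alt_mul u) R [seq (jh.1, mval jh.2.2) | jh <- s] =
  R * rval (syllables s).2.
Proof.
elim: s R => [|[j h] s IHs] R /=; first by rewrite mulr1.
rewrite IHs /alt_mul /=.
have E k : (yt ^+ k)%g.2 = (root_unit ^+ k)%g by elim: k => // k IHk; rewrite !expgS -IHk.
by rewrite rvalM rvalM E rvalX !mulrA.
Qed.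

Lemma lift_B0 b : gen_by (tower_gens n0 xs y) n0.+1 b -> exists2 b', Bt b' & b'.1 = b.
Proof.
elim=> [g [t lt_t ->]| |g h _ [g' Bg <-] _ [h' Bh <-]|g _ [g' Bg <-]].
- exists (gt t); first exact: gen_by_gen.
  by rewrite /tower_gens; case: ifP.
- by exists 1%g; first exact: gen_1.
- by exists (g' * h')%g; first exact: gen_M.
by exists (g'^-1)%g; first exact: gen_V.
Qed.

(** A lift b' of b has trivial matrix by [kernel_rep], while a normal form with at least one
    syllable has a non-trivial one. So b lies in H, where injectivity is known. *)
Theorem root_extension_inj b : gen_by (tower_gens n0 xs y) n0.+1 b ->
  b.2 = 1%g -> b = 1%g.
Proof.
move=> /lift_B0[b' Bb' <-] b1; have rep1 := kernel_rep Bb' b1.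
have [h [s [Hh Hs Eb]]] := syllables_ex Bb'.
have [h' [s' [Hh' Hs' Er red]]] := syllables_reduce Hh Hs.
rewrite Er in Eb; case: s' Hs' red {Er} Eb => [|[j h1] s1] Hs' red Eb.
  have E : b'.1 = h' by rewrite Eb mulg1.
  by rewrite E; apply: injH; rewrite // -E.
have [lt_j alt] := red; have nz_h (h2 : G0) : mval h2.2 != 0.
  by apply: contra_eq_neq (munitP h2.2) => ->; rewrite ncps0 eq_sym oner_neq0.
have := alternating_prod_neq1 (@ncps_mulf_neq0 _ d) (lam_neq0 u_nil u_neq1) (nz_h h') lt_j alt.
rewrite -[(j, _) :: _]/[seq (jh.1, mval jh.2.2) | jh <- (j, h1) :: s1].
rewrite foldl_syllables => /negP[]; apply/eqP; rewrite -[RHS]rep1.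
by rewrite Eb.
Qed.

End Step.

(** * The Magnus embedding *)

Definition power_word (G : groupType) (I : Type) (x : I -> G) (s : seq (I * int)) : G :=
  (\prod_(ie <- s) expgz (x ie.1) ie.2)%g.

Section PowerWords.
Variables (G : groupType) (I : eqType) (x : I -> G).
Local Notation word := (power_word x).

Lemma power_word_cons i e s : word ((i, e) :: s) = (expgz (x i) e * word s)%g.
Proof. exact: big_cons. Qed.

Lemma power_word_cat s s' : word (s ++ s') = (word s * word s')%g.
Proof. exact: big_cat. Qed.

Definition reduced_word (s : seq (I * int)) : bool :=
  sorted (fun a b => a != b) (map fst s) && all (fun ie => ie.2 != 0) s.

Lemma power_word_reduce s : exists2 s', reduced_word s' & word s' = word s.
Proof.
elim: s => [|[i e] s [s' red E]]; first by exists [::].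
rewrite power_word_cons -E.
have [->|nze] := eqVneq e 0; first by exists s'; rewrite // mul1g.
case: s' red {E} => [|[i' e'] s'] red.
  by exists [:: (i, e)]; rewrite ?power_word_cons // /reduced_word /= nze.
have [Ei|ni] := eqVneq i i'; last first.
  exists [:: (i, e), (i', e') & s']; rewrite ?power_word_cons //.
  by move: red; rewrite /reduced_word /= ni nze.
case/andP: red => /= sorted_s /andP[nze' all_s].
have [E0|nzE] := eqVneq (e + e') 0.
  exists s'; first by rewrite /reduced_word all_s (path_sorted sorted_s).
  by rewrite power_word_cons mulgA Ei -expgzD E0 mul1g.
exists ((i, e + e') :: s'); first by rewrite /reduced_word /= nzE Ei sorted_s all_s.
by rewrite !power_word_cons mulgA Ei expgzD.
Qed.

Lemma gen_power_word (P : G -> Prop) b : (forall g, P g -> exists i, g = x i) ->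
  gen_subgroup P b -> exists s, b = word s.
Proof.
move=> Px Bb; suff [] : (exists s, b = word s) /\ (exists s, b^-1%g = word s) by [].
elim: Bb => [g /Px[i ->]| |g h _ [[s Es] [s' Es']] _ [[t Et] [t' Et']]|g _ []].
- split; first by exists [:: (i, 1)]; rewrite power_word_cons /power_word big_nil mulg1.
  by exists [:: (i, -1)]; rewrite power_word_cons /power_word big_nil mulg1.
- by rewrite invg1; split; exists [::]; rewrite /power_word big_nil.
- rewrite invgM; split; first by exists (s ++ t); rewrite power_word_cat Es Et.
  by exists (t' ++ s'); rewrite power_word_cat Es' Et'.
by rewrite invgK.
Qed.

End PowerWords.

Section MagnusEmbedding.
Variables (K : numFieldType) (d : nat).
Local Notation A := (ncps K d).
Implicit Types (f g : munit K d) (w v : seq 'I_d).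

Definition supported_on (i : 'I_d) (f : A) : Prop :=
  forall w, ~~ all (pred1 i) w -> f w = 0.

Lemma supported_onM i (f g : A) :
  supported_on i f -> supported_on i g -> supported_on i (f * g).
Proof.
move=> sf sg w nw; rewrite ncpsM big1 // => k _; move: nw.
rewrite -{1}(cat_take_drop k w) all_cat negb_and.
by case/orP=> [/sf->|/sg->]; rewrite ?mul0r ?mulr0.
Qed.

Lemma supported_on1 i : supported_on i 1.
Proof. by move=> [|a w] // _; rewrite ncps1. Qed.

Lemma supported_onV i f : supported_on i (mval f) -> supported_on i (mval f^-1%g).
Proof.
move=> sf w; have [n] := ubnP (size w); elim: n w => // n IHn w ltw nw.
have := congr1 (fun u : A => u w) (mvalV f); rewrite ncpsM big_ord_recl take0 drop0.
rewrite munitP mul1r big1 ?addr0 => [->|k _]; first exact: (supported_on1 nw).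
have := nw; rewrite -{1}(cat_take_drop (lift ord0 k) w) all_cat negb_and.
case/orP=> [/sf->|nd]; first by rewrite mul0r.
rewrite IHn ?mulr0 // size_drop /= /bump /=.
by have := ltn_ord k; move: ltw; lia.
Qed.

Definition gen_unit (i : 'I_d) (f : munit K d) : Prop :=
  mval f = 1 + lin (fun j => (i == j)%:R).

Lemma gen_unit_supp i f (e : int) : gen_unit i f ->
  supported_on i (mval (expgz f e)) /\ mval (expgz f e) [:: i] = e%:~R.
Proof.
move=> Ef; have sf : supported_on i (mval f).
  rewrite Ef => -[|a [|b w]] //=; last by rewrite ncpsD ncps1 addr0.
  by rewrite andbT ncpsD ncps1 add0r eq_sym => /negPf/= ->.
have sX n : supported_on i (mval (f ^+ n)%g) /\ mval (f ^+ n)%g [:: i] = n%:R.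
  elim: n => [|n [sn En]]; first by split; [apply: supported_on1|].
  rewrite expgS mvalM; split; first exact: supported_onM.
  by rewrite ncpsM_1 !munitP En mul1r mulr1 Ef ncpsD ncps1 /= eqxx !add0r natr1.
case: e => n; first exact: sX.
have [sn En] := sX n.+1; split; first exact: supported_onV.
have := congr1 (fun u : A => u [:: i]) (mvalV (f ^+ n.+1)%g).
rewrite ncpsM_1 !munitP En mul1r mulr1 ncps1 => /eqP; rewrite addr_eq0 => /eqP.
by rewrite NegzE mulrNz => ->.
Qed.

Variables (x : 'I_d -> munit K d).
Hypothesis xP : forall i, gen_unit i (x i).

(** A factor involves powers of its own letter only, so a word without repeated neighbours takes at
    most one letter from each factor, with the exponent as coefficient. The prefix v covers the case
    of a factor that contributes 1: then too many letters remain for the other factors. *)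
Lemma magnus_coef s v : reduced_word s -> sorted (fun a b => a != b) (v ++ map fst s) ->
  mval (power_word x s) (v ++ map fst s) =
  if v is [::] then \prod_(ie <- s) (ie.2)%:~R else 0.
Proof.
elim: s v => [|[i e] s IHs] v red sv.
  rewrite /power_word [RHS](_ : _ = if v is [::] then 1 else 0); last first.
    by case: v {sv} => //; rewrite big_nil.
  by rewrite /= cats0 big_nil; clear sv; case: v.
have red_s : reduced_word s.
  by case/andP: red => s1 /= /andP[_ s2]; rewrite /reduced_word s2 (path_sorted s1).
have [sf ef] := gen_unit_supp e (xP i); set f := expgz (x i) e in sf ef.
have E a b w (P : A) : a != b ->
    (mval f * P) [:: a, b & w] = P [:: a, b & w] + mval f [:: a] * P (b :: w).
  move=> nab; rewrite !ncpsM_cons munitP mul1r; congr (_ + _).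
  rewrite (_ : lder b (lder a (mval f)) = 0) ?mul0r ?addr0 //.
  apply/funext => u; apply: sf => /=; case: (a =P i) => // Ea.
  by rewrite -Ea eq_sym (negPf nab).
rewrite power_word_cons mvalM -/f; case: v sv => [|a v] sv.
  rewrite big_cons /= -[X in mval f * X]/(mval (power_word x s)).
  have IH0 := IHs [::] red_s (path_sorted sv).
  case Es: s => [|[i2 e2] s2].
    by rewrite /= ncpsM_1 !munitP ef /power_word !big_nil mul1r !mulr1 mval1 ncps1 add0r.
  have := IHs [:: i] red_s sv; rewrite Es /= => E1.
  rewrite E; last by move: sv; rewrite Es /= => /andP[].
  by rewrite E1 add0r ef; have := IH0; rewrite Es /= => ->.
have [b [w Ew]] : exists b w, v ++ i :: map fst s = b :: w.
  by case: v {sv} => [|b v]; [exists i, (map fst s)|exists b, (v ++ i :: map fst s)].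
rewrite /= Ew E; last by move: sv; rewrite /= Ew /= => /andP[].
have E1 : rcons (a :: v) i ++ map fst s = [:: a, b & w] by rewrite cat_rcons /= Ew.
have E2 : rcons v i ++ map fst s = b :: w by rewrite cat_rcons Ew.
have := IHs (rcons (a :: v) i) red_s; rewrite E1 => ->; last first.
  by move: sv; rewrite /= Ew.
have := IHs (rcons v i) red_s; rewrite E2 => ->; last first.
  by move: sv; rewrite /= Ew => /path_sorted.
by rewrite /= add0r; case: (v) => [|? ?]; rewrite mulr0.
Qed.

End MagnusEmbedding.

Lemma magnus_inj (Gr : groupType) (d : nat) (xs : nat -> (Gr * munit rat d)%type) b :
  (forall i : 'I_d, gen_unit i (xs i).2) -> gen_by xs d b -> b.2 = 1%g -> b = 1%g.
Proof.
move=> xP Bb b1; have [s Es] : exists s, b = power_word (fun i : 'I_d => xs i) s.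
  by apply: gen_power_word Bb => g [i lti ->]; exists (Ordinal lti).
have [s' red Es'] := power_word_reduce (fun i : 'I_d => xs i) s.
case/andP: (red) => sorted_s all_s.
have := magnus_coef xP (v := [::]) red sorted_s.
have -> : power_word (fun i : 'I_d => (xs i).2) s' = 1%g.
  rewrite -b1 Es -Es' /power_word (morph_prod (T := snd)) //.
  by apply: eq_bigr => ie _; rewrite (morph_expgz (T := snd)).
case: s' red sorted_s all_s Es' => [|[i e] s1] _ _ all_s Es'.
  by move=> _; rewrite Es -Es' /power_word big_nil.
rewrite mval1 ncps1 /= => /esym/eqP; rewrite prodf_seq_eq0 => /hasP[ie ie_s /andP[_]].
by rewrite intr_eq0 => /eqP e0; have := allP all_s _ ie_s; rewrite e0.
Qed.

(** * Towers of roots *)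

Definition shift_word (G : groupType) (x : nat -> G) (i : nat) (L : seq (nat * int)) : G :=
  power_word (fun l => x (i + l)%N) L.

Definition exponent_sum (L : seq (nat * int)) (l : nat) : int :=
  \sum_(le <- L | le.1 == l) le.2.

Section Relations.
Variables (d m : nat) (L : seq (nat * int)).
Hypothesis L_lt : forall le, le \in L -> (le.1 < d)%N.
Local Notation a := (exponent_sum L).

Lemma shift_word_char (G : groupType) (P : G -> Prop) (x : nat -> G) i
    (M : zmodType) (S : M -> Prop) (chi : G -> M) :
  character (gen_subgroup P) S chi ->
  (forall l, (l < d)%N -> gen_subgroup P (x (i + l)%N)) ->
  S (chi (shift_word x i L) - \sum_(l < d) chi (x (i + l)%N) *~ a l).
Proof.
move=> chiP Px; rewrite /shift_word /power_word /exponent_sum.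
elim: L L_lt => [|[l e] s IHs] s_lt.
  rewrite big_nil big1 ?subr0; first exact: char1 chiP.
  by move=> l _; rewrite big_nil mulr0z.
have lt_l : (l < d)%N := s_lt _ (mem_head _ _).
have s_lt' le : le \in s -> (le.1 < d)%N by move=> le_s; apply: s_lt; rewrite inE le_s orbT.
have Ps : gen_subgroup P (\prod_(ie <- s) expgz (x (i + ie.1)%N) ie.2)%g.
  elim: s s_lt' {IHs s_lt} => [|le s IHs] s_lt; first by rewrite big_nil; apply: gen_1.
  rewrite big_cons; apply: gen_M.
    by apply/gen_expgz/Px/s_lt; rewrite mem_head.
  by apply: IHs => le' le_s; apply: s_lt; rewrite inE le_s orbT.
have Pl : gen_subgroup P (expgz (x (i + l)%N) e) by apply/gen_expgz/Px.
rewrite big_cons /=; apply: (charSC chiP (charM chiP Pl Ps)).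
have -> : \sum_(l0 < d) chi (x (i + l0)%N) *~ (\sum_(le <- (l, e) :: s | le.1 == l0 :> nat) le.2)
    = chi (x (i + l)%N) *~ e +
      \sum_(l0 < d) chi (x (i + l0)%N) *~ (\sum_(le <- s | le.1 == l0 :> nat) le.2).
  rewrite [in RHS](bigD1 (Ordinal lt_l)) //= [in LHS](bigD1 (Ordinal lt_l)) //= addrA.
  rewrite big_cons /= eqxx mulrzDr; congr (_ + _); apply: eq_bigr => l0.
  by rewrite big_cons -val_eqE /= eq_sym => /negPf->.
rewrite opprD addrACA; apply: (charSD chiP); last exact: IHs.
by apply: (char_expgz chiP); apply: Px.
Qed.

Variables (G : groupType) (x : nat -> G) (k q : nat) (z : G).
Hypothesis rel_x : forall i, (i < k)%N -> (x (i + d)%N ^+ m)%g = shift_word x i L.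
Hypothesis rel_z : (z ^+ q)%g = shift_word x k L.
Local Notation g := (tower_gens (d + k) x z).
Local Notation top := (fun i => if i == k then - q%:Z else - m%:Z).

(** Row i of the relation matrix is relation i seen by characters. The last relation has its own
    exponent q, because the tower may so far contain only an intermediate root z. *)
Lemma tower_relP i (M : zmodType) (S : M -> Prop) (chi : G -> M) :
  (i <= k)%N -> character (gen_by g (d + k.+1)) S chi ->
  S (\sum_(t < d + k.+1) chi (g t) *~ rel_row d a top i t).
Proof.
move=> le_ik chiP; set B := gen_by g (d + k.+1) in chiP.
have gE l : (l < d)%N -> g (i + l)%N = x (i + l)%N.
  by move=> lt_l; rewrite /tower_gens; case: ifP => //; lia.
have Bg l : (l < d)%N -> B (x (i + l)%N).
  by move=> lt_l; rewrite -gE //; apply: gen_by_gen; lia.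
have -> : \sum_(t < d + k.+1) chi (g t) *~ rel_row d a top i t =
    \sum_(l < d) chi (x (i + l)%N) *~ a l + chi (g (i + d)%N) *~ top i.
  rewrite -(big_mkord xpredT (fun t => chi (g t) *~ rel_row d a top i t)).
  rewrite (@big_cat_nat _ _ _ i) ?leq0n //=; last by lia.
  rewrite (@big_cat_nat _ _ _ (i + d)%N i) /=; [|lia|lia].
  rewrite big_nat big1 ?add0r; last first.
    move=> t /andP[_ lt_t]; rewrite /rel_row leqNgt lt_t /=.
    by case: eqP => [|_]; [lia | rewrite mulr0z].
  congr (_ + _).
    rewrite -{1}(add0n i) big_addn addKn big_mkord; apply: eq_bigr => l _.
    by rewrite (addnC l i) gE // /rel_row leq_addr ltn_add2l ltn_ord addKn.
  rewrite big_ltn; last by lia.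
  rewrite big_nat big1 ?addr0; last first.
    move=> t /andP[lt_t _]; rewrite /rel_row (ltnNge t) (ltnW lt_t) andbF.
    by case: eqP => [|_]; [lia | rewrite mulr0z].
  by rewrite /rel_row ltnn andbF eqxx.
pose N := if i == k then q else m.
have Etop : (g (i + d)%N ^+ N)%g = shift_word x i L.
  rewrite /N; case: eqP => [->|/eqP ne_ik].
    by rewrite /tower_gens addnC ltnn.
  by rewrite -rel_x; [congr (_ ^+ _)%g; rewrite /tower_gens; case: ifP => //|]; lia.
have Bt : B (g (i + d)%N) by apply: gen_by_gen; lia.
have := char_expgz chiP N Bt; rewrite /= Etop => S1.
have S2 := shift_word_char chiP Bg.
have := charSB chiP S1 S2; rewrite opprB addrC addrA subrK.
have -> : top i = - N%:Z by rewrite /N; case: ifP.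
by rewrite mulrNz.
Qed.

End Relations.

(** * Primitivity of the roots modulo every prime *)

Section Primitive.
Variables (d m : nat) (a : nat -> int) (v : nat -> 'I_d -> rat).
Hypothesis m_gt0 : (0 < m)%N.
Hypothesis a_gcd : forall p : nat, prime p -> exists2 l, (l < d)%N & ~~ (p %| a l)%Z.
Hypothesis v_init : forall i j : 'I_d, v i j = (i == j)%:R.
Hypothesis v_rec : forall i j, v (i + d)%N j *~ m%:Z = \sum_(l < d) v (i + l)%N j *~ a l.

Definition lower_poly : {poly int} := \sum_(l < d) a l *: 'X^l.
Definition rec_poly : {poly int} := lower_poly - m%:Z *: 'X^d.

Lemma coef_lower l : lower_poly`_l = if (l < d)%N then a l else 0.
Proof. by rewrite /lower_poly -(poly_def d a) coef_poly. Qed.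

Lemma size_rec : size rec_poly = d.+1.
Proof.
have s1 : (size lower_poly <= d)%N by rewrite /lower_poly -(poly_def d a) size_poly.
have s2 : size (m%:Z *: 'X^d : {poly int}) = d.+1.
  by rewrite size_scale ?size_polyXn // eqz_nat -lt0n.
by rewrite /rec_poly -opprB size_polyN size_polyDl ?s2 // size_polyN ltnS.
Qed.

(** Evaluation of X^i at the vector v i, cut at degree n. By the recursion its kernel is, up to
    integer factors, the ideal of [rec_poly]. *)
Definition val_at n (f : {poly int}) j : rat := \sum_(i < n) v i j *~ f`_i.

Lemma val_atB n f g j : val_at n (f - g) j = val_at n f j - val_at n g j.
Proof. by rewrite -sumrB; apply: eq_bigr => i _; rewrite coefB mulrzBr. Qed.
Lemma val_atZ n c f j : val_at n (c *: f) j = val_at n f j *~ c.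
Proof.
by rewrite mulrz_suml; apply: eq_bigr => i _; rewrite coefZ [c * _]mulrC mulrzA.
Qed.
Lemma val_at0 n j : val_at n 0 j = 0.
Proof. by rewrite /val_at big1 // => i _; rewrite coef0. Qed.
Lemma val_atD n f g j : val_at n (f + g) j = val_at n f j + val_at n g j.
Proof. by rewrite -big_split; apply: eq_bigr => i _; rewrite coefD mulrzDr. Qed.
Lemma val_at_sum n (I : Type) (r : seq I) (F : I -> {poly int}) j :
  val_at n (\sum_(i <- r) F i) j = \sum_(i <- r) val_at n (F i) j.
Proof.
by apply: (big_morph (val_at n ^~ j)) => [f g|]; [apply: val_atD | apply: val_at0].
Qed.
Lemma val_atXn n i j : (i < n)%N -> val_at n 'X^i j = v i j.
Proof.
move=> lti; rewrite /val_at (bigD1 (Ordinal lti)) //= coefXn eqxx big1 ?addr0 // => k.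
by rewrite -val_eqE coefXn => /negPf/= ->.
Qed.

Lemma val_at_rec n i j : (i + d < n)%N -> val_at n (rec_poly * 'X^i) j = 0.
Proof.
move=> lt_n; rewrite /rec_poly mulrBl val_atB -scalerAl -exprD val_atZ.
rewrite addnC val_atXn // v_rec /lower_poly mulr_suml val_at_sum -sumrB big1 // => l _.
by rewrite -scalerAl -exprD val_atZ addnC val_atXn ?subrr //; have := ltn_ord l; lia.
Qed.

Lemma val_at_recM n (h : {poly int}) j : (size h + d <= n)%N -> val_at n (rec_poly * h) j = 0.
Proof.
move=> le_n; rewrite -[h]coefK poly_def mulr_sumr val_at_sum big1 // => i _.
by rewrite -scalerAr val_atZ val_at_rec ?mul0rz //; have := ltn_ord i; lia.
Qed.

(** Pseudo-division by [rec_poly] leaves a remainder of degree less than d, on which the evaluation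
    is injective since the first d values of v are the unit vectors. *)
Lemma val_at_ker n (f : {poly int}) : (size f <= n)%N -> (forall j, val_at n f j = 0) ->
  exists2 C : int, C != 0 & exists h, C *: f = rec_poly * h.
Proof.
move=> le_n f0; pose C := lead_coef rec_poly ^+ scalp f rec_poly.
have nzA : rec_poly != 0 by rewrite -size_poly_eq0 size_rec.
have nzC : C != 0 by rewrite expf_neq0 // lead_coef_eq0.
exists C => //; exists (f %/ rec_poly).
have E := Pdiv.Idomain.divp_eq f rec_poly; rewrite -/C in E.
rewrite E mulrC; set R := f %% rec_poly in E *.
suff -> : R = 0 by rewrite addr0.
have szR : (size R <= d)%N by rewrite -ltnS -size_rec ltn_modp.
pose n' := (n + size (f %/ rec_poly)%R + d)%N.
have R0 j : val_at n' R j = 0.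
  have -> : R = C *: f - rec_poly * (f %/ rec_poly) by rewrite E mulrC addrC addKr.
  rewrite val_atB val_atZ val_at_recM ?subr0; last by rewrite /n' -addnA leq_addl.
  suff -> : val_at n' f j = val_at n f j by rewrite f0 mul0rz.
  rewrite /val_at -!(big_mkord xpredT (fun i => v i j *~ f`_i)).
  rewrite (@big_cat_nat _ _ _ n 0 n') //=; last by rewrite /n' -addnA leq_addr.
  rewrite [X in _ + X]big_nat [X in _ + X]big1 ?addr0 // => i /andP[le_ni _].
  by rewrite nth_default ?mulr0z // (leq_trans le_n).
apply/polyP => i; rewrite coef0.
have [le_di|lt_id] := leqP d i; first by rewrite nth_default // (leq_trans szR).
have := R0 (Ordinal lt_id); rewrite /val_at -(big_mkord xpredT (fun i0 => v i0 _ *~ R`_i0)).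
rewrite (@big_cat_nat _ _ _ d 0 n') //=; last by rewrite /n' leq_addl.
rewrite [X in _ + X]big_nat [X in _ + X]big1 ?addr0; last first.
  by move=> k /andP[le_k _]; rewrite nth_default ?mulr0z // (leq_trans szR).
rewrite big_mkord (bigD1 (Ordinal lt_id)) //= (v_init (Ordinal lt_id)) eqxx big1 ?addr0.
  by move=> /eqP; rewrite intr_eq0 => /eqP.
by move=> k nk; rewrite v_init (negPf nk) mul0rz.
Qed.

Section ModP.
Variables (p : nat) (pr_p : prime p).
Local Notation red := (map_poly (intr : int -> 'F_p)).

Lemma red_eq0 (h : {poly int}) : red h = 0 -> exists h1, h = p%:Z *: h1.
Proof.
move=> h0; exists (\poly_(i < size h) (h`_i %/ p%:Z)%Z); apply/polyP => i.
rewrite coefZ coef_poly; case: ltnP => [_|le_i]; last by rewrite mulr0 nth_default.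
have := congr1 (fun P : {poly 'F_p} => P`_i) h0; rewrite coef_map coef0 => /eqP.
by rewrite Fp_int_eq0 // => pdv; rewrite mulrC divzK.
Qed.

Lemma red_rec_neq0 : red rec_poly != 0.
Proof.
have [l lt_l nl] := a_gcd pr_p; apply: contraNneq nl => r0.
have := congr1 (fun P : {poly 'F_p} => P`_l) r0; rewrite coef_map coef0 => /eqP.
rewrite Fp_int_eq0 // /rec_poly coefB coef_lower lt_l coefZ coefXn.
by rewrite (ltn_eqF lt_l) mulr0 subr0.
Qed.

(** Gauss's lemma: [rec_poly] is non-zero modulo p, so a factor p of C divides the cofactor h and
    cancels. *)
Lemma rec_cofactor (C : int) (f h : {poly int}) : C != 0 -> C *: f = rec_poly * h ->
  exists C' h', ~~ (p %| C')%Z /\ C' *: f = rec_poly * h'.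
Proof.
have [n] := ubnP `|C|%N; elim: n C h => // n IHn C h ltC nzC E.
have [pC|npC] := boolP (p %| C)%Z; last by exists C, h.
have /dvdzP[C1 EC] := pC.
have h0 : red h = 0.
  have := congr1 red E; rewrite rmorphM /= map_polyZ /=.
  have /eqP -> : (C%:~R == 0 :> 'F_p) by rewrite Fp_int_eq0.
  by rewrite scale0r => /esym/eqP; rewrite mulf_eq0 (negPf red_rec_neq0) => /eqP.
have [h1 Eh] := red_eq0 h0.
have p_gt1 := prime_gt1 pr_p.
have nzp : p%:Z != 0 by rewrite eqz_nat -lt0n prime_gt0.
have nzC1 : C1 != 0 by apply: contraNneq nzC => C10; rewrite EC C10 mul0r.
apply: (IHn C1 h1) => //.
  rewrite -ltnS; apply: leq_trans ltC; rewrite EC abszM absz_nat ltnS.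
  by rewrite -{1}[`|C1|%N]muln1 ltn_pmul2l // absz_gt0.
have nzpP : (p%:Z)%:P != 0 :> {poly int} by rewrite polyC_eq0.
by apply: (mulfI nzpP); rewrite !mul_polyC scalerA [p%:Z * _]mulrC -EC E Eh scalerAr.
Qed.

(** Modulo p the relation becomes rec_poly (h' - C' c X^k) = C' c m X^(d+k), where h' has degree
    less than k, so that the second factor is not 0. Hence m is prime to p and [rec_poly] is a
    monomial modulo p; but besides - m at X^d it has some non-zero a l with l < d. *)
Lemma primitive_relation k (b c : int) (e : nat -> int) :
  (p %| b)%Z -> ~~ (p %| c)%Z ->
  (forall j, \sum_(l < d) v (k + l)%N j *~ (a l * c) =
             \sum_(t < d + k) v t j *~ (e t * b)) -> False.
Proof.
move=> pb pc E.
pose g : {poly int} := \sum_(t < d + k) e t *: 'X^t.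
pose f := c *: (lower_poly * 'X^k) - b *: g.
have szg : (size g <= d + k)%N by rewrite /g -(poly_def (d + k) e) size_poly.
have szl : (size (lower_poly * 'X^k)%R <= d + k)%N.
  apply: leq_trans (size_polyMleq _ _) _; rewrite size_polyXn addnS /= leq_add2r.
  by rewrite /lower_poly -(poly_def d a) size_poly.
have szf : (size f <= d + k)%N.
  apply: leq_trans (size_polyD _ _) _; rewrite geq_max size_polyN.
  by rewrite !(leq_trans (size_scale_leq _ _)).
have f0 j : val_at (d + k) f j = 0.
  apply/eqP; rewrite val_atB !val_atZ subr_eq0 /lower_poly mulr_suml !val_at_sum.
  apply/eqP; rewrite !mulrz_suml; have := E j; congr (_ = _).
    apply: eq_bigr => l _; rewrite -scalerAl -exprD val_atZ addnC val_atXn ?mulrzA //.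
    by have := ltn_ord l; lia.
  by apply: eq_bigr => t _; rewrite val_atZ val_atXn // mulrzA.
have [C nzC [h Eh]] := val_at_ker szf f0.
have [C' [h' [pC' {}Eh]]] := rec_cofactor nzC Eh.
have Fp0 i : (i%:~R == 0 :> 'F_p) = (p %| i)%Z by apply: Fp_int_eq0.
have Eb : b%:~R = 0 :> 'F_p by apply/eqP; rewrite Fp0.
pose B := red h' - (C' * c)%:~R *: 'X^k.
have EB : red rec_poly * B = (C' * c * m%:Z)%:~R *: 'X^(d + k).
  have E1 : red (lower_poly * 'X^k) = red lower_poly * 'X^k by rewrite rmorphM /= map_polyXn.
  have E2 : red rec_poly = red lower_poly - (m%:Z)%:~R *: 'X^d.
    by rewrite /rec_poly rmorphB /= map_polyZ map_polyXn.
  have E3 : red rec_poly * red h' = (C' * c)%:~R *: (red lower_poly * 'X^k).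
    have := congr1 red Eh; rewrite rmorphM => <-; rewrite map_polyZ /= /f rmorphB /=.
    by rewrite !map_polyZ /= Eb scale0r subr0 E1 scalerA -intrM.
  rewrite /B mulrBr E3 E2 -scalerAr mulrBl scalerBr opprB addrC subrK.
  by rewrite -scalerAl scalerA -intrM exprD.
have szh : (size h' <= k)%N.
  have [->|nzh] := eqVneq h' 0; first by rewrite size_poly0.
  have nzA : rec_poly != 0 by rewrite -size_poly_eq0 size_rec.
  have := leq_trans (size_scale_leq C' f) szf; rewrite Eh size_mul // size_rec addSn /=.
  by rewrite leq_add2l.
have Bk : B`_k = - (C' * c)%:~R.
  rewrite /B coefB coefZ coefXn eqxx mulr1 nth_default ?sub0r //.
  exact: leq_trans (size_poly _ _) szh.
have nzB : B != 0.
  apply: contraTneq (isT) => B0; have := Bk; rewrite B0 coef0 => /esym/eqP.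
  rewrite oppr_eq0 Fp0 dvdzE abszM Euclid_dvdM // -!dvdzE.
  by rewrite (negPf pc) (negPf pC').
have nzAB : red rec_poly * B != 0 by rewrite mulf_neq0 // red_rec_neq0.
have dvdA : red rec_poly %| ('X - 0%:P) ^+ (d + k).
  rewrite subr0; have nz : (C' * c * m%:Z)%:~R != 0 :> 'F_p.
    by apply: contraNneq nzAB => z0; rewrite EB z0 scale0r.
  by rewrite -(dvdpZr _ _ nz) -EB dvdp_mulr.
have pm : ~~ (p %| m%:Z)%Z.
  by apply: contra nzAB => pm; rewrite EB; rewrite -Fp0 in pm; rewrite intrM (eqP pm) mulr0 scale0r.
have /dvdp_exp_XsubCP[r _ /eqpP[[c1 c2] /= /andP[nz1 nz2] Ec]] := dvdA.
rewrite subr0 in Ec.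
have cA l : (red rec_poly)`_l != 0 -> l = r.
  have := congr1 (fun P : {poly 'F_p} => P`_l) Ec; rewrite !coefZ coefXn.
  case: eqP => // _; rewrite mulr0 => /eqP; rewrite mulf_eq0 (negPf nz1) /= => /eqP->.
  by rewrite eqxx.
have rd : d = r.
  apply: cA; rewrite coef_map Fp0 /rec_poly coefB coef_lower ltnn coefZ coefXn eqxx.
  by rewrite mulr1 sub0r dvdzE abszN -dvdzE.
have [l lt_l nl] := a_gcd pr_p.
suff : l = r by rewrite -rd => Elr; rewrite Elr ltnn in lt_l.
apply: cA; rewrite coef_map Fp0 /rec_poly coefB coef_lower lt_l coefZ coefXn.
by rewrite (ltn_eqF lt_l) mulr0 subr0.
Qed.

End ModP.
End Primitive.

Section TowerInjective.
Variables (Gr : groupType) (d m : nat) (L : seq (nat * int)).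
Local Notation G0 := (Gr * munit rat d)%type.
Variable xi : nat -> G0.
Local Notation a := (exponent_sum L).
Hypotheses (m_gt0 : (0 < m)%N) (L_lt : forall le, le \in L -> (le.1 < d)%N).
Hypothesis a_gcd : forall p : nat, prime p -> exists2 l, (l < d)%N & ~~ (p %| a l)%Z.
Hypothesis xi_rel : forall i, (xi (i + d)%N ^+ m)%g = shift_word xi i L.
Hypothesis xi_gen : forall i : 'I_d, gen_unit i (xi i).2.

Lemma lin_coef_character (P : G0 -> Prop) j :
  character (gen_subgroup P) (fun q : rat => q = 0) (fun g : G0 => lin_coef g j).
Proof.
split=> // [q q' -> ->|g h _ _]; first exact: subrr.
by rewrite lin_coefM addrAC addrK subrr.
Qed.

Lemma lin_coef_root (z : G0) k q j : (z ^+ q)%g = shift_word xi k L ->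
  lin_coef z j *~ q%:Z = \sum_(l < d) lin_coef (xi (k + l)%N) j *~ a l.
Proof.
move=> Ez; have P0 (g : G0) : gen_subgroup (fun=> True) g by apply: gen_in.
have chiP := lin_coef_character (fun=> True) j.
have := shift_word_char L_lt (x := xi) (i := k) chiP (fun l _ => P0 _).
rewrite -Ez -[(z ^+ q)%g]/(expgz z q) lin_coef_expgz => /eqP.
by rewrite subr_eq0 => /eqP.
Qed.

Lemma xi_init (i j : 'I_d) : lin_coef (xi i) j = (i == j)%:R.
Proof. by rewrite /lin_coef xi_gen ncpsD ncps1 add0r. Qed.

(** Expanding v in the generators gives (1 - b e_n) z = b (a combination of the earlier xi) on
    linear parts. A prime dividing b does not divide 1 - b e_n, which [primitive_relation]
    excludes. *)
Lemma tower_prim k q (z v : G0) (b : int) : (z ^+ q)%g = shift_word xi k L ->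
  gen_by (tower_gens (d + k) xi z) (d + k).+1 v ->
  (forall j, lin_coef z j = lin_coef v j *~ b) -> b = 1 \/ b = -1.
Proof.
move=> Ez Hv Eb; apply: contrapT => b1.
have [p pr_p pb] : exists2 p : nat, prime p & (p %| b)%Z.
  have [->|nzb] := eqVneq b 0; first by exists 2; rewrite // dvdz0.
  exists (pdiv `|b|%N); last by rewrite dvdzE pdiv_dvd.
  by apply: pdiv_prime; move: b1 nzb; case: (b) => [[|[|k']]|[|k']] // /(_ _) []; by [left|right].
have [e He] := gen_by_exponents Hv.
pose n := (d + k)%N.
have Ev j : lin_coef v j = \sum_(t < n) lin_coef (xi t) j *~ e t + lin_coef z j *~ e n.
  have := He _ _ _ (lin_coef_character _ j); move/eqP; rewrite subr_eq0 => /eqP->.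
  rewrite big_ord_recr /= /tower_gens ltnn; congr (_ + _).
  by apply: eq_bigr => t _; rewrite ltn_ord.
(* The relation is multiplied by q, since only q times the linear part of z is an integer
   combination of those of the xi. *)
apply: (@primitive_relation d m a (fun i => lin_coef (xi i)) m_gt0 a_gcd xi_init _
  p pr_p k b (1 - b * e n) (fun t => q%:Z * e t)) => //.
- by move=> i j; apply: lin_coef_root; apply: xi_rel.
- apply: contraL (pb) => pc; apply/negP => pb'.
  have : (p %| 1 - b * e n + b * e n)%Z by rewrite rpredD // dvdz_mulr.
  by rewrite subrK dvdzE dvdn1 eqn_leq leqNgt prime_gt1.
move=> j; under eq_bigr do rewrite mulrzA.
rewrite -mulrz_suml -(lin_coef_root j Ez) -mulrzA mulrC mulrzA.
have -> : lin_coef z j *~ (1 - b * e n) = (\sum_(t < n) lin_coef (xi t) j *~ e t) *~ b.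
  rewrite mulrzBr mulr1z {1}Eb Ev mulrzDl -mulrzA [e n * b]mulrC.
  by rewrite addrK.
rewrite !mulrz_suml; apply: eq_bigr => t _.
by rewrite -!mulrzA; congr (_ *~ _); ring.
Qed.

(** As p divides both m and q p, the entries [top] of all relation rows vanish modulo p, and
    [local_basis] applies. *)
Lemma tower_step k p q (y : G0) : prime p -> (p %| m)%N ->
  (y ^+ (q * p))%g = shift_word xi k L ->
  (forall b, gen_by (tower_gens (d + k) xi (y ^+ p)%g) (d + k).+1 b -> b.2 = 1%g -> b = 1%g) ->
  forall b, gen_by (tower_gens (d + k) xi y) (d + k).+1 b -> b.2 = 1%g -> b = 1%g.
Proof.
move=> pr_p pm; have [p0 Ep] : exists p0, p = p0.+2.
  by exists p.-2; have := prime_gt1 pr_p; lia.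
subst p; move=> Ey injH.
have Ez : ((y ^+ p0.+2) ^+ q)%g = shift_word xi k L by rewrite -expgnA mulnC.
have [s [lt_sd al_s al_gt]] : exists s, [/\ (s < d)%N, ~~ (p0.+2 %| a s)%Z
    & forall j, (s < j < d)%N -> (p0.+2 %| a j)%Z].
  have [l lt_l nl] := a_gcd pr_p.
  pose Q i := (i < d)%N && ~~ (p0.+2 %| a i)%Z.
  have exQ : exists i, Q i by exists l; rewrite /Q lt_l.
  have ubQ i : Q i -> (i <= d)%N by case/andP=> /ltnW.
  case: (ex_maxnP exQ ubQ) => s /andP[lt_s ns] max_s; exists s; split=> // j /andP[lt_sj lt_j].
  by apply: contraTT lt_sj => nj; rewrite -leqNgt max_s // /Q lt_j.
pose x1 t := lift_scal p0 (xi t); pose y1 := yt p0 y.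
have rel1 i : (i < k)%N -> (x1 (i + d)%N ^+ m)%g = shift_word x1 i L.
  move=> _; rewrite /x1 -(morphX (@lift_scalM _ _ _)) xi_rel.
  rewrite /shift_word /power_word (morph_prod (@lift_scalM _ _ _)).
  by apply: eq_bigr => le _; rewrite (morph_expgz (@lift_scalM _ _ _)).
have rel_y1 : (y1 ^+ (q * p0.+2))%g = shift_word x1 k L.
  rewrite mulnC expgnA yt_p -(morphX (@lift_scalM _ _ _)) Ez.
  rewrite /shift_word /power_word (morph_prod (@lift_scalM _ _ _)).
  by apply: eq_bigr => le _; rewrite (morph_expgz (@lift_scalM _ _ _)).
have top_p i : (p0.+2 %| (if i == k then - (q * p0.+2)%N%:Z else - m%:Z))%Z.
  by case: ifP => _; rewrite dvdzE abszN absz_nat // dvdn_mull.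
have relP := tower_relP L_lt rel1 rel_y1.
have [Q0 pQ0 basis] := local_basis pr_p lt_sd al_s al_gt top_p relP.
pose ys (j : 'I_d) := tower_gens (d + k) x1 y1 (other_index k s j).
rewrite addnS in basis.
apply: (@root_extension_inj Gr d p0 (d + k) xi y pr_p Q0 ys pQ0) => //.
- move=> j; apply: gen_by_gen; rewrite /other_index.
  by case: ifP => _; have := ltn_ord j; lia.
- by move=> i; exists (i : nat); [have := ltn_ord i; lia | apply: xi_init].
by move=> v b; apply: tower_prim Ez.
Qed.

(** Induction over the divisors q of m, with the power m / q of the new generator adjoined. For q =
    1 this power is a word in the earlier generators; a prime factor p of q accounts for one
    extraction of a p-th root. *)
Lemma tower_level k : (forall b, gen_by xi (d + k) b -> b.2 = 1%g -> b = 1%g) ->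
  forall b, gen_by xi (d + k.+1) b -> b.2 = 1%g -> b = 1%g.
Proof.
move=> inj_k; suff S q : (q %| m)%N -> forall b,
    gen_by (tower_gens (d + k) xi (xi (d + k)%N ^+ (m %/ q))%g) (d + k).+1 b ->
    b.2 = 1%g -> b = 1%g.
  move=> b Bb; apply: (S m (dvdnn m)); apply: gen_byS Bb => i; rewrite addnS ltnS.
  rewrite leq_eqVlt => /predU1P[->|]; last exact: tower_gens_lt.
  by rewrite divnn m_gt0; apply: tower_gens_last.
have [n] := ubnP q; elim: n q => // n IHn q ltq qm.
have q_gt0 : (0 < q)%N := dvdn_gt0 m_gt0 qm.
have [q1|q_neq1] := eqVneq q 1%N.
  move=> b Bb; apply: inj_k; apply: gen_by_tower Bb => [t lt_t|].
    exact: gen_by_gen.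
  rewrite q1 divn1 addnC xi_rel /shift_word /power_word.
  elim: L L_lt => [|le s IHs] s_lt; first by rewrite big_nil; apply: gen_1.
  rewrite big_cons; apply: gen_M.
    apply/gen_expgz/gen_by_gen. by rewrite ltn_add2l s_lt ?mem_head.
  by apply: IHs => le' le_s; apply: s_lt; rewrite inE le_s orbT.
have q_gt1 : (1 < q)%N by lia.
have pr_p := pdiv_prime q_gt1; set p := pdiv q in pr_p.
have /dvdnP[q' Eq] : (p %| q)%N := pdiv_dvd q.
have p_gt1 := prime_gt1 pr_p.
have q'_gt0 : (0 < q')%N by move: q_gt0; rewrite Eq muln_gt0 => /andP[].
have Em : (m %/ q * q = m)%N := divnK qm.
apply: (@tower_step k p q') => //.
- by apply: dvdn_trans qm; apply: pdiv_dvd.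
- by rewrite -expgnA -Eq Em addnC xi_rel.
have Ep : (m %/ q * p = m %/ q')%N.
  by rewrite -{2}Em Eq [(q' * p)%N]mulnC mulnA mulnK.
rewrite -expgnA Ep; apply: IHn; last first.
  by apply: dvdn_trans qm; rewrite Eq dvdn_mulr.
by rewrite -ltnS (leq_trans _ ltq) // ltnS Eq -{1}[q']muln1 ltn_pmul2l.
Qed.

Theorem tower_inj n b : gen_by xi n b -> b.2 = 1%g -> b = 1%g.
Proof.
move=> Bb; suff inj k : forall b, gen_by xi (d + k) b -> b.2 = 1%g -> b = 1%g.
  apply: (inj n); apply: gen_byS Bb => i lt_i; apply: gen_by_gen; lia.
elim: k => [|k IHk] {}b {}Bb; last exact: tower_level IHk b Bb.
by rewrite addn0 in Bb; apply: magnus_inj Bb.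
Qed.

End TowerInjective.

(** * Power series models *)

Lemma eq_shift_word (G : groupType) (x y : nat -> G) d i (L : seq (nat * int)) :
  (forall le, le \in L -> (le.1 < d)%N) -> (forall l, (l < d)%N -> x (i + l)%N = y (i + l)%N) ->
  shift_word x i L = shift_word y i L.
Proof.
move=> L_lt Exy; rewrite /shift_word /power_word; apply: eq_big_seq => le /L_lt lt_l.
by rewrite Exy.
Qed.

Lemma morph_shift_word (G H : groupType) (T : G -> H) (x : nat -> G) i L :
  {morph T : g h / (g * h)%g} -> T (shift_word x i L) = shift_word (T \o x) i L.
Proof.
move=> TM; rewrite /shift_word /power_word (morph_prod TM).
by apply: eq_bigr => le _; rewrite (morph_expgz TM).
Qed.

Section UnitMorphism.
Variables (K : numFieldType) (d d' : nat) (W : 'I_d -> ncps K d').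
Hypothesis sW : forall j, small 1 (W j).

Fact subst_unit_subproof (f : munit K d) : subst W (mval f) [::] == 1.
Proof. by rewrite subst_nil // munitP. Qed.
Definition subst_unit f : munit K d' := MUnit (subst_unit_subproof f).

Lemma subst_unitM : {morph subst_unit : f g / (f * g)%g}.
Proof. by move=> f g; apply/val_inj; rewrite /= substM. Qed.

End UnitMorphism.

Lemma sum_scale_invmx (K : fieldType) (V : lmodType K) d (Lam : 'M[K]_d) (F : 'I_d -> V) i :
  Lam \in unitmx -> \sum_j Lam i j *: (\sum_k invmx Lam j k *: F k) = F i.
Proof.
move=> Lam_unit; under eq_bigr do rewrite scaler_sumr.
have E k : \sum_j Lam i j *: (invmx Lam j k *: F k) = (i == k)%:R *: F k.
  under eq_bigr do rewrite scalerA.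
  rewrite -scaler_suml; congr (_ *: _).
  by have := congr1 (fun M : 'M_d => M i k) (mulmxV Lam_unit); rewrite !mxE.
rewrite exchange_big (bigD1 i) //= E eqxx scale1r big1 ?addr0 // => k nk.
by rewrite E eq_sym (negPf nk) scale0r.
Qed.

Section Model.
Variables (K : numFieldType) (d m : nat) (L : seq (nat * int)) (Lam : 'M[K]_d).
Hypotheses (d_gt0 : (0 < d)%N) (m_gt0 : (0 < m)%N) (Lam_unit : Lam \in unitmx).
Hypothesis L_lt : forall le, le \in L -> (le.1 < d)%N.

Fact lin_unit_subproof (u : 'I_d -> K) : (1 + lin u) [::] == 1.
Proof. by rewrite ncpsD ncps1 addr0. Qed.
Definition lin_unit u : munit K d := MUnit (lin_unit_subproof u).

(** The default 1 is never read, since L only involves indices below d. *)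
Definition model_low (i : nat) : munit K d :=
  if insub i is Some j then lin_unit (Lam j) else 1%g.

Fact model_top_subproof :
  ncps_root m (mval (shift_word model_low 0 L)) [::] == 1.
Proof. by have [-> _] := ncps_rootP m_gt0 (munitP (shift_word model_low 0 L)). Qed.
Definition model_top : munit K d := MUnit model_top_subproof.

Definition model_init i := if (i < d)%N then model_low i else model_top.

(** Chosen so that the linear form with coefficients [Lam i] is sent to X_(i+1) - 1; substitution
    then acts on the X_i as the shift. *)
Definition model_sub (j : 'I_d) : ncps K d :=
  \sum_(i < d) invmx Lam j i *: (mval (model_init i.+1) - 1).

Lemma small_model_sub j : small 1 (model_sub j).
Proof.
apply: small_sum => i _; apply/smallZ/small1.
by rewrite ncpsB munitP ncps1 subrr.
Qed.

Local Notation tau := (subst_unit small_model_sub).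

(** All X_i are images of X_0 under powers of the shift, so the relation at index 0, which holds by
    the choice of the m-th root, gives all the others. *)
Definition model i : munit K d := iter i tau (model_init 0).

Lemma model_init_lt (i : 'I_d) : mval (model_init i) = 1 + lin (Lam i).
Proof. by rewrite /model_init ltn_ord /model_low valK. Qed.

Lemma tau_init (i : 'I_d) : tau (model_init i) = model_init i.+1.
Proof.
apply/val_inj; rewrite /= model_init_lt substD ?subst1 ?subst_linE //;
  try exact: small_model_sub.
by rewrite sum_scale_invmx // addrC subrK.
Qed.

Lemma model_initE i : (i <= d)%N -> model i = model_init i.
Proof.
elim: i => // i IHi lt_i; rewrite /model iterS -/(model i) IHi ?(ltnW lt_i) //.
exact: (tau_init (Ordinal lt_i)).
Qed.

Lemma model_gen (i : 'I_d) : mval (model i) = 1 + lin (Lam i).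
Proof. by rewrite model_initE ?(ltnW (ltn_ord i)) // model_init_lt. Qed.

Lemma model_rel i : (model (i + d)%N ^+ m)%g = shift_word model i L.
Proof.
have rel0 : (model d ^+ m)%g = shift_word model 0 L.
  rewrite model_initE // /model_init ltnn; apply/val_inj; rewrite /= mvalX.
  have [_ ->] := ncps_rootP m_gt0 (munitP (shift_word model_low 0 L)).
  congr mval; apply: (eq_shift_word L_lt) => l lt_l.
  by rewrite add0n model_initE ?(ltnW lt_l) // /model_init lt_l.
elim: i => [|i IHi]; first exact: rel0.
rewrite addSn /model iterS -(morphX (subst_unitM _)) -/(model (i + d)) IHi.
by rewrite (morph_shift_word _ _ _ (subst_unitM _)).
Qed.

Lemma model_sub_lin j b :
  model_sub j [:: b] = \sum_(i < d) invmx Lam j i * mval (model i.+1) [:: b].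
Proof.
rewrite /model_sub ncps_sum; apply: eq_bigr => i _.
by rewrite ncpsZ ncpsB ncps1 subr0 model_initE // ltn_ord.
Qed.

End Model.

(* m-th roots in 1 + I are unique. *)
Lemma model_unique (K : numFieldType) d m L (x y : nat -> munit K d) :
  (0 < m)%N -> (forall le, le \in L -> (le.1 < d)%N) ->
  (forall i, (x (i + d)%N ^+ m)%g = shift_word x i L) ->
  (forall i, (y (i + d)%N ^+ m)%g = shift_word y i L) ->
  (forall i : 'I_d, x i = y i) -> forall i, x i = y i.
Proof.
move=> m_gt0 L_lt relx rely Exy i; have [n] := ubnP i; elim: n i => // n IHn i lt_i.
have [lt_d|le_d] := ltnP i d; first exact: (Exy (Ordinal lt_d)).
apply/val_inj/(ncps_root_inj m_gt0) => [||/=]; [exact: munitP|exact: munitP|].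
rewrite -!mvalX -(subnK le_d) relx rely; congr mval; apply: (eq_shift_word L_lt) => l lt_l.
by apply: IHn; lia.
Qed.

(** * The order on power series *)

Section Shortlex.
Variable d : nat.
Implicit Types u v w : seq 'I_d.

Fixpoint lexlt u v : bool :=
  match u, v with
  | a :: u', b :: v' => (a < b)%N || ((a == b) && lexlt u' v')
  | _, _ => false
  end.

Definition shortlex u v : bool :=
  (size u < size v)%N || ((size u == size v) && lexlt u v).

Lemma lexlt_total u v : size u = size v -> [|| lexlt u v, u == v | lexlt v u].
Proof.
elim: u v => [|a u IHu] [|b v] //= [/IHu]; rewrite eqseq_cons [b == a]eq_sym.
have [lt_ab|lt_ba|/val_inj->] := ltngtP a b => //=; first by rewrite !orbT.
by rewrite eqxx.
Qed.

Lemma shortlex_total u v : [|| shortlex u v, u == v | shortlex v u].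
Proof.
rewrite /shortlex [size v == _]eq_sym.
have [lt_uv|lt_vu|/lexlt_total//] := ltngtP (size u) (size v); first by [].
by rewrite /= !orbT.
Qed.

Lemma lexlt_trans : transitive lexlt.
Proof.
elim=> [|b v IHv] [|a u] [|c w] //= /orP[lt_ab|/andP[/eqP-> lt_uv]].
  by case/orP=> [/(ltn_trans lt_ab)->//|/andP[/eqP<- _]]; rewrite lt_ab.
by case/orP=> [->//|/andP[/eqP-> /(IHv _ _ lt_uv)->]]; rewrite eqxx orbT.
Qed.

Lemma shortlex_trans : transitive shortlex.
Proof.
move=> v u w /orP[lt_uv|/andP[/eqP Euv lt_uv]] /orP[lt_vw|/andP[/eqP Evw lt_vw]].
- by rewrite /shortlex (ltn_trans lt_uv).
- by rewrite /shortlex -Evw lt_uv.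
- by rewrite /shortlex Euv lt_vw.
by rewrite /shortlex Euv Evw eqxx (lexlt_trans lt_uv) ?orbT.
Qed.

Lemma lex_least n (P : seq 'I_d -> Prop) : (exists2 w, size w = n & P w) ->
  exists2 w, size w = n & P w /\ forall v, size v = n -> lexlt v w -> ~ P v.
Proof.
elim: n P => [|n IHn] P [w szw Pw].
  by exists w; rewrite // (size0nil szw) in Pw *; split=> // -[].
have exa : exists i, `[< exists a : 'I_d, a = i :> nat /\ exists2 v, size v = n & P (a :: v) >].
  case: w szw Pw => // a v [szv] Pv; exists a; apply/asboolP; exists a; split=> //.
  by exists v.
case: (ex_minnP exa) => _ /asboolP[a [<- exv]] min_a.
have [v szv [Pv min_v]] := IHn (fun v => P (a :: v)) exv.
exists (a :: v); first by rewrite /= szv.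
split=> // -[|b u] //= [szu] /orP[lt_ba|/andP[/eqP-> lt_uv]]; last exact: min_v.
move=> Pu; have := min_a b; rewrite leqNgt lt_ba => /(_ _)/negP[] //.
by apply/asboolP; exists b; split=> //; exists u.
Qed.

End Shortlex.

Section SeriesOrder.
Variables (K : realFieldType) (d : nat).
Local Notation A := (ncps K d).
Implicit Types (f g : A) (u v w : seq 'I_d).

Definition leads f w : Prop := forall v, shortlex v w -> f v = 0.
Definition spos f : Prop := exists2 w, 0 < f w & leads f w.

Lemma leads_small f w : leads f w -> small (size w) f.
Proof. by move=> lf v ltv; apply: lf; rewrite /shortlex ltv. Qed.

Lemma leading_word f : f != 0 -> exists2 w, f w != 0 & leads f w.
Proof.
move=> /ncps_low[w0 nz0 s0].
have [|w szw [nzw min_w]] := @lex_least d (size w0) (fun w => f w != 0).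
  by exists w0.
exists w => // v /orP[ltv|/andP[/eqP szv lt_vw]].
  by apply: s0; rewrite -szw.
by apply/eqP/negPn/negP; apply: min_w => //; rewrite szv.
Qed.

Lemma spos_total f : f != 0 -> spos f \/ spos (- f).
Proof.
move=> /leading_word[w nzw lw]; have [nw|pw|fw0] := ltgtP (f w) 0; last by rewrite fw0 eqxx in nzw.
  by right; exists w; [rewrite ncpsN oppr_gt0 | move=> v /lw; rewrite ncpsN => ->; rewrite oppr0].
by left; exists w.
Qed.

Lemma spos0 : ~ spos 0.
Proof. by case=> w; rewrite ncps0 ltxx. Qed.

Lemma sposD f g : spos f -> spos g -> spos (f + g).
Proof.
move=> [w pw lw] [v pv lv]; case/or3P: (shortlex_total w v) => [lt_wv|/eqP Ewv|lt_vw].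
- exists w; first by rewrite ncpsD (lv _ lt_wv) addr0.
  by move=> u ltu; rewrite ncpsD lw // lv ?addr0 // (shortlex_trans ltu).
- exists w; first by rewrite ncpsD addr_gt0 // Ewv.
  by move=> u ltu; rewrite ncpsD lw // lv ?addr0 // -Ewv.
exists v; first by rewrite ncpsD (lw _ lt_vw) add0r.
by move=> u ltu; rewrite ncpsD lv // lw ?addr0 // (shortlex_trans ltu).
Qed.

(** A factor with constant term 1 leaves the coefficients of lowest degree unchanged; this makes the
    order bi-invariant. *)
Lemma leads_mulr f g w v : g [::] = 1 -> leads f w -> (size v <= size w)%N ->
  (f * g) v = f v.
Proof.
move=> g1 lf lev; rewrite ncpsM big_ord_recr /= take_size drop_size g1 mulr1.
rewrite big1 ?add0r // => i _; rewrite (leads_small lf) ?mul0r //.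
by rewrite size_take_min gtn_min (leq_trans (ltn_ord i)).
Qed.

Lemma leads_mull f g w v : g [::] = 1 -> leads f w -> (size v <= size w)%N ->
  (g * f) v = f v.
Proof.
move=> g1 lf lev; rewrite ncpsM big_ord_recl /= take0 drop0 g1 mul1r.
rewrite big1 ?addr0 // => i _; rewrite [f _](leads_small lf) ?mulr0 //.
by rewrite size_drop /= /bump /=; have := ltn_ord i; move: lev; lia.
Qed.

Lemma shortlex_size u v : shortlex u v -> (size u <= size v)%N.
Proof. by case/orP=> [/ltnW|/andP[/eqP->]]. Qed.

Lemma spos_mulr f g : g [::] = 1 -> spos f -> spos (f * g).
Proof.
move=> g1 [w pw lw]; exists w; first by rewrite (leads_mulr g1 lw).
by move=> v ltv; rewrite (leads_mulr g1 lw) ?shortlex_size // lw.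
Qed.

Lemma spos_mull f g : g [::] = 1 -> spos f -> spos (g * f).
Proof.
move=> g1 [w pw lw]; exists w; first by rewrite (leads_mull g1 lw).
by move=> v ltv; rewrite (leads_mull g1 lw) ?shortlex_size // lw.
Qed.

Variables (W : 'I_d -> A) (mu : 'I_d -> K).
Hypotheses (sW : forall j, small 1 (W j)) (mu_gt0 : forall j, 0 < mu j).
Hypothesis W_diag : forall j, W j [:: j] = mu j.
Hypothesis W_trig : forall j b : 'I_d, (b < j)%N -> W j [:: b] = 0.

(* Triangularity makes the leading word survive, with its coefficient multiplied
   by a product of diagonal entries. *)
Lemma subst_leads f w : leads f w ->
  leads (subst W f) w /\ subst W f w = (\prod_(j <- w) mu j) * f w.
Proof.
elim: w f => [|a w IHw] f lf.
  split; last by rewrite big_nil mul1r subst_nil.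
  by move=> v; rewrite /shortlex ltn0 /=; case: v.
have f0 : f [::] = 0 by apply: lf.
have sd j : small (size w) (lder j f) by move=> v ltv; apply: lf; rewrite /shortlex /= ltnS ltv.
have ssub g n : small n g -> small n (subst W g).
  elim: n g => // n IHn g sg; rewrite (substE sW) sg // scale0r add0r.
  apply: small_sum => j _; rewrite -add1n; apply: smallM; first exact: sW.
  by apply: IHn => v ltv; apply: sg.
have E b u : (size u <= size w)%N ->
    subst W f (b :: u) = \sum_(j < d) W j [:: b] * subst W (lder j f) u.
  move=> leu; rewrite {1}(substE sW) f0 scale0r add0r ncps_sum; apply: eq_bigr => j _.
  move: leu; rewrite leq_eqVlt => /predU1P[szu|ltu].
    exact: (low_mul_l _ szu (ssub _ _ (sd j)) (sW j)).
  rewrite [X in _ = _ * X](ssub _ _ (sd j) _ ltu) mulr0.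
  by apply: (smallM (sW j) (ssub _ _ (sd j))); rewrite add1n ltnS.
(* A letter j before a starts no word of the lowest length in f, so in that length only letters from
   a on contribute. *)
have ld (j : 'I_d) : (j < a)%N -> forall u, size u = size w -> subst W (lder j f) u = 0.
  move=> lt_ja u szu; apply: (ssub _ (size w).+1 _ u); last by rewrite szu.
  move=> v; rewrite ltnS leq_eqVlt => /predU1P[szv|/sd//].
  by apply: lf; rewrite /shortlex /= szv eqxx lt_ja orbT.
have la : leads (lder a f) w.
  by move=> v ltv; apply: lf; move: ltv; rewrite /shortlex /= ltnS eqSS ltnn eqxx.
have [lta Ea] := IHw _ la.
split=> [[|b u]|].
- by move=> _; rewrite subst_nil.
- rewrite /shortlex /= ltnS eqSS => /orP[ltu|/andP[/eqP szu ltbu]].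
    rewrite E ?(ltnW ltu) // big1 // => j _.
    by rewrite [subst _ _ _](ssub _ _ (sd j)) ?mulr0.
  rewrite E ?szu // big1 // => j _.
  have [lt_bj|lt_jb|Ebj] := ltngtP b j; first by rewrite W_trig ?mul0r.
    rewrite [subst _ _ _]ld ?mulr0 //.
    by case/orP: ltbu => [lt_ba|/andP[/eqP<- _]] //; apply: ltn_trans lt_ba.
  move/val_inj: Ebj => Ebj; case/orP: ltbu => [lt_ba|/andP[/eqP Eba ltu]].
    by rewrite [subst _ _ _]ld ?mulr0 // -Ebj.
  by rewrite -Ebj Eba lta ?mulr0 // /shortlex szu eqxx ltu orbT.
rewrite E // (bigD1 a) //= W_diag Ea big_cons -mulrA -[RHS]addr0; congr (_ + _).
apply: big1 => j nja; have [lt_aj|lt_ja|/val_inj Eaj] := ltngtP a j.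
- by rewrite W_trig ?mul0r.
- by rewrite [subst _ _ _]ld ?mulr0.
by rewrite Eaj eqxx in nja.
Qed.

Lemma spos_subst f : spos f -> spos (subst W f).
Proof.
move=> [w pw lw]; have [lsw Esw] := subst_leads lw; exists w => //.
rewrite Esw mulr_gt0 // {pw lw lsw Esw}; elim: w => [|j w IHw].
  by rewrite big_nil ltr01.
by rewrite big_cons mulr_gt0.
Qed.

End SeriesOrder.

Section UnitOrder.
Variables (K : realFieldType) (d : nat).
Implicit Types f g : munit K d.

Definition upos f : Prop := spos (mval f - 1).

Lemma upos1 : ~ upos 1%g.
Proof. by rewrite /upos mval1 subrr; apply: spos0. Qed.

Lemma uposM f g : upos f -> upos g -> upos (f * g)%g.
Proof.
move=> pf pg; rewrite /upos mvalM (_ : _ - 1 = (mval f - 1) * mval g + (mval g - 1)).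
  by apply: sposD => //; apply: spos_mulr => //; apply: munitP.
by rewrite mulrBl mul1r addrA subrK.
Qed.

Lemma uposJ f g : upos f -> upos (f ^ g)%g.
Proof.
move=> pf; rewrite conjgE /upos !mvalM.
rewrite (_ : _ - 1 = mval (g^-1)%g * ((mval f - 1) * mval g)).
  by apply: spos_mull; [apply: munitP | apply: spos_mulr => //; apply: munitP].
by move: (mvalVl g); move: (mval g^-1%g) => h hg; rewrite mulrBl mul1r mulrBr hg.
Qed.

Lemma upos_total f : f != 1%g -> upos f \/ upos (f^-1)%g.
Proof.
move=> nf1; have : mval f - 1 != 0.
  by rewrite subr_eq0; apply: contraNneq nf1 => f1; apply/eqP/val_inj.
move=> /spos_total[pf|nf]; [by left | right].
rewrite /upos (_ : _ - 1 = - (mval f - 1) * mval (f^-1)%g).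
  by apply: spos_mulr => //; apply: munitP.
by rewrite opprB mulrBl mul1r mvalV.
Qed.

End UnitOrder.

(** * Newton bases *)

Section NewtonBasis.
Variables (K : comNzRingType) (n : nat) (mu : 'I_n.+1 -> K).
Local Notation d := n.+1.

(** Multiplication by X modulo the product of all X - mu j, in the Newton basis formed by the
    partial products. Unlike a basis of eigenvectors, it exists for repeated roots too. *)
Definition newton_mx : 'M[K]_d :=
  \matrix_(i, j) (if i == j then mu i else (i.+1 == j :> nat)%:R).

(** For k = d the row is 0, in accordance with the full product being 0 in the quotient. *)
Definition newton_row (k : nat) : 'rV[K]_d := \row_j (j == k :> nat)%:R.

(** The coordinates of 1, X, ..., X^n in the Newton basis; the matrix is unitriangular whatever the
    roots are. *)
Definition krylov_mx : 'M[K]_d := \matrix_(i < d) (newton_row 0 *m newton_mx ^+ i).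

Lemma mul_newton_row (k : 'I_d) :
  newton_row k *m newton_mx = mu k *: newton_row k + newton_row k.+1.
Proof.
apply/rowP=> j; rewrite !mxE (bigD1 k) //= !mxE eqxx mul1r big1 ?addr0 => [|i nik].
  have [->|nkj] := eqVneq k j; first by rewrite eqxx mulr1 eq_sym gtn_eqF ?ltnSn ?addr0.
  by rewrite -val_eqE /= in nkj; rewrite [j == k :> nat]eq_sym (negPf nkj) mulr0 add0r eq_sym.
by rewrite !mxE (negPf (nik : i != k :> nat)) mul0r.
Qed.

Lemma newton_row_horner (k : nat) : (k <= d)%N ->
  newton_row 0 *m horner_mx newton_mx (\prod_(j < d | (j < k)%N) ('X - (mu j)%:P)) =
  newton_row k.
Proof.
elim: k => [_|k IHk lt_kd]; first by rewrite big_pred0 // rmorph1 mulmx1.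
rewrite (bigD1 (Ordinal lt_kd)) ?ltnSn //= mulrC rmorphM.
rewrite (eq_bigl (fun j : 'I_d => (j < k)%N)) => [|j]; last first.
  by rewrite -val_eqE /= ltnS [in RHS]ltn_neqAle andbC.
rewrite [_ * _]/(_ *m _) mulmxA IHk ?(ltnW lt_kd) //.
rewrite rmorphB /= horner_mx_X horner_mx_C mulmxBr mul_mx_scalar.
by rewrite (mul_newton_row (Ordinal lt_kd)) /= addrC addKr.
Qed.

Lemma krylov_row_trig i (j : 'I_d) : (i <= j)%N ->
  (newton_row 0 *m newton_mx ^+ i) 0 j = (i == j)%:R.
Proof.
elim: i j => [|i IHi] j le_ij; first by rewrite expr0 mulmx1 mxE eq_sym.
have lt_i : (i < d)%N := ltn_trans le_ij (ltn_ord j).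
rewrite exprSr [_ * _]/(_ *m _) mulmxA mxE.
rewrite (bigID (fun k : 'I_d => (i <= k)%N)) /= [X in _ + X]big1 ?addr0 => [|k]; last first.
  rewrite -ltnNge => lt_ki; rewrite [newton_mx k j]mxE -val_eqE /= !ltn_eqF ?mulr0 //;
    by move: lt_ki le_ij; clear; lia.
rewrite (bigD1 (Ordinal lt_i)) //= IHi //= eqxx mul1r big1 ?addr0 => [|k /andP[le_ik nki]].
  by rewrite [newton_mx _ _]mxE -val_eqE /= ltn_eqF.
by rewrite IHi // eq_sym (negPf (nki : k != i :> nat)) mul0r.
Qed.

End NewtonBasis.

Lemma krylov_unit (K : comUnitRingType) n (mu : 'I_n.+1 -> K) : krylov_mx mu \in unitmx.
Proof.
rewrite unitmxE det_trig; last first.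
  by apply/is_trig_mxP => i j lt_ij; rewrite mxE krylov_row_trig ?(ltnW lt_ij) // ltn_eqF.
by rewrite big1 ?unitr1 // => i _; rewrite mxE krylov_row_trig // eqxx.
Qed.

(** * The model whose shift is triangular with positive diagonal *)

Section PositiveModel.
Variables (K : realFieldType) (n m : nat) (L : seq (nat * int)) (mu : 'I_n.+1 -> K).
Local Notation d := n.+1.
Hypotheses (m_gt0 : (0 < m)%N) (L_lt : forall le, le \in L -> (le.1 < d)%N).
Hypothesis muE : m%:R *: 'X^d - \sum_(l < d) (exponent_sum L l)%:~R *: 'X^l =
  m%:R *: \prod_(j < d) ('X - (mu j)%:P).
Local Notation Lam := (krylov_mx mu).
Local Notation model := (model L Lam m_gt0).

Lemma newton_char_relation :
  m%:R *: (newton_row K n 0 *m newton_mx mu ^+ d) =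
  \sum_(l < d) (exponent_sum L l)%:~R *: (newton_row K n 0 *m newton_mx mu ^+ l).
Proof.
apply/eqP; rewrite -subr_eq0; apply/eqP.
have := congr1 (fun p => newton_row K n 0 *m horner_mx (newton_mx mu) p) muE.
rewrite /= linearB /= linearZ /= rmorphXn /= horner_mx_X linear_sum /= mulmxBr mulmx_sumr.
rewrite -scalemxAr linearZ /= -scalemxAr.
have -> : \prod_(j < d) ('X - (mu j)%:P) = \prod_(j < d | (j < d)%N) ('X - (mu j)%:P).
  by apply: eq_bigl => j; rewrite ltn_ord.
rewrite newton_row_horner // [newton_row _ _ d](_ : _ = 0); last first.
  by apply/rowP=> j; rewrite !mxE ltn_eqF.
rewrite scaler0 => rel0; rewrite -[RHS]rel0; congr (_ - _); apply: eq_bigr => l _.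
by rewrite linearZ /= rmorphXn /= horner_mx_X -scalemxAr.
Qed.

(** For i < d this is the definition of the model. For i = d the linear part of the m-th root obeys
    the recursion that [newton_char_relation] gives for the rows. *)
Lemma newton_model_lin i b : (i <= d)%N ->
  mval (model i) [:: b] = (newton_row K n 0 *m newton_mx mu ^+ i) 0 b.
Proof.
pose chi (f : munit K d) := mval f [:: b].
have gen_lin (j : 'I_d) : chi (model j) = (newton_row K n 0 *m newton_mx mu ^+ j) 0 b.
  by rewrite /chi model_gen ?krylov_unit // ncpsD ncps1 add0r /lin mxE.
rewrite leq_eqVlt => /predU1P[->|lt_id]; last exact: (gen_lin (Ordinal lt_id)).
have chiM f g : chi (f * g)%g = chi f + chi g.
  by rewrite /chi mvalM ncpsM !big_ord_recl big_ord0 /= !munitP mul1r mulr1 addr0 addrC.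
have chiX f k : chi (f ^+ k)%g = chi f *+ k.
  by elim: k => [|k IHk]; rewrite ?expgS ?chiM ?IHk ?mulrS // /chi mval1 ncps1.
have chiP : character (gen_subgroup (fun _ => True)) (fun x : K => x = 0) chi.
  split=> // [x y -> ->|f g _ _]; first by rewrite subrr.
  by rewrite chiM [chi f + _]addrC addrK subrr.
have /eqP := shift_word_char L_lt chiP (fun l _ => gen_in (G := munit K d) (P := fun _ => True) (g := model (0 + l)%N) I).
rewrite -(model_rel m_gt0 (krylov_unit mu) L_lt) chiX add0n subr_eq0 => /eqP Echi.
have /eqP := congr1 (fun u : 'rV_d => u 0 b) newton_char_relation.
rewrite mxE summxE => /eqP Erow.
have m_neq0 : m%:R != 0 :> K by rewrite pnatr_eq0 -lt0n.
apply: (mulfI m_neq0); rewrite Erow mulr_natl -/(chi _) Echi; apply: eq_bigr => l _.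
by rewrite add0n gen_lin -mulrzl [RHS]mxE.
Qed.

(** The linear part of the shift is Lam^-1 (Lam N) = N, with N the Newton matrix. *)
Lemma newton_model_sub j b : model_sub L Lam m_gt0 j [:: b] = newton_mx mu j b.
Proof.
rewrite model_sub_lin ?krylov_unit //.
rewrite -[newton_mx mu in RHS]mul1mx -(mulVmx (krylov_unit mu)) -mulmxA [RHS]mxE.
apply: eq_bigr => i _; rewrite newton_model_lin //; congr (_ * _).
rewrite exprSr [_ * newton_mx mu]/(_ *m _) mulmxA !mxE; apply: eq_bigr => k _.
by rewrite [Lam i k]mxE.
Qed.

Hypothesis mu_gt0 : forall j, 0 < mu j.

Lemma upos_model_shift f : upos f -> upos (subst_unit (small_model_sub L Lam m_gt0) f).
Proof.
move=> pf; rewrite /upos /= -(subst1 (small_model_sub L Lam m_gt0)) -substB; last exact: small_model_sub.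
apply: (spos_subst (small_model_sub L Lam m_gt0) mu_gt0) pf => [j|j b lt_bj].
  by rewrite newton_model_sub mxE eqxx.
by rewrite newton_model_sub mxE -val_eqE /= gtn_eqF // gtn_eqF ?leqW.
Qed.

End PositiveModel.

Lemma positive_roots (R : rcfType) n (p : {poly int}) : size p = n.+1 ->
  (forall z : R[i], root (map_poly intr p) z -> exists2 y : R, 0 < y & z = y%:C%C) ->
  exists2 mu : 'I_n -> R, forall j, 0 < mu j &
    map_poly intr p = (lead_coef p)%:~R *: \prod_(j < n) ('X - (mu j)%:P).
Proof.
move=> szp rootp; set q : {poly R[i]} := map_poly intr p in rootp *.
have lead_q : lead_coef q = (lead_coef p)%:~R by rewrite lead_coef_map_inj //; apply: intr_inj.
have nz_lead : lead_coef q != 0 by rewrite lead_q intr_eq0 lead_coef_eq0 -size_poly_eq0 szp.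
have [rs Eq] := closed_field_poly_normal q.
have sz_rs : size rs = n.
  have := congr1 (size \o @polyseq _) Eq.
  rewrite /= size_scale // size_prod_XsubC size_map_inj_poly ?szp; [by case|exact: intr_inj|by []].
have pos_rs j : (j < n)%N -> exists2 y : R, 0 < y & nth 0 rs j = y%:C%C.
  move=> lt_jn; apply: rootp; rewrite Eq rootZ // root_prod_XsubC.
  by rewrite mem_nth ?sz_rs.
pose mu (j : 'I_n) : R := complex.Re (nth 0 rs j).
have muE (j : 'I_n) : (mu j)%:C%C = nth 0 rs j.
  by rewrite /mu; have [y _ ->] := pos_rs j (ltn_ord j).
exists mu => [j|]; first by rewrite /mu; have [y y_gt0 ->] := pos_rs j (ltn_ord j).
apply: (map_poly_inj (real_complex R)).
rewrite -map_poly_comp (eq_map_poly (g := intr)) => [|z /=]; last by rewrite rmorph_int.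
rewrite -/q Eq lead_q linearZ /= rmorph_int rmorph_prod /=; congr (_ *: _).
rewrite (big_nth 0) sz_rs big_mkord; apply: eq_bigr => j _.
by rewrite rmorphB /= map_polyX map_polyC /= -muE.
Qed.

(** * Words in x and t *)

Section FreeGroupEval.
Variable T : choiceType.
Implicit Types u v : fgroup T.

Lemma fgroup_ind (P : fgroup T -> Prop) : P 1%g ->
  (forall a u, P u -> P (fg_gen a * u)%g) ->
  (forall a u, P u -> P ((fg_gen a)^-1 * u)%g) -> forall u, P u.
Proof.
move=> P1 Pg PV [s rs]; elim: s rs => [|[a b] s IHs] rs.
  by rewrite (_ : FGroup rs = 1%g) //; apply/val_inj.
have rs' : reduced s := path_sorted rs.
have Ep : push (a, b) s = (a, b) :: s.
  by case: s rs {IHs rs'} => //= c s /andP[/negPf->].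
case: b rs Ep => rs Ep.
  rewrite (_ : FGroup rs = (fg_gen a * FGroup rs')%g); first exact/Pg/IHs.
  by apply/val_inj; rewrite /= Ep.
rewrite (_ : FGroup rs = ((fg_gen a)^-1 * FGroup rs')%g); first exact/PV/IHs.
by apply/val_inj; rewrite /= Ep.
Qed.

Variables (W : groupType) (g : T -> W).

Definition letter_eval (a : T * bool) : W := if a.2 then g a.1 else (g a.1)^-1%g.
Definition fg_eval u : W := (\prod_(a <- u : seq _) letter_eval a)%g.

Lemma eval_push a s :
  (\prod_(b <- push a s) letter_eval b = letter_eval a * \prod_(b <- s) letter_eval b)%g.
Proof.
case: s => [|b s] /=; first by rewrite big_seq1 big_nil mulg1.
case: eqP => [->|_]; last by rewrite big_cons.
rewrite big_cons mulgA; case: a => a [] /=; rewrite /letter_eval /=.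
  by rewrite mulgV mul1g.
by rewrite mulVg mul1g.
Qed.

Lemma fg_evalM : {morph fg_eval : u v / (u * v)%g}.
Proof.
move=> u v; rewrite /fg_eval /=; elim: (fgword u) => [|a s IHs] /=.
  by rewrite big_nil mul1g.
by rewrite eval_push IHs big_cons mulgA.
Qed.

Lemma fg_eval_gen a : fg_eval (fg_gen a) = g a.
Proof. by rewrite /fg_eval /= big_seq1. Qed.

End FreeGroupEval.

Lemma F2_ind (P : F2 -> Prop) : P x_ -> P t_ ->
  (forall f g, P f -> P g -> P (f * g)%g) -> (forall f, P f -> P f^-1%g) -> forall f, P f.
Proof.
move=> Px Pt PM PV; have Pg (a : bool) : P (fg_gen a) by case: a.
apply: fgroup_ind => [|a u Pu|a u Pu]; first by rewrite -(mulgV x_); apply/PM/PV.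
  exact: PM.
exact/PM/Pu/PV.
Qed.

(** The unrestricted wreath product of H with the integers. Letting t act by translation evaluates
    all translates of a word in the conjugates of x at once. *)
Definition wreath (H : groupType) : Type := ((int -> H) * int)%type.

Section Wreath.
Variable H : groupType.
Implicit Types u v : wreath H.

HB.instance Definition _ := Choice.on (wreath H).

Definition wreath_one : wreath H := (fun=> 1%g, 0).
Definition wreath_inv u : wreath H := (fun i => (u.1 (i + u.2))^-1%g, - u.2).
Definition wreath_mul u v : wreath H := (fun i => (u.1 i * v.1 (i - u.2))%g, u.2 + v.2).

Fact wreath_mulA : associative wreath_mul.
Proof.
move=> u v w; rewrite /wreath_mul /=; congr (_, _); last by rewrite addrA.
by apply/funext => i; rewrite mulgA opprD addrA.
Qed.

Fact wreath_mul1 : left_id wreath_one wreath_mul.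
Proof.
case=> f a; rewrite /wreath_mul /=; congr (_, _); last by rewrite add0r.
by apply/funext => i; rewrite mul1g subr0.
Qed.

Fact wreath_mulr1 : right_id wreath_one wreath_mul.
Proof.
case=> f a; rewrite /wreath_mul /=; congr (_, _); last by rewrite addr0.
by apply/funext => i; rewrite mulg1.
Qed.

Fact wreath_mulV : left_inverse wreath_one wreath_inv wreath_mul.
Proof.
case=> f a; rewrite /wreath_mul /=; congr (_, _); last by rewrite addNr.
by apply/funext => i; rewrite opprK mulVg.
Qed.

Fact wreath_mulVr : right_inverse wreath_one wreath_inv wreath_mul.
Proof.
case=> f a; rewrite /wreath_mul /=; congr (_, _); last by rewrite addrN.
by apply/funext => i; rewrite subrK mulgV.
Qed.

HB.instance Definition _ := isGroup.Build (wreath H)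
  wreath_mulA wreath_mul1 wreath_mulr1 wreath_mulV wreath_mulVr.

Definition wreath_eval (X : int -> H) : F2 -> wreath H :=
  @fg_eval bool (wreath H) (fun b => if b then (fun=> 1%g, 1) else (X, 0)).

End Wreath.

(** The family chosen here does not influence the second component; see [wreath_eval_deg]. *)
Definition tdeg (f : F2) : int := (wreath_eval (fun=> x_) f).2.

(* Rewriting t^-i f t^(i - tdeg f) as a word in the conjugates x^(t^j) and
   substituting X j for x^(t^j). *)
Definition ev (H : groupType) (X : int -> H) (f : F2) (i : int) : H :=
  (wreath_eval X f).1 i.

Section Eval.
Variables (H : groupType) (X : int -> H).
Implicit Types f g : F2.

Lemma tdegM f g : tdeg (f * g)%g = tdeg f + tdeg g.
Proof. by rewrite /tdeg /wreath_eval fg_evalM. Qed.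

Lemma tdegV f : tdeg f^-1%g = - tdeg f.
Proof. by rewrite /tdeg /wreath_eval (morphV (@fg_evalM _ _ _)). Qed.

Lemma tdeg_x : tdeg x_ = 0.
Proof. by rewrite /tdeg /wreath_eval fg_eval_gen. Qed.

Lemma tdeg_t : tdeg t_ = 1.
Proof. by rewrite /tdeg /wreath_eval fg_eval_gen. Qed.

Lemma wreath_eval_deg f : (wreath_eval X f).2 = tdeg f.
Proof.
elim/F2_ind: f => [||f g Ef Eg|f Ef]; rewrite ?tdeg_x ?tdeg_t ?tdegM ?tdegV.
- by rewrite /wreath_eval fg_eval_gen.
- by rewrite /wreath_eval fg_eval_gen.
- by rewrite /wreath_eval fg_evalM -Ef -Eg.
by rewrite /wreath_eval (morphV (@fg_evalM _ _ _)) -Ef.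
Qed.

Lemma evM f g i : ev X (f * g)%g i = (ev X f i * ev X g (i - tdeg f))%g.
Proof. by rewrite /ev -wreath_eval_deg /wreath_eval fg_evalM. Qed.

Lemma evV f i : ev X f^-1%g i = (ev X f (i + tdeg f))^-1%g.
Proof. by rewrite /ev -wreath_eval_deg /wreath_eval (morphV (@fg_evalM _ _ _)). Qed.

Lemma ev_x i : ev X x_ i = X i.
Proof. by rewrite /ev /wreath_eval fg_eval_gen. Qed.

Lemma ev_t i : ev X t_ i = 1%g.
Proof. by rewrite /ev /wreath_eval fg_eval_gen. Qed.

Lemma tdeg1 : tdeg 1%g = 0.
Proof. by rewrite -(mulgV x_) tdegM tdegV subrr. Qed.

Lemma ev1 i : ev X 1%g i = 1%g.
Proof. by rewrite -(mulgV x_) evM evV tdeg_x subr0 addr0 mulgV. Qed.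

Lemma tdegJ f g : tdeg (f ^ g)%g = tdeg f.
Proof. by rewrite conjgE !tdegM tdegV; lia. Qed.

Lemma evJ f g i : tdeg f = 0 ->
  ev X (f ^ g)%g i = (ev X f (i + tdeg g) ^ ev X g (i + tdeg g))%g.
Proof. by move=> f0; rewrite !conjgE !evM evV tdegV opprK f0 subr0. Qed.

End Eval.

Arguments ev [H] X f i : simpl never.
Arguments tdeg f : simpl never.

Lemma ev_morph (H H' : groupType) (T : H -> H') (X : int -> H) f i :
  {morph T : g h / (g * h)%g} -> T (ev X f i) = ev (T \o X) f i.
Proof.
move=> TM; elim/F2_ind: f i => [||f g Ef Eg|f Ef] i.
- by rewrite !ev_x.
- by rewrite !ev_t (morph1 TM).
- by rewrite !evM TM Ef Eg.
by rewrite !evV (morphV TM) Ef.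
Qed.

Lemma ev_shift (H : groupType) (X : int -> H) k f i :
  ev (fun j => X (j + k)) f i = ev X f (i + k).
Proof.
elim/F2_ind: f i => [||f g Ef Eg|f Ef] i; first by rewrite !ev_x.
- by rewrite !ev_t.
- by rewrite !evM Ef Eg addrAC.
by rewrite !evV Ef addrAC.
Qed.

Lemma ev_gen (H : groupType) (x : nat -> H) f i :
  exists n, gen_by x n (ev (fun j => x `|j|%N) f i).
Proof.
elim/F2_ind: f i => [||f g Ef Eg|f Ef] i.
- by exists `|i|.+1%N; rewrite ev_x; apply: gen_in; exists `|i|%N.
- by exists 0%N; rewrite ev_t; apply: gen_1.
- have [n1 gf] := Ef i; have [n2 gg] := Eg (i - tdeg f); exists (maxn n1 n2).
  have gen_le n n' h : (n <= n')%N -> gen_by x n h -> gen_by x n' h.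
    move=> le_n; apply: gen_byS => j lt_j; apply: gen_by_gen; exact: leq_trans le_n.
  rewrite evM; apply: gen_M.
    exact: gen_le (leq_maxl _ _) gf.
  exact: gen_le (leq_maxr _ _) gg.
by have [n gf] := Ef (i + tdeg f); exists n; rewrite evV; apply: gen_V.
Qed.

Lemma ev_conj (G : groupType) (phi : F2 -> G) f i : {morph phi : u v / (u * v)%g} ->
  phi f = (expgz (phi t_) i * ev (fun j => phi x_ ^ expgz (phi t_) j)%g f i *
           expgz (phi t_) (tdeg f - i))%g.
Proof.
move=> phiM; elim/F2_ind: f i => [||f g Ef Eg|f Ef] i.
- by rewrite ev_x tdeg_x sub0r expgzN conjgE !mulgA mulgV mul1g mulgK.
- by rewrite ev_t tdeg_t mulg1 -expgzD addrC subrK expgz1.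
- rewrite phiM (Ef i) (Eg (i - tdeg f)) evM tdegM -!mulgA; congr (_ * (_ * _))%g.
  rewrite mulgA -expgzD [tdeg f - i + _](_ : _ = 0) ?mul1g; last by ring.
  by congr (_ * expgz _ _)%g; ring.
rewrite (morphV phiM) (Ef (i + tdeg f)) evV tdegV !invgM -!expgzN !mulgA.
by congr (expgz _ _ * _ * expgz _ _)%g; ring.
Qed.

(** A model has indices i >= 0 only. Translated far enough to the right, a given word meets no
    negative index. *)
Definition eventually (P : int -> Prop) := exists i0, forall i, i0 <= i -> P i.

Lemma eventually_and P Q :
  eventually P -> eventually Q -> eventually (fun i => P i /\ Q i).
Proof.
move=> [i1 P1] [i2 P2]; exists (Num.max i1 i2) => i.
by rewrite ge_max => /andP[/P1 ? /P2].
Qed.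

Lemma eventually_shift P k : eventually P -> eventually (fun i => P (i + k)).
Proof. by move=> [i0 Pi0]; exists (i0 - k) => i le_i; apply: Pi0; rewrite -lerBlDr. Qed.

Lemma eventually_impl (P Q : int -> Prop) :
  (forall i, P i -> Q i) -> eventually P -> eventually Q.
Proof. by move=> PQ [i0 Pi0]; exists i0 => i /Pi0/PQ. Qed.

Lemma ev_eventually (H : groupType) (X Y : int -> H) f :
  (forall i, 0 <= i -> X i = Y i) -> eventually (fun i => ev X f i = ev Y f i).
Proof.
move=> XY; elim/F2_ind: f => [||f g Ef Eg|f Ef].
- by exists 0 => i /XY; rewrite !ev_x.
- by exists 0 => i _; rewrite !ev_t.
- apply: eventually_impl (eventually_and Ef (eventually_shift (- tdeg f) Eg)) => i [Efi Egi].
  by rewrite !evM Efi Egi.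
by apply: eventually_impl (eventually_shift (tdeg f) Ef) => i Efi; rewrite !evV Efi.
Qed.

Lemma ev_normal_closure (H : groupType) (X : int -> H) (w f : F2) :
  tdeg w = 0 -> eventually (fun i => ev X w i = 1%g) ->
  normal_closure (fun u => u = w) f -> tdeg f = 0 /\ eventually (fun i => ev X f i = 1%g).
Proof.
move=> w0 w1; elim=> [_ [_ [h [-> ->]]]||g h _ [g0 g1] _ [h0 h1]|g _ [g0 g1]].
- rewrite tdegJ; split=> //; apply: eventually_impl (eventually_shift (tdeg h) w1) => i wi.
  by rewrite evJ // wi conj1g.
- by split; [apply: tdeg1 | exists 0 => i _; apply: ev1].
- rewrite tdegM g0 h0 addr0; split=> //; apply: eventually_impl (eventually_and g1 h1).
  by move=> i [gi hi]; rewrite evM g0 subr0 gi hi mulg1.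
rewrite tdegV g0 oppr0; split=> //; apply: eventually_impl g1 => i gi.
by rewrite evV g0 addr0 gi invg1.
Qed.

(** * The order on the group *)

Section BaseChange.
Variables (K F : numFieldType) (phi : {rmorphism K -> F}) (d : nat).

Fact munit_map_subproof (f : munit K d) : ncps_map phi (mval f) [::] == 1.
Proof. by rewrite /ncps_map munitP rmorph1. Qed.
Definition munit_map f : munit F d := MUnit (munit_map_subproof f).

Lemma munit_mapM : {morph munit_map : f g / (f * g)%g}.
Proof. by move=> f g; apply/val_inj; rewrite /= ncps_mapM. Qed.

Lemma munit_map_eq1 f : munit_map f = 1%g -> f = 1%g.
Proof.
move=> f1; apply/val_inj/(@ncps_map_inj _ _ _ phi); rewrite -[LHS]/(mval (munit_map f)) f1.
by apply/funext => w; rewrite /ncps_map mval1 -[\val _]/(1 : ncps K d) !ncps1 rmorph_nat.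
Qed.

(** Injectivity is proved over the rationals in the standard coordinates, whereas the order lives
    over the reals in Newton coordinates. A linear change of variables relates the two models on the
    first d terms, hence everywhere by [model_unique]. *)
Lemma model_transfer m L (Lam : 'M[F]_d) (m_gt0 : (0 < m)%N) :
    Lam \in unitmx -> (forall le, le \in L -> (le.1 < d)%N) ->
  exists T : munit F d -> munit F d, {morph T : f g / (f * g)%g} /\
    forall i, T (model L Lam m_gt0 i) = munit_map (model L 1%:M m_gt0 i).
Proof.
move=> Lam_unit L_lt.
pose V (i : 'I_d) : ncps F d := lin (fun k => (i == k)%:R).
pose W (j : 'I_d) : ncps F d := \sum_i invmx Lam j i *: V i.
have sW j : small 1 (W j).
  by apply: small_sum => i _; apply/smallZ/small_lin.
exists (subst_unit sW); split; first exact: subst_unitM.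
apply: (model_unique m_gt0 L_lt) => [i|i|i].
- rewrite -(morphX (subst_unitM sW)) model_rel // (morph_shift_word _ _ _ (subst_unitM sW)).
  by [].
- rewrite -(morphX munit_mapM) model_rel ?unitmx1 //.
  by rewrite (morph_shift_word _ _ _ munit_mapM).
apply/val_inj; rewrite /= !model_gen ?unitmx1 // substD ?subst1 ?subst_linE //.
rewrite sum_scale_invmx //; apply/funext => -[|a [|b w]];
  rewrite /ncps_map !ncpsD !ncps1 /lin /= ?mxE ?addr0 ?add0r ?rmorph1 ?rmorph0 //.
by rewrite rmorph_nat.
Qed.

End BaseChange.

Section Order.
Variables (R : realFieldType) (G : groupType) (phi : F2 -> G) (w : F2).
Hypotheses (phiM : {morph phi : u v / (u * v)%g}) (phi_surj : forall g, exists u, phi u = g).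
Hypothesis phi_ker : forall u, phi u = 1%g <-> normal_closure (fun v => v = w) u.
Variables (n m : nat) (L : seq (nat * int)) (mu : 'I_n.+1 -> R) (k : int).
Local Notation d := n.+1.
Hypotheses (m_gt0 : (0 < m)%N) (L_lt : forall le, le \in L -> (le.1 < d)%N).
Hypothesis a_gcd : forall p, prime p ->
  exists2 l, (l < d)%N & ~~ (p %| exponent_sum L l)%Z.
Hypothesis muE : m%:R *: 'X^d - \sum_(l < d) (exponent_sum L l)%:~R *: 'X^l =
  m%:R *: \prod_(j < d) ('X - (mu j)%:P).
Hypothesis mu_gt0 : forall j, 0 < mu j.
Hypothesis w_deg : tdeg w = 0.
Hypothesis w_rel : forall (H : groupType) (X : int -> H) (i : int),
  ev X w (i - k) = 1%g <-> (X (i + d%:Z) ^+ m = power_word (fun l => X (i + l%:Z)) L)%g.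

Local Notation xR := (model L (krylov_mx mu) m_gt0).
Local Notation xQ := (model L (1%:M : 'M[rat]_d) m_gt0).
Local Notation nat_ext x := (fun i : int => x `|i|%N).
Local Notation evR := (ev (nat_ext xR)).

Let conj_x (i : int) : G := (phi x_ ^ expgz (phi t_) i)%g.

Lemma ev_conj_x f i : tdeg f = 0 -> ev conj_x f i = 1%g <-> phi f = 1%g.
Proof.
move=> f0; rewrite (ev_conj f i phiM) f0 sub0r expgzN; split=> [->|E].
  by rewrite mulg1 mulgV.
by have /(congr1 (fun g => (expgz (phi t_) i)^-1 * g * expgz (phi t_) i)%g) := E; rewrite !mulgA mulVg mul1g mulgVK mulg1 mulVg.
Qed.

Lemma conj_x_rel i : (conj_x (i + d)%N ^+ m)%g = shift_word conj_x i L.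
Proof.
rewrite PoszD; apply/w_rel/ev_conj_x => //; apply/phi_ker.
by apply: gen_in; exists w, 1%g; rewrite conjg1.
Qed.

(** [tower_inj] is applied to the pairs of a conjugate of x in G and the corresponding rational
    series; for large i the word meets non-negative indices only, where the pairs satisfy the
    relations. *)
Lemma evR_inj f : tdeg f = 0 -> eventually (fun i => evR f i = 1%g -> phi f = 1%g).
Proof.
move=> f0; have [T [TM Tx]] := model_transfer (@ratr R) m_gt0 (krylov_unit mu) L_lt.
pose xi (i : nat) : (G * munit rat d)%type := (conj_x i, xQ i).
have xi_rel i : (xi (i + d)%N ^+ m)%g = shift_word xi i L.
  have fstM : {morph (fun u : (G * munit rat d)%type => u.1) : u v / (u * v)%g} by [].
  have sndM : {morph (fun u : (G * munit rat d)%type => u.2) : u v / (u * v)%g} by [].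
  rewrite [LHS]surjective_pairing [RHS]surjective_pairing; congr (_, _).
    rewrite (morphX fstM) (morph_shift_word _ _ _ fstM); exact: conj_x_rel.
  rewrite (morphX sndM) (morph_shift_word _ _ _ sndM).
  by rewrite [LHS](model_rel m_gt0 (unitmx1 _ _) L_lt).
have xi_gen (i : 'I_d) : gen_unit i (xi i).2.
  rewrite /gen_unit /= model_gen ?unitmx1 //; congr (_ + lin _).
  by apply/funext => j; rewrite mxE.
have agree (i : int) : 0 <= i -> conj_x i = (xi `|i|%N).1 by case: i.
apply: eventually_impl (ev_eventually f agree) => i Ei evR1.
have [N gN] := ev_gen xi f i.
have evQ1 : ev (nat_ext xQ) f i = 1%g.
  apply: (@munit_map_eq1 _ _ (@ratr R)); rewrite (ev_morph _ _ _ (munit_mapM (ratr : {rmorphism rat -> R}) (d := d))).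
  rewrite (_ : _ \o _ = T \o nat_ext xR); last by apply/funext => j; rewrite /= Tx.
  by rewrite -(ev_morph _ _ _ TM) evR1 (morph1 TM).
have fstM : {morph (fun u : (G * munit rat d)%type => u.1) : u v / (u * v)%g} by [].
have sndM : {morph (fun u : (G * munit rat d)%type => u.2) : u v / (u * v)%g} by [].
have := tower_inj m_gt0 L_lt a_gcd xi_rel xi_gen gN.
rewrite (ev_morph _ _ _ sndM) => /(_ evQ1) b1.
apply/(ev_conj_x i f0); rewrite Ei.
by rewrite -[LHS](ev_morph (nat_ext xi) f i fstM) b1.
Qed.

Definition fpos f : Prop :=
  0 < tdeg f \/ tdeg f = 0 /\ eventually (fun i => upos (evR f i)).

Lemma fpos_ker f : phi f = 1%g -> ~ fpos f.
Proof.
have evw : eventually (fun i => evR w i = 1%g).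
  exists (- k) => i le_i; rewrite -(addrK k i); apply/w_rel.
  have: 0 <= i + k by rewrite -lerBlDr sub0r.
  by case: (i + k) => // j _; apply: (model_rel m_gt0 (krylov_unit mu) L_lt j).
move=> /phi_ker/(ev_normal_closure w_deg evw)[f0 [i1 f1]].
case=> [|[_ [i2 f2]]]; first by rewrite f0 ltxx.
have := f2 (Num.max i1 i2); rewrite f1 ?le_max ?lexx ?orbT // => /(_ isT).
exact: upos1.
Qed.

Lemma fposM f g : fpos f -> fpos g -> fpos (f * g)%g.
Proof.
rewrite /fpos tdegM => -[f_gt0|[f0 pf]] [g_gt0|[g0 pg]].
- by left; rewrite addr_gt0.
- by left; rewrite g0 addr0.
- by left; rewrite f0 add0r.
right; rewrite f0 g0; split=> //; apply: eventually_impl (eventually_and pf pg) => i [pfi pgi].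
by rewrite evM f0 subr0; apply: uposM.
Qed.

Lemma fposJ f g : fpos f -> fpos (f ^ g)%g.
Proof.
rewrite /fpos tdegJ => -[|[f0 pf]]; [by left | right; split=> //].
apply: eventually_impl (eventually_shift (tdeg g) pf) => i pfi.
by rewrite evJ //; apply: uposJ.
Qed.

(** On non-negative indices the shift is the substitution, which preserves positivity by
    [upos_model_shift]. *)
Lemma evR_shift f : eventually (fun i => upos (evR f i) -> upos (evR f (i + 1))).
Proof.
pose T := subst_unit (small_model_sub L (krylov_mx mu) m_gt0).
have TM : {morph T : g h / (g * h)%g} by apply: subst_unitM.
have Tx (i : int) : 0 <= i -> (T \o nat_ext xR) i = xR `|(i + 1)%R|%N.
  by case: i => // i _ /=; rewrite addn1.
apply: eventually_impl (ev_eventually f Tx) => i Ei pfi.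
rewrite -ev_shift -Ei -(ev_morph _ _ _ TM).
exact: (upos_model_shift m_gt0 L_lt muE mu_gt0).
Qed.

(** In t-degree 0 the sign is decided at a single large index i0: triviality there gives triviality
    in G, and [evR_shift] carries a sign to all later indices. *)
Lemma fpos_total f : [\/ fpos f, phi f = 1%g | fpos f^-1%g].
Proof.
have [f_lt0|f_gt0|f0] := ltgtP (tdeg f) 0.
- by apply: Or33; left; rewrite tdegV oppr_gt0.
- by apply: Or31; left.
have [i0 Pi0] := eventually_and (evR_inj f0) (eventually_and (evR_shift f) (evR_shift f^-1%g)).
have up g : upos (evR g i0) -> (forall i : int, i0 <= i -> upos (evR g i) -> upos (evR g (i + 1))) ->
    eventually (fun i => upos (evR g i)).
  move=> pg stepg; exists i0 => i le_i; rewrite -(subrK i0 i) addrC.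
  have: 0 <= i - i0 by rewrite subr_ge0.
  case: (i - i0) => // j _; elim: j => [|j IHj]; first by rewrite addr0.
  rewrite -[j.+1]addn1 PoszD addrA; apply: stepg IHj; lia.
have [E|nE] := eqVneq (evR f i0) 1%g.
  by apply: Or32; apply: (Pi0 i0 _).1 E.
have [pf|pV] := upos_total nE.
  by apply: Or31; right; split=> //; apply: up => // i /Pi0[_ []].
apply: Or33; right; rewrite tdegV f0 oppr0; split=> //; apply: up => [|i /Pi0[_ []] //].
by rewrite evV f0 addr0.
Qed.

Lemma order_of_presentation : bi_orderable G.
Proof.
exists (fun u v => exists2 f, phi f = (u^-1 * v)%g & fpos f); split.
- by move=> u [f]; rewrite mulVg => /fpos_ker.
- move=> u v z [f Ef pf] [g Eg pg]; exists (f * g)%g; last exact: fposM.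
  by rewrite phiM Ef Eg mulgA mulgK.
- move=> u v; have [f Ef] := phi_surj (u^-1 * v)%g.
  case: (fpos_total f) => [pf|f1|pf]; [by apply: Or31; exists f| |].
    by apply: Or32; rewrite -[LHS]mulg1 -f1 Ef mulVKg.
  by apply: Or33; exists f^-1%g => //; rewrite (morphV phiM) Ef invgM invgK.
move=> u v g [f Ef pf]; split; last first.
  by exists f => //; rewrite Ef invgM mulgA mulgVK.
have [h Eh] := phi_surj g; exists (f ^ h)%g; last exact: fposJ.
by rewrite conjgE !phiM (morphV phiM) Ef Eh invgM !mulgA.
Qed.

End Order.

Lemma tdegX f n : tdeg (f ^+ n)%g = tdeg f *+ n.
Proof. by elim: n => [|n IHn]; rewrite ?tdeg1 // expgS tdegM IHn mulrS. Qed.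

Lemma tdeg_expgz f k : tdeg (expgz f k) = k * tdeg f.
Proof.
by case: k => n /=; rewrite ?tdegV tdegX -mulr_natl ?NegzE ?mulNr natz.
Qed.

Section EvWords.
Variables (H : groupType) (X : int -> H).

Lemma ev_prod (I : Type) (s : seq I) (F : I -> F2) i : (forall j, tdeg (F j) = 0) ->
  tdeg (\prod_(j <- s) F j)%g = 0 /\
  ev X (\prod_(j <- s) F j)%g i = (\prod_(j <- s) ev X (F j) i)%g.
Proof.
move=> F0; elim: s => [|j s [IH0 IH1]]; first by rewrite !big_nil tdeg1 ev1.
by rewrite !big_cons tdegM evM !F0 subr0 IH0 IH1.
Qed.

Lemma ev_expgz_x k i : ev X (expgz x_ k) i = expgz (X i) k.
Proof.
have evX n j : ev X (x_ ^+ n)%g j = (X j ^+ n)%g.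
  by elim: n => [|n IHn]; rewrite ?ev1 // !expgS evM ev_x tdeg_x subr0 IHn.
by case: k => n /=; rewrite ?evV ?tdegX ?tdeg_x ?mul0rn ?addr0 evX.
Qed.

Lemma ev_expgz_t k i : ev X (expgz t_ k) i = 1%g.
Proof.
have evX n j : ev X (t_ ^+ n)%g j = 1%g.
  by elim: n j => [|n IHn] j; rewrite ?ev1 // expgS evM ev_t IHn mulg1.
by case: k => n /=; rewrite ?evV evX ?invg1.
Qed.

Lemma ev_term k e i : ev X (expgz x_ k ^ expgz t_ e)%g i = expgz (X (i + e)) k.
Proof.
by rewrite evJ ?tdeg_expgz ?tdeg_x ?mulr0 // tdeg_t mulr1 ev_expgz_t conjg1 ev_expgz_x.
Qed.

End EvWords.

Lemma power_word_inv (G : groupType) (I : Type) (x : I -> G) (L : seq (I * int)) :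
  power_word x (rev [seq (le.1, - le.2) | le <- L]) = (power_word x L)^-1%g.
Proof.
rewrite /power_word; elim: L => [|le L IHL]; first by rewrite !big_nil invg1.
by rewrite map_cons rev_cons -cats1 big_cat big_seq1 IHL big_cons invgM expgzN.
Qed.

Lemma exponent_sum_inv L l :
  exponent_sum (rev [seq (le.1, - le.2) | le <- L]) l = - exponent_sum L l.
Proof.
by rewrite /exponent_sum (perm_big _ (introT permPl (perm_rev _))) big_map sumrN.
Qed.

Lemma wpoly_coef r (m d : 'I_r -> int) l : (forall j, low m d <= d j) ->
  (wpoly m d)`_l = \sum_(j | `|d j - low m d|%N == l) m j.
Proof.
move=> low_d; rewrite /wpoly coef_sum big_mkcond [RHS]big_mkcond /=; apply: eq_bigr => j _.
by rewrite low_d coefZ coefXn eq_sym; case: eqP => _; rewrite ?mulr1 ?mulr0.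
Qed.

(** * The relation carried by a principal word *)

Section PrincipalWord.
Variables (w : F2) (r : nat) (m d : 'I_r -> int) (n : nat) (a : 'I_n -> int) (c : int).
Hypotheses (hw : principal m d w) (hdeg : size (wpoly m d) = n.+1).
Hypothesis hA : wpoly m d = \sum_(i < n) a i *: 'X^i - c *: 'X^n.
Local Notation low := (low m d).
Local Notation high := (high m d).

Lemma principal_coef (l : 'I_n) : (wpoly m d)`_l = a l.
Proof.
rewrite hA coefB coefZ coefXn ltn_eqF // mulr0 subr0 coef_sum (bigD1 l) //=.
rewrite coefZ coefXn eqxx mulr1 big1 ?addr0 // => i nil; rewrite coefZ coefXn eq_sym.
by rewrite (negPf (nil : i != l :> nat)) mulr0.
Qed.

Lemma principal_lead : (wpoly m d)`_n = - c.
Proof.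
rewrite hA coefB coefZ coefXn eqxx mulr1 coef_sum big1 ?sub0r // => i _.
by rewrite coefZ coefXn gtn_eqF ?mulr0.
Qed.

Lemma principal_lead_neq0 : c != 0.
Proof.
have := principal_lead; rewrite -[n]/(n.+1.-1) -hdeg -/(lead_coef _) => lead_c.
by rewrite -oppr_eq0 -lead_c lead_coef_eq0 -size_poly_eq0 hdeg.
Qed.

Lemma principal_range j : low <= d j <= high.
Proof.
have [[_ _ _ tidy_w] _] := hw.
have: j \in tau d (d j) by rewrite inE.
have [le_low|] := leP low (d j); have [le_high|] := leP (d j) high; move=> //= out;
  by rewrite tidy_w ?inE ?out ?orbT.
Qed.

Lemma expsum_coef l : (wpoly m d)`_l = expsum m d (low + l%:Z).
Proof.
rewrite wpoly_coef => [|j]; last by have /andP[] := principal_range j.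
apply: eq_bigl => j; have /andP[le_low _] := principal_range j; rewrite inE; apply/eqP/eqP; lia.
Qed.

Lemma principal_high : high = low + n%:Z.
Proof.
have supp_n : low + n%:Z \in supp m d.
  by rewrite mem_supp -expsum_coef principal_lead oppr_eq0 principal_lead_neq0.
have [high_in le_high] := high_supp supp_n.
apply/le_anti; rewrite le_high andbT.
have: (wpoly m d)`_(`|high - low|%N) != 0.
  rewrite expsum_coef -mem_supp (_ : low + _ = high) //.
  by move: le_high; lia.
apply: contraR; rewrite -ltNge => lt_high; apply/eqP/nth_default; rewrite hdeg.
by move: lt_high; lia.
Qed.

(** Only one factor of w has the top exponent, so w = P Y^(-c) Q and w = 1 means Y^c = Q P; this is
    why the factors after j0 come first in [L0]. For c < 0 both sides are inverted, whence the sign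
    of c in the exponent sums. *)
Lemma principal_relation : exists L : seq (nat * int),
  [/\ forall le, le \in L -> (le.1 < n)%N,
      forall l : 'I_n, exponent_sum L l = Num.sg c * a l &
      forall (H : groupType) (X : int -> H) (i : int),
        ev X w (i - low) = 1%g <->
        (X (i + n%:Z) ^+ `|c|%N = power_word (fun l => X (i + l%:Z)) L)%g].
Proof.
have [[[r_gt0 def_w] _ _ _] /eqP/cards1P[j0 tau_high]] := hw.
have tauE j : (d j == high) = (j == j0).
  by have := in_set1 j j0; rewrite -tau_high inE => ->.
have d_j0 : d j0 = high by apply/eqP; rewrite tauE.
have m_j0 : m j0 = - c.
  by rewrite -principal_lead expsum_coef -principal_high /expsum tau_high big_set1.
have c_neq0 := principal_lead_neq0.
have [p1 [p2 [def_s uniq_s]]] : exists p1 p2,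
    index_enum 'I_r = p1 ++ j0 :: p2 /\ uniq (p1 ++ j0 :: p2).
  have := index_enum_uniq 'I_r; case/splitPr: (mem_index_enum j0) => p1 p2 uniq_s.
  by exists p1, p2.
have s_neq j : j \in p2 ++ p1 -> j != j0.
  have := uniq_s; rewrite -cat1s uniq_catCA cat1s /= mem_cat orbC -mem_cat => /andP[j0_out _].
  by apply: contraTneq => ->.
pose L0 := [seq (`|d j - low|%N, m j) | j <- p2 ++ p1].
have L0_lt le : le \in L0 -> (le.1 < n)%N.
  case/mapP=> j /s_neq; rewrite -tauE principal_high => nj -> /=.
  by have := principal_range j; rewrite principal_high; lia.
have L0_sum (l : 'I_n) : exponent_sum L0 l = a l.
  rewrite -principal_coef wpoly_coef => [|j]; last by have /andP[] := principal_range j.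
  rewrite /exponent_sum big_map def_s !big_cat big_cons d_j0 principal_high /= addrC.
  by rewrite ifF //; have := ltn_ord l; lia.
have L0_rel (H : groupType) (X : int -> H) (i : int) : ev X w (i - low) = 1%g <->
    expgz (X (i + n%:Z)) c = power_word (fun l => X (i + l%:Z)) L0.
  have [|_] := @ev_prod H X _ (index_enum 'I_r) (fun j => expgz x_ (m j) ^ expgz t_ (d j))%g (i - low).
    by move=> j; rewrite tdegJ tdeg_expgz tdeg_x mulr0.
  rewrite -def_w => ->; rewrite def_s.
  have E p : (\prod_(j <- p) ev X (expgz x_ (m j) ^ expgz t_ (d j)) (i - low) =
      \prod_(j <- p) expgz (X (i + `|d j - low|%N%:Z)) (m j))%g.
    apply: eq_bigr => j _; rewrite ev_term; congr (expgz (X _) _).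
    by have := principal_range j; lia.
  rewrite E /power_word big_map !big_cat big_cons /= m_j0 d_j0 principal_high expgzN.
  rewrite (_ : `|(low + n%:Z - low)%R|%N = n); last by lia.
  move: (\prod_(j <- p1) _)%g (\prod_(j <- p2) _)%g (expgz _ c) => P Q Y.
  split=> [PYQ|->]; last by rewrite invgM -mulgA mulVg mulg1 mulgV.
  have := congr1 (fun g => Y * (P^-1 * g) * P)%g PYQ.
  by rewrite mulKg mulVKg mulg1 mulgVK.
case: (ltgtP c 0) c_neq0 => // sgn_c _.
  exists (rev [seq (le.1, - le.2) | le <- L0]); split=> [le|l|H X i].
  - by rewrite mem_rev => /mapP[le' le_in -> /=]; apply: L0_lt.
  - by rewrite exponent_sum_inv L0_sum ltr0_sg ?mulN1r.
  rewrite L0_rel power_word_inv; case: c sgn_c => // k _ /=.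
  by split=> [<-|->]; rewrite invgK.
exists L0; split=> // [l|H X i]; first by rewrite L0_sum gtr0_sg ?mul1r.
by rewrite L0_rel; case: c sgn_c.
Qed.

Lemma principal_tdeg : tdeg w = 0.
Proof.
have [[[_ ->] _ _ _] _] := hw.
have [|-> //] := @ev_prod F2 (fun=> 1%g) _ (index_enum 'I_r)
  (fun j => expgz x_ (m j) ^ expgz t_ (d j))%g 0.
by move=> j; rewrite tdegJ tdeg_expgz tdeg_x mulr0.
Qed.

End PrincipalWord.

Theorem theoremD (R : realType) (G : groupType) (w : F2)
    (r : nat) (m d : 'I_r -> int)
    (hw : principal m d w)
    (hG : has_presentation (fun u : F2 => u = w) G)
    (n : nat) (a : 'I_n -> int) (c : int)
    (hn : (1 <= n)%N)
    (hdeg : size (wpoly m d) = n.+1)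
    (hA : wpoly m d = \sum_(i < n) a i *: 'X^i - c *: 'X^n)
    (hgcd : \big[gcdz/0]_(i < n) a i = 1)
    (hdvd : forall i : 'I_n, i.+1 = n -> ~~ (c %| a i)%Z)
    (hroots : forall z : R[i],
       root (map_poly intr (wpoly m d)) z -> exists2 y : R, 0 < y & z = y%:C%C) :
  bi_orderable G.
Proof.
case: n hn a hdeg hA hgcd {hdvd} => // n _ a hdeg hA hgcd.
have [L [L_lt L_sum w_rel]] := principal_relation hw hdeg hA.
have [mu mu_gt0 rootsA] := positive_roots hdeg hroots.
have [phi [phi_surj phi_ker]] := hG.
have phiM : {morph phi : u v / (u * v)%g} by move=> u v; apply: gmulfM.
have c_neq0 := principal_lead_neq0 hdeg hA.
have c_gt0 : (0 < `|c|)%N by rewrite absz_gt0.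
have sg_sg : Num.sg c * Num.sg c = 1 by rewrite -expr2 sqr_sg c_neq0.
apply: (order_of_presentation phiM phi_surj phi_ker c_gt0 L_lt _ _ mu_gt0
  (principal_tdeg hw) w_rel) => [p p_pr|].
  (* The sign of c is a unit, so a prime dividing all exponent sums would divide all a i, hence
     their gcd 1. *)
  apply: contrapT => no_l; have: (p %| \big[gcdz/0]_(i < n.+1) a i)%Z.
    elim/big_rec: _ => [|i g _ pg]; first exact: dvdz0.
    rewrite dvdz_gcd pg andbT; apply/negPn/negP => pai; apply: no_l; exists i => //.
    rewrite L_sum; apply: contra pai => p_sga.
    by rewrite -[a i]mul1r -sg_sg -mulrA dvdz_mull.
  by rewrite hgcd dvdz1 /=; case: p p_pr {no_l} => [|[|]].
have lead_A : lead_coef (wpoly m d) = - c by rewrite lead_coefE hdeg (principal_lead hA).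
(* Multiplication by minus the sign of c makes the leading coefficient |c| and turns the a l into
   the exponent sums of L. *)
have := congr1 (fun q : {poly R} => - (Num.sg c)%:~R *: q) rootsA.
rewrite lead_A hA scalerA -intrN -intrM mulrNN -normrEsg -abszE => <-.
rewrite rmorphB /= map_polyZ rmorphXn /= map_polyX rmorph_sum /= scalerBr scalerA.
rewrite -intrM mulNr -normrEsg -abszE !mulrNz !scaleNr opprK [RHS]addrC; congr (_ - _).
rewrite scaler_sumr; apply: eq_bigr => l _.
by rewrite map_polyZ rmorphXn /= map_polyX scalerA -intrM L_sum.
Qed.
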